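(* Let $(U,\rho)$ be a complete metric space, let $g\in\widetilde W(\mathbb{R},U)$, and let $F\in\widetilde W_1(\mathbb{R},(\mathrm{cl}\,U,\mathrm{dist}_{\rho'}))$. Suppose that for all $\varepsilon>0$ the set $$\mathcal{T}(\varepsilon)=\mathcal{P}^{(\rho')}_1(\varepsilon;g)\cap\mathcal{P}^{(\mathrm{dist}_{\rho'})}_1(\varepsilon;F)$$ is relatively dense in $\mathbb{R}$. Then for any $\delta>0$ and any function $h\in W_1(\mathbb{R},\mathbb{R})$ whose (countable) frequency module $\mathrm{Mod}\,h$ is dense in $\mathbb{R}$ (for such a function $h$ the set $\mathcal{T}(\varepsilon)\cap\mathcal{P}^{(\rho_{\mathbb{R}})}_1(\varepsilon;h)$ is relatively dense for all $\varepsilon>0$) there exists a function $f_\delta\in\widetilde W(\mathbb{R},U)$ such that $f_\delta(t)\in F(t)$ for almost every $t\in\mathbb{R}$, $$\rho(f_\delta(t),g(t))<\rho(g(t),F(t))+\delta\quad\text{for almost every } t\in\mathbb{R},$$ and for any $\varepsilon'>0$ there is a number $\varepsilon>0$ such that $$\mathcal{P}^{(\rho')}_1(\varepsilon';f_\delta)\supseteq\mathcal{T}(\varepsilon)\cap\mathcal{P}^{(\rho_{\mathbb{R}})}_1(\varepsilon;h).$$ Furthermore, if $F\in M^*_p(\mathbb{R},\mathrm{cl}_b\,U)$ for some $p\geq1$, then $f_\delta\in\widetilde W(\mathbb{R},U)\cap M^*_p(\mathbb{R},U)\subseteq\widetilde W_p(\mathbb{R},U)$.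
   Context: Let $(V,\sigma)$ be a complete metric space with a fixed point $v_0\in V$, and let $p\geq 1$. $M_p(\mathbb{R},V)=M_p(\mathbb{R},(V,\sigma))$ is the set of (strongly) measurable functions $f:\mathbb{R}\to V$ with $\sup_{\xi\in\mathbb{R}}\int_\xi^{\xi+1}\sigma^p(f(t),v_0)\,dt<+\infty$. For $f,g\in M_p(\mathbb{R},V)$ and $l>0$ put $$D^{(\sigma)}_{p,l}(f,g)=\Bigl(\sup_{\xi\in\mathbb{R}}\frac1l\int_\xi^{\xi+l}\sigma^p(f(t),g(t))\,dt\Bigr)^{1/p},\qquad D^{(\sigma)}_p(f,g)=\lim_{l\to+\infty}D^{(\sigma)}_{p,l}(f,g).$$ For $\varepsilon>0$ and $f\in M_p(\mathbb{R},V)$, $\tau\in\mathbb{R}$ is an $(\varepsilon,D^{(\sigma)}_{p,l})$-almost period of $f$ if $D^{(\sigma)}_{p,l}(f(\cdot),f(\cdot+\tau))<\varepsilon$, and $$\mathcal{P}^{(\sigma)}_p(\varepsilon;f)=\{\tau\in\mathbb{R}:D^{(\sigma)}_p(f(\cdot),f(\cdot+\tau))<\varepsilon\}.$$ A set $T\subseteq\mathbb{R}$ is relatively dense if there is $a>0$ such that $[\xi,\xi+a]\cap T\neq\emptyset$ for all $\xi\in\mathbb{R}$. For a Lebesgue measurable set $T\subseteq\mathbb{R}$, $$\varkappa_W(T)=\lim_{l\to+\infty}\sup_{\xi\in\mathbb{R}}\frac1l\,\mathrm{meas}([\xi,\xi+l]\cap T),$$ where $\mathrm{meas}$ is Lebesgue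 measure. $M^*_p(\mathbb{R},V)$ is the set of $f\in M_p(\mathbb{R},V)$ such that for any $\varepsilon>0$ there is $\delta>0$ such that for all measurable $T\subseteq\mathbb{R}$ with $\varkappa_W(T)<\delta$ one has $\lim_{l\to+\infty}\sup_{\xi\in\mathbb{R}}\frac1l\int_{[\xi,\xi+l]\cap T}\sigma^p(f(t),v_0)\,dt<\varepsilon$. $W_p(\mathbb{R},V)$ (Weyl almost periodic functions of order $p$) is the set of $f\in M_p(\mathbb{R},V)$ such that for any $\varepsilon>0$ there is $l=l(\varepsilon,f)>0$ for which the set of $(\varepsilon,D^{(\sigma)}_{p,l})$-almost periods of $f$ is relatively dense. $\widetilde W_p(\mathbb{R},V)=\widetilde W_p(\mathbb{R},(V,\sigma))$ is the set of $f\in M_p(\mathbb{R},V)$ such that: 1) $\mathcal{P}^{(\sigma)}_p(\varepsilon;f)$ is relatively dense for all $\varepsilon>0$; 2) for any $\varepsilon,\delta>0$ there is a compact set $K_{\varepsilon,\delta}\subseteq V$ such that $\varkappa_W(\{t\in\mathbb{R}:\sigma(f(t),K_{\varepsilon,\delta})\geq\varepsilon\})<\delta$. For the metric space $(U,\rho)$: $\rho'(x,y)=\min\{1,\rho(x,y)\}$; $\widetilde W(\mathbb{R},U)=\widetilde W_1(\mathbb{R},(U,\rho'))$; $\rho(x,A)=\inf_{y\in A}\rho(x,y)$ for nonempty $A\subseteq U$. $(\mathrm{cl}\,U,\mathrm{dist}_{\rho'})$ is the metric space of nonempty closed subsets of $(U,\rho)$ with the Hausdorff metric $\mathrm{dist}_{\rho'}$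 corresponding to $\rho'$; $(\mathrm{cl}_b\,U,\mathrm{dist}_\rho)$ is the metric space of nonempty closed bounded subsets of $(U,\rho)$ with the Hausdorff metric $\mathrm{dist}_\rho$ corresponding to $\rho$, and $M^*_p(\mathbb{R},\mathrm{cl}_b\,U)$ is taken with respect to $\mathrm{dist}_\rho$. The spaces $M^*_p(\mathbb{R},U)$ and $\widetilde W_p(\mathbb{R},U)$ are taken with respect to $\rho$. $\rho_{\mathbb{R}}(x,y)=|x-y|$ is the usual metric on $\mathbb{R}$, and $W_1(\mathbb{R},\mathbb{R})$ is taken with respect to it. For $h\in W_1(\mathbb{R},\mathbb{R})$, $\mathrm{Mod}\,h$ is the additive group of all $\lambda\in\mathbb{R}$ such that $e^{\mathrm{i}\lambda\tau_j}\to1$ as $j\to+\infty$ for every sequence $\{\tau_j\}_{j\in\mathbb{N}}\subset\mathbb{R}$ with $D^{(\rho_{\mathbb{R}}')}_1(h(\cdot),h(\cdot+\tau_j))\to0$, where $\rho_{\mathbb{R}}'=\min\{1,\rho_{\mathbb{R}}\}$; it coincides with the frequency module of $h$. *)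

(* Defs.v *)
From HB Require Import structures.
From mathcomp Require Import all_boot all_order all_algebra.
From mathcomp Require Import all_classical all_reals all_analysis.
From mathcomp Require Import complex.
Set Implicit Arguments.
Unset Strict Implicit.
Unset Printing Implicit Defensive.
Import Order.TTheory GRing.Theory Num.Theory.
Import numFieldNormedType.Exports.
Local Open Scope classical_set_scope.
Local Open Scope ring_scope.

Section metric_spaces.
Context {R : realType}.

(* The library's completeType also fixes a point; here completeness is a
   property of the uniform structure alone. *)
Definition complete_space (V : metricType R) : Prop :=
  forall G : set_system V, ProperFilter G -> cauchy G -> exists x : V, G --> x.

(* Only meaningful for nonempty A: inf set0 = 0. *)
Definition dist_set (V : metricType R) (x : V) (A : set V) : R :=
  inf [set mdist x y | y in A].

Definition metric_bounded (V : metricType R) (A : set V) : Prop :=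
  exists M : R, forall x y, A x -> A y -> mdist x y <= M.

(* Only meaningful for nonempty bounded A and B: sup of an unbounded set is 0. *)
Definition hausdorff_dist (V : metricType R) (A B : set V) : R :=
  Num.max (sup [set dist_set x B | x in A]) (sup [set dist_set y A | y in B]).

End metric_spaces.

Section hausdorff_lemmas.
Context {R : realType} (V : metricType R).
Implicit Types (A B C : set V) (x y : V).

Lemma dist_set_has_inf x A : A !=set0 -> has_inf [set mdist x y | y in A].
Proof.
move=> [a Aa]; split; first by exists (mdist x a), a.
by exists 0 => _ [y _ <-]; exact: mdist_ge0.
Qed.

Lemma dist_set_ge0 x A : A !=set0 -> 0 <= dist_set x A.
Proof.
move=> A0; apply: lb_le_inf; first exact: (dist_set_has_inf x A0).1.
by move=> _ [y _ <-]; exact: mdist_ge0.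
Qed.

Lemma dist_set_le x A y : A y -> dist_set x A <= mdist x y.
Proof.
move=> Ay; apply: ge_inf; last by exists y.
by exists 0 => _ [z _ <-]; exact: mdist_ge0.
Qed.

Lemma dist_set_triangle x y A : A !=set0 ->
  dist_set x A <= mdist x y + dist_set y A.
Proof.
move=> A0; rewrite -lerBlDl; apply: lb_le_inf.
  exact: (dist_set_has_inf y A0).1.
move=> _ [z Az <-]; rewrite lerBlDl.
exact: le_trans (dist_set_le x Az) (metric_triangle _ _ _).
Qed.

Let excess A B := sup [set dist_set x B | x in A].

Let excess_ub A B x : metric_bounded A -> B !=set0 -> A x ->
  dist_set x B <= excess A B.
Proof.
move=> [M AM] [b Bb] Ax; apply: ub_le_sup; last by exists x.
exists (M + mdist x b) => _ [y Ay <-].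
apply: le_trans (dist_set_le y Bb) _.
by apply: le_trans (metric_triangle y x b) _; rewrite lerD2r AM.
Qed.

Let excess_le A B r : A !=set0 -> (forall x, A x -> dist_set x B <= r) ->
  excess A B <= r.
Proof.
move=> [a Aa] h; apply: ge_sup; first by exists (dist_set a B), a.
by move=> _ [x Ax <-]; exact: h.
Qed.

Let excess_triangle A B C : A !=set0 -> B !=set0 -> C !=set0 ->
  metric_bounded A -> metric_bounded B ->
  excess A C <= excess A B + excess B C.
Proof.
move=> A0 B0 C0 bA bB; apply: excess_le => // x Ax.
rewrite -lerBlDr; apply: le_trans (excess_ub bA B0 Ax).
apply: lb_le_inf; first exact: (dist_set_has_inf x B0).1.
move=> _ [y By <-]; rewrite lerBlDr.
apply: le_trans (dist_set_triangle x y C0) _.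
by rewrite lerD2l excess_ub.
Qed.

Lemma hausdorff_dist_sym A B : hausdorff_dist A B = hausdorff_dist B A.
Proof. by rewrite /hausdorff_dist maxC. Qed.

Lemma hausdorff_distxx A : A !=set0 -> metric_bounded A ->
  hausdorff_dist A A = 0.
Proof.
move=> A0 bA; rewrite /hausdorff_dist maxxx.
apply/eqP; rewrite eq_le; apply/andP; split.
  apply: excess_le => // x Ax.
  by rewrite (le_trans (dist_set_le x Ax))// mdistxx.
have [a Aa] := A0.
exact: le_trans (dist_set_ge0 a A0) (excess_ub bA A0 Aa).
Qed.

Lemma hausdorff_dist_triangle B A C : A !=set0 -> B !=set0 -> C !=set0 ->
  metric_bounded A -> metric_bounded B -> metric_bounded C ->
  hausdorff_dist A C <= hausdorff_dist A B + hausdorff_dist B C.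
Proof.
move=> A0 B0 C0 bA bB bC; rewrite /hausdorff_dist ge_max; apply/andP; split.
  apply: le_trans (excess_triangle A0 B0 C0 bA bB) _.
  by apply: lerD; rewrite le_max lexx.
apply: le_trans (excess_triangle C0 B0 A0 bC bB) _.
by rewrite addrC; apply: lerD; rewrite le_max lexx orbT.
Qed.

Lemma dist_set0_closed x A : closed A -> A !=set0 -> dist_set x A <= 0 -> A x.
Proof.
move=> cA A0 xA; apply: cA => N; rewrite -filter_from_ballE => -[e /= e0 eN].
have [_ [y Ay <-] ye] := inf_adherent e0 (dist_set_has_inf x A0).
exists y; split => //; apply: eN; rewrite ballEmdist/=.
by apply: lt_le_trans ye _; rewrite -[leRHS]add0r lerD2r.
Qed.

Lemma hausdorff_dist_eq0 A B : closed A -> closed B ->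
  A !=set0 -> B !=set0 -> metric_bounded A -> metric_bounded B ->
  hausdorff_dist A B = 0 -> A = B.
Proof.
move=> cA cB A0 B0 bA bB AB.
have /andP[AB0 BA0] : (excess A B <= 0) && (excess B A <= 0).
  by rewrite -ge_max -/(hausdorff_dist A B) -[leRHS]AB.
apply/seteqP; split => x xA; apply: dist_set0_closed => //.
  exact: le_trans (excess_ub bA B0 xA) AB0.
exact: le_trans (excess_ub bB A0 xA) BA0.
Qed.

End hausdorff_lemmas.

(* The same points as V, with the metric min(1, mdist). *)
Definition truncated {R : realType} (V : metricType R) : Type := V.

Section truncated_metric.
Context {R : realType} (V : metricType R).

Definition truncated_mdist (x y : V) : R := Num.min 1 (mdist x y).

Let truncated_mdistxx x : truncated_mdist x x = 0.
Proof. by rewrite /truncated_mdist mdistxx min_r. Qed.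

Let truncated_mdist_positivity x y : truncated_mdist x y = 0 -> x = y.
Proof.
rewrite /truncated_mdist; case: (leP 1 (mdist x y)) => _.
  by move/eqP; rewrite oner_eq0.
exact: mdist_positivity.
Qed.

Let truncated_mdist_sym x y : truncated_mdist x y = truncated_mdist y x.
Proof. by rewrite /truncated_mdist metric_sym. Qed.

Let truncated_mdist_triangle y x z :
  truncated_mdist x z <= truncated_mdist x y + truncated_mdist y z.
Proof.
rewrite /truncated_mdist ge_min.
have := metric_triangle x y z.
have := mdist_ge0 x y; have := mdist_ge0 y z.
case: (leP 1 (mdist x y)) => [_|_]; case: (leP 1 (mdist y z)) => [_|_].
- by rewrite lerDl ler01.
- by move=> ? _ _; rewrite lerDl; apply/orP; left.
- by move=> _ ? _; rewrite lerDr; apply/orP; left.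
- by move=> _ _ ->; rewrite orbT.
Qed.

HB.instance Definition _ := Choice.copy (truncated V) V.
HB.instance Definition _ := @isMetric.Build R (truncated V) truncated_mdist
  truncated_mdistxx truncated_mdist_positivity truncated_mdist_sym
  truncated_mdist_triangle.

Lemma truncated_bounded (A : set (truncated V)) : metric_bounded A.
Proof.
by exists 1 => x y _ _; rewrite /mdist/= /truncated_mdist ge_min lexx.
Qed.

Lemma truncated_closed (A : set V) : closed A -> closed (A : set (truncated V)).
Proof.
move=> cA x xA; apply: cA => N; rewrite -filter_from_ballE => -[e /= e0 eN].
have e1 : 0 < Num.min 1 e by rewrite lt_min ltr01.
have := xA _ (nbhsx_ballx (x : truncated V) _ e1).
rewrite ballEmdist => -[y [Ay /= xy]]; exists y; split => //.
apply: eN; rewrite ballEmdist/=; move: xy.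
rewrite /mdist/= /truncated_mdist lt_min => /andP[].
rewrite gt_min ltxx/= => xy1; rewrite min_r; last exact: ltW.
by [].
Qed.

End truncated_metric.

(* cl V, the nonempty closed subsets of V, with the Hausdorff metric
   corresponding to min(1, mdist). *)
Record closed_set {R : realType} (V : metricType R) := ClosedSet {
  closed_set_val : set V ;
  closed_set_closed : closed closed_set_val ;
  closed_set_nonempty : closed_set_val !=set0 }.

(* cl_b V, the nonempty closed bounded subsets of V, with the Hausdorff metric
   corresponding to mdist. *)
Record bounded_closed_set {R : realType} (V : metricType R) :=
  BoundedClosedSet {
  bounded_closed_set_val : set V ;
  bounded_closed_set_closed : closed bounded_closed_set_val ;
  bounded_closed_set_nonempty : bounded_closed_set_val !=set0 ;
  bounded_closed_set_bounded : metric_bounded bounded_closed_set_val }.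

Section hyperspaces.
Context {R : realType} (V : metricType R).

Lemma closed_set_inj (A B : closed_set V) :
  closed_set_val A = closed_set_val B -> A = B.
Proof.
case: A B => [A cA A0] [B cB B0] /= AB; subst B.
by congr ClosedSet; exact: Prop_irrelevance.
Qed.

Lemma bounded_closed_set_inj (A B : bounded_closed_set V) :
  bounded_closed_set_val A = bounded_closed_set_val B -> A = B.
Proof.
case: A B => [A cA A0 bA] [B cB B0 bB] /= AB; subst B.
by congr BoundedClosedSet; exact: Prop_irrelevance.
Qed.

Definition closed_set_mdist (A B : closed_set V) : R :=
  hausdorff_dist (closed_set_val A : set (truncated V)) (closed_set_val B).

Definition bounded_closed_set_mdist (A B : bounded_closed_set V) : R :=
  hausdorff_dist (bounded_closed_set_val A) (bounded_closed_set_val B).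

Let closed_set_mdistxx A : closed_set_mdist A A = 0.
Proof.
apply: hausdorff_distxx; last exact: truncated_bounded.
exact: (closed_set_nonempty A).
Qed.

Let closed_set_mdist_positivity A B : closed_set_mdist A B = 0 -> A = B.
Proof.
move=> AB; apply/closed_set_inj; apply: (hausdorff_dist_eq0 _ _ _ _ _ _ AB).
- exact: (@truncated_closed R V _ (@closed_set_closed R V A)).
- exact: (@truncated_closed R V _ (@closed_set_closed R V B)).
- exact: (closed_set_nonempty A).
- exact: (closed_set_nonempty B).
- exact: truncated_bounded.
- exact: truncated_bounded.
Qed.

Let closed_set_mdist_sym A B : closed_set_mdist A B = closed_set_mdist B A.
Proof. exact: hausdorff_dist_sym. Qed.

Let closed_set_mdist_triangle B A C :
  closed_set_mdist A C <= closed_set_mdist A B + closed_set_mdist B C.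
Proof.
apply: hausdorff_dist_triangle; try exact: truncated_bounded.
- exact: (closed_set_nonempty A).
- exact: (closed_set_nonempty B).
- exact: (closed_set_nonempty C).
Qed.

HB.instance Definition _ := gen_eqMixin (closed_set V).
HB.instance Definition _ := gen_choiceMixin (closed_set V).
HB.instance Definition _ := @isMetric.Build R (closed_set V) closed_set_mdist
  closed_set_mdistxx closed_set_mdist_positivity closed_set_mdist_sym
  closed_set_mdist_triangle.

Let bounded_closed_set_mdistxx A : bounded_closed_set_mdist A A = 0.
Proof. by apply: hausdorff_distxx; case: A. Qed.

Let bounded_closed_set_mdist_positivity A B :
  bounded_closed_set_mdist A B = 0 -> A = B.
Proof.
move=> AB; apply/bounded_closed_set_inj.
by apply: (hausdorff_dist_eq0 _ _ _ _ _ _ AB); clear AB; case: A; case: B.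
Qed.

Let bounded_closed_set_mdist_sym A B :
  bounded_closed_set_mdist A B = bounded_closed_set_mdist B A.
Proof. exact: hausdorff_dist_sym. Qed.

Let bounded_closed_set_mdist_triangle B A C :
  bounded_closed_set_mdist A C <=
  bounded_closed_set_mdist A B + bounded_closed_set_mdist B C.
Proof. by apply: hausdorff_dist_triangle; case: A; case: B; case: C. Qed.

HB.instance Definition _ := gen_eqMixin (bounded_closed_set V).
HB.instance Definition _ := gen_choiceMixin (bounded_closed_set V).
HB.instance Definition _ := @isMetric.Build R (bounded_closed_set V)
  bounded_closed_set_mdist bounded_closed_set_mdistxx
  bounded_closed_set_mdist_positivity bounded_closed_set_mdist_sym
  bounded_closed_set_mdist_triangle.

End hyperspaces.

(* Lebesgue (not Borel) measurable subsets of the line. *)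
Notation lebesgue_sets R :=
  (caratheodory_type (wlength (@idfun R))^*%mu).
Notation meas := completed_lebesgue_measure.

Section weyl.
Context {R : realType}.
Local Open Scope ereal_scope.

Definition lebesgue_measurable (T : set R) : Prop :=
  measurable (T : set (lebesgue_sets R)).

Definition ae_line (P : R -> Prop) : Prop :=
  {ae @meas R, forall t, P t}.

Definition integral_line (D : set R) (f : R -> \bar R) : \bar R :=
  \int[@meas R]_(t in (D : set (lebesgue_sets R))) f t.

Definition simple_function (V : Type) (s : R -> V) : Prop :=
  finite_set (range s) /\ forall v, lebesgue_measurable (s @^-1` [set v]).

(* An almost everywhere limit of finitely valued measurable functions. *)
Definition strongly_measurable (V : metricType R) (f : R -> V) : Prop :=
  exists s : nat -> R -> V, (forall n, simple_function (s n)) /\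
    ae_line (fun t => s n t @[n --> \oo] --> f t).

Definition shift (V : Type) (f : R -> V) (tau : R) : R -> V :=
  fun t => f (t + tau)%R.

Definition sup_mean (T : set R) (u : R -> \bar R) (l : R) : \bar R :=
  ereal_sup [set l^-1%:E * integral_line (`[xi, (xi + l)%R] `&` T) u
            | xi in [set: R]].

(* By subadditivity in l, the limits below exist whenever the means are finite
   for l = 1; lim is otherwise unspecified. *)
Definition kappaW (T : set R) : \bar R :=
  lim (ereal_sup [set l^-1%:E * meas (`[xi, (xi + l)%R] `&` T)
                 | xi in [set: R]] @[l --> +oo%R]).

Definition relatively_dense (T : set R) : Prop :=
  exists2 a : R, (0 < a)%R & forall xi : R, (`[xi, (xi + a)%R] `&` T) !=set0.

Section metric_valued.
Context {V : metricType R}.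
Implicit Types (p : R) (f g : R -> V).

Definition dist_pow p f g : R -> \bar R :=
  fun t => ((mdist (f t) (g t)) `^ p)%:E.

Definition Mp p (v0 : V) : set (R -> V) := [set f | strongly_measurable f /\
  ereal_sup [set integral_line `[xi, (xi + 1)%R] (dist_pow p f (cst v0))
            | xi in [set: R]] < +oo].

Definition Dpl p (l : R) f g : \bar R :=
  (sup_mean setT (dist_pow p f g) l) `^ p^-1.

Definition Dp p f g : \bar R := lim (Dpl p l f g @[l --> +oo%R]).

Definition periods_l p (l eps : R) f : set R :=
  [set tau | Dpl p l f (shift f tau) < eps%:E].

Definition periods p (eps : R) f : set R :=
  [set tau | Dp p f (shift f tau) < eps%:E].

Definition Mstar p (v0 : V) : set (R -> V) := [set f | Mp p v0 f /\
  forall eps : R, (0 < eps)%R -> exists2 delta : R, (0 < delta)%R &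
    forall T : set R, lebesgue_measurable T -> kappaW T < delta%:E ->
      lim (sup_mean T (dist_pow p f (cst v0)) l @[l --> +oo%R]) < eps%:E].

Definition Wp p (v0 : V) : set (R -> V) := [set f | Mp p v0 f /\
  forall eps : R, (0 < eps)%R ->
    exists2 l : R, (0 < l)%R & relatively_dense (periods_l p l eps f)].

Definition Wtilde_p p (v0 : V) : set (R -> V) := [set f | [/\ Mp p v0 f,
  forall eps : R, (0 < eps)%R -> relatively_dense (periods p eps f) &
  forall eps delta : R, (0 < eps)%R -> (0 < delta)%R ->
    exists K : set V, [/\ compact K, K !=set0 &
      kappaW [set t | (eps <= dist_set (f t) K)%R] < delta%:E]]].

End metric_valued.

Section truncated_valued.
Context {V : metricType R}.

Definition periods_trunc (eps : R) (f : R -> V) : set R :=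
  periods 1 eps (f : R -> truncated V).

Definition Wtilde (v0 : V) : set (R -> V) :=
  [set f | Wtilde_p 1 (v0 : truncated V) (f : R -> truncated V)].

End truncated_valued.

(* The set T(eps) of common almost periods of g and F. *)
Definition common_periods (U : metricType R) (g : R -> U)
    (F : R -> closed_set U) (eps : R) : set R :=
  periods_trunc eps g `&` periods 1 eps F.

Definition expi (x : R) : R[i] := (cos x +i* sin x)%C.

(* R^o carries the metric |x - y|; convergence of exp(i lambda tau_j) is in the
   topology of the complex modulus. *)
Definition Mod (h : R -> R^o) : set R := [set lambda |
  forall tau : nat -> R,
    Dp 1 (h : R -> truncated R^o) (shift h (tau j)) @[j --> \oo] --> 0 ->
    expi (lambda * tau j)%R @[j --> \oo] --> (1%R : R[i]^o)].

End weyl.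

(* Main.v *)
Require Import Defs.
From mathcomp Require Import all_boot all_order all_algebra.
From mathcomp Require Import all_classical all_reals all_analysis.
From mathcomp Require Import measurable_realfun.
From mathcomp Require Import complex ring lra zify.

(** The selection [f] is a uniform limit of functions of finitely many integer
    codes, which record with increasing precision where [g t] and [F t] are.
    From the codes of [g t] and of [F t] at the coarsest scale one picks a point
    of a closed set near [F t] that almost realises the distance to [g t], and
    then moves it in geometrically decreasing steps so that it stays in the
    closed sets coded at the finer scales; the limit lies in [F t]
    ([almost_periodic_selection]).  Such a limit is strongly measurable and
    tight, and it inherits the almost periods of its codes
    ([coded_strongly_measurable], [coded_tight], [coded_periods]).  So all rests
    on coding a tight Weyl almost periodic function [phi] by integers in an
    almost periodic way ([quantization_exists]).

    The natural code of [phi t] is the first [j] such that [phi t] is closer than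
    some threshold to [v j], where the points [v j] are dense in the essential
    range; by tightness large codes are rare.  The code changes under a small
    perturbation of [phi] where a distance is near the threshold, and with a
    fixed threshold this set need not have a small upper mean.  So the threshold
    is moved: it is [eta * (3 / 4 + theta t / 8)], where [theta t] is the sum of
    the [8 ^- k * cos (lam_k * t)] and the [lam_k] are frequencies of [h].  They
    decrease so fast that some almost periods [sigma_0], ..., [sigma_3] of [phi]
    and of the first [k] terms turn the [k]-th term by nearly 0, 1, 2 and 3
    quarters.  Translations by them hardly affect the distances, but at most
    three of them leave the threshold near a given value at the scale of the
    [k]-th term.  Combining [n] consecutive terms gives 4 ^ n almost periods of
    which at most 3 ^ n leave the threshold near a given value
    ([dither_exists]).  An upper mean does not exceed the upper mean of an
    average of translates ([mean_le_average]), so the set where the threshold is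
    critical has a small upper mean ([threshold_band_small]).

    Three facts about [h] enter.  Its translates are totally bounded in the
    mean, which colours the line with finitely many colours such that points of
    the same colour differ by an almost period of [h]; hence [g], [F] and [h]
    have relatively dense sets of common almost periods ([finite_colouring],
    [common_relatively_dense]).  Density of [Mod h] gives arbitrarily small
    frequencies [lam_k].  Finally, two frequencies that nearly fix the same
    almost periods are separated, because their difference would otherwise turn
    some almost period by one to three quarters; so [Mod h] is countable ([Mod_separated]).

    For the order [p], the distance of [f t] from a fixed point is bounded by
    that of [F t] from a fixed set up to a constant, so the condition that
    defines [Mstar] passes from [F] to [f] ([selection_Mstar]).  It makes the
    set where [f] and a translate are far apart negligible also for the [p]-th
    powers of the distances ([Mstar_periods]). *)

Set Implicit Arguments.
Unset Strict Implicit.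
Unset Printing Implicit Defensive.
Import Order.TTheory GRing.Theory Num.Theory.
Import numFieldNormedType.Exports.
Local Open Scope classical_set_scope.
Local Open Scope ring_scope.

(** * Lebesgue measure and translations *)

Notation shift := Defs.shift.

(** The cast selects the Lebesgue sets, instead of the Borel sets, as the
    measurable sets of the line. *)
Notation lebesgue_fun u :=
  (measurable_fun (setT : set (lebesgue_sets _)) (u : lebesgue_sets _ -> _)).

Section translation.
Context {R : realType}.
Local Open Scope ereal_scope.
Implicit Types (A : set R) (s a b : R).

Definition translate s A : set R := [set t | A (t + s)%R].

Lemma translateD s r A : translate s (translate r A) = translate (s + r) A.
Proof. by apply/seteqP; split => t; rewrite /translate/= addrA. Qed.

Lemma translate0 A : translate 0 A = A.
Proof. by apply/seteqP; split => t; rewrite /translate/= addr0. Qed.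

Lemma translate_itvoc s a b : translate s `]a, b] = `](a - s)%R, (b - s)%R]%classic.
Proof.
by apply/seteqP; split => t; rewrite /translate/= !in_itv/= ltrBlDr lerBrDr.
Qed.

Let outer_translate_le s A :
  ((wlength (@idfun R))^*)%mu (translate s A) <= ((wlength (@idfun R))^*)%mu A.
Proof.
apply: le_ereal_inf_tmp => _ [B [mB AB] <-]; apply: ereal_inf_lbound => /=.
exists (fun k => translate s (B k)).
  split.
    move=> i; have [[a b] _ <-] := mB i.
    by exists ((a - s)%R, (b - s)%R) => //=; rewrite translate_itvoc.
  by move=> t /AB[k _ Bk]; exists k.
apply: eq_eseriesr => i _; have [[a b] _ <-] /= := mB i.
rewrite translate_itvoc !wlength_itv/= !lte_fin ltrD2r.
by case: ifP => // _; rewrite -!EFinB; congr (_%:E); ring.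
Qed.

Lemma outer_translate s A :
  ((wlength (@idfun R))^*)%mu (translate s A) = ((wlength (@idfun R))^*)%mu A.
Proof.
apply/eqP; rewrite eq_le outer_translate_le/=.
rewrite -{1}[A](translate0 A) -(subrr s) -(addrC (- s)%R) -translateD.
exact: outer_translate_le.
Qed.

Lemma meas_translate s A : @meas R (translate s A) = meas A.
Proof. exact: outer_translate. Qed.

Lemma translate_setI s A B : translate s (A `&` B) = translate s A `&` translate s B.
Proof. by []. Qed.

(** A set is Lebesgue measurable when it satisfies the criterion of
    Caratheodory, which speaks only of the translation invariant outer
    measure. *)
Lemma lebesgue_measurable_translate s A :
  lebesgue_measurable A -> lebesgue_measurable (translate s A).
Proof.
move=> mA; have {}mA : ((wlength (@idfun R))^*)%mu.-caratheodory A := mA.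
suff: ((wlength (@idfun R))^*)%mu.-caratheodory (translate s A) by [].
move=> X; have XE : X = translate s (translate (- s) X).
  by rewrite translateD subrr translate0.
rewrite {}XE -[~` _]/(translate s (~` A)) -!translate_setI !outer_translate.
rewrite -(outer_translate (- s) X); exact: mA.
Qed.

Lemma meas_itvcc a b : (a <= b)%R -> @meas R `[a, b] = (b - a)%:E.
Proof.
move=> ab; transitivity (lebesgue_measure (`[a, b]%classic : set R)); first by [].
rewrite lebesgue_measure_itv/= lte_fin; case: ltP => //.
by move=> ba; rewrite (@le_anti _ _ a b) ?ab// subrr.
Qed.

Lemma borel_lebesgue_measurable A : measurable A -> lebesgue_measurable A.
Proof. exact: sub_caratheodory. Qed.

Lemma borel_fun_lebesgue d (T : measurableType d) (u : R -> T) :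
  measurable_fun setT u -> lebesgue_fun u.
Proof.
move=> mu _ B mB; rewrite setTI; apply: borel_lebesgue_measurable.
by rewrite -[_ @^-1` _]setTI; exact: mu.
Qed.

Lemma measurable_window a b : lebesgue_measurable `[a, b].
Proof. by apply: borel_lebesgue_measurable; exact: measurable_itv. Qed.

Lemma measurable_fun_translate s :
  measurable_fun (setT : set (lebesgue_sets R))
    ((fun t : R => t + s)%R : lebesgue_sets R -> lebesgue_sets R).
Proof.
by move=> _ B mB; rewrite setTI; exact: (@lebesgue_measurable_translate s B).
Qed.

Lemma integral_translate s A (u : R -> \bar R) : lebesgue_measurable A ->
  lebesgue_fun u -> (forall t, 0 <= u t) ->
  integral_line (translate s A) (fun t => u (t + s)%R) = integral_line A u.
Proof.
move=> mA mu u0; rewrite /integral_line.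
have mtr := measurable_fun_translate s.
have := @ge0_integral_pushforward _ _ (lebesgue_sets R) (lebesgue_sets R) R _
  mtr (@meas R) A u mA (@measurable_funTS _ _ (lebesgue_sets R) _ A u mu)
  (fun t _ => u0 t).
rewrite /comp/= => <-.
apply: eq_measure_integral => B mB BA.
exact: (meas_translate s B).
Qed.

Lemma ae_lineT (P : R -> Prop) : (forall t, P t) -> ae_line P.
Proof. by move=> Pt; apply: (@aeW _ (lebesgue_sets R)). Qed.

Lemma ae_lineS (P Q : R -> Prop) :
  (forall t, P t -> Q t) -> ae_line P -> ae_line Q.
Proof.
by move=> PQ; apply: (@filterS _ _ (ae_filter_ringOfSetsType (@meas R))).
Qed.

Lemma ae_lineI (P Q : R -> Prop) :
  ae_line P -> ae_line Q -> ae_line (fun t => P t /\ Q t).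
Proof.
by move=> aP aQ; apply: (@filterI _ _ (ae_filter_ringOfSetsType (@meas R))).
 Qed.

Lemma ae_line_forall (P : nat -> R -> Prop) :
  (forall n, ae_line (P n)) -> ae_line (fun t => forall n, P n t).
Proof. by move=> aP; apply: (@ae_foralln _ (lebesgue_sets R)). Qed.

Lemma ae_line_translate s (P : R -> Prop) :
  ae_line P -> ae_line (fun t => P (t + s)%R).
Proof.
move=> [N [mN N0 PN]]; exists (translate s N); split.
- exact: lebesgue_measurable_translate.
- by rewrite [LHS]meas_translate.
- by move=> t /= nP; apply: PN.
Qed.

End translation.

(** * Integrals over windows and upper means *)

Section windows.
Context {R : realType}.
Local Open Scope ereal_scope.
Implicit Types (u v : R -> \bar R) (xi l c : R).

Definition window xi l u : \bar R := integral_line `[xi, (xi + l)%R] u.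

Lemma ae_window_le xi l u v : lebesgue_fun u -> lebesgue_fun v ->
  (forall t, 0 <= u t) -> (forall t, 0 <= v t) ->
  ae_line (fun t => u t <= v t) -> window xi l u <= window xi l v.
Proof.
move=> mu mv u0 v0 uv.
apply: (@ae_ge0_le_integral _ (lebesgue_sets R)) => //.
- exact: measurable_window.
- by apply: measurable_funTS; assumption.
- by apply: measurable_funTS; assumption.
- by apply: ae_lineS uv => t ? _.
Qed.

Lemma window_le xi l u v : lebesgue_fun u -> lebesgue_fun v ->
  (forall t, 0 <= u t) -> (forall t, u t <= v t) ->
  window xi l u <= window xi l v.
Proof.
move=> mu mv u0 uv; apply: ae_window_le => //.
  by move=> t; exact: le_trans (uv t).
exact: ae_lineT.
Qed.

Lemma window_ge0 xi l u : (forall t, 0 <= u t) -> 0 <= window xi l u.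
Proof. by move=> u0; apply: integral_ge0. Qed.

Lemma windowD xi l u v : lebesgue_fun u -> lebesgue_fun v ->
  (forall t, 0 <= u t) -> (forall t, 0 <= v t) ->
  window xi l (fun t => u t + v t) = window xi l u + window xi l v.
Proof.
move=> mu mv u0 v0; rewrite /window /integral_line ge0_integralD//.
- exact: measurable_window.
- by apply: measurable_funTS; assumption.
- by apply: measurable_funTS; assumption.
Qed.

Lemma windowZ xi l (k : R) u : lebesgue_fun u -> (forall t, 0 <= u t) ->
  (0 <= k)%R -> window xi l (fun t => k%:E * u t) = k%:E * window xi l u.
Proof.
move=> mu u0 k0; rewrite /window /integral_line ge0_integralZl//.
- exact: measurable_window.
- exact: (measurable_funTS mu).
Qed.

Lemma window_translate xi l s u : lebesgue_fun u -> (forall t, 0 <= u t) ->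
  window xi l (fun t => u (t + s)%R) = window (xi + s) l u.
Proof.
move=> mu u0; rewrite /window -[RHS](@integral_translate _ s) //; last first.
  exact: measurable_window.
congr integral_line; apply/seteqP; split => t; rewrite /translate/= !in_itv/=;
  by rewrite addrAC !lerD2r.
Qed.

Lemma window_cst xi l c : (0 <= l)%R -> (0 <= c)%R ->
  window xi l (cst c%:E) = (c * l)%:E.
Proof.
move=> l0 c0; rewrite /window /integral_line integral_cst//; last first.
  exact: measurable_window.
by rewrite [X in _ * X](@meas_itvcc R xi (xi + l)) ?lerDl// (addrC xi) addrK -EFinM.
Qed.

Lemma window_indic xi l (A : set R) : lebesgue_measurable A ->
  window xi l (EFin \o \1_A) = meas (`[xi, (xi + l)%R] `&` A).
Proof.
move=> mA; rewrite /window /integral_line integral_indic//; last first.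
  exact: measurable_window.
by rewrite setIC.
Qed.

Lemma window_subset xi l xi' l' u : lebesgue_fun u -> (forall t, 0 <= u t) ->
  (xi' <= xi)%R -> (xi + l <= xi' + l')%R -> window xi l u <= window xi' l' u.
Proof.
move=> mu u0 a b; apply: (@ge0_subset_integral _ (lebesgue_sets R)) => //.
- exact: measurable_window.
- exact: measurable_window.
- by apply: measurable_funTS; assumption.
- move=> t /=; rewrite !in_itv/= => /andP[h1 h2].
  by rewrite (le_trans a h1) (le_trans h2 b).
Qed.

Lemma window_cat xi l l' u : lebesgue_fun u -> (forall t, 0 <= u t) ->
  (0 <= l)%R -> (0 <= l')%R ->
  window xi (l + l') u <= window xi l u + window (xi + l) l' u.
Proof.
move=> mu u0 l0 l'0; rewrite /window addrA.
set b := (xi + l)%R; set c := (b + l')%R.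
have E : `[xi, c]%classic = `[xi, b]%classic `|` `]b, c]%classic.
  by rewrite -itv_bndbnd_setU// bnd_simp ?lerDl.
have mw2 : lebesgue_measurable `]b, c].
  by apply: borel_lebesgue_measurable; exact: measurable_itv.
rewrite {1}/integral_line E ge0_integral_setU//; first last.
- apply/disj_setPS => t [/=]; rewrite !in_itv/= => /andP[_ h] /andP[h' _].
  by move: (lt_le_trans h' h); rewrite ltxx.
- by apply: measurable_funTS; assumption.
- exact: measurable_window.
apply: leeD => //.
apply: (@ge0_subset_integral _ (lebesgue_sets R)) => //.
- exact: measurable_window.
- by apply: measurable_funTS; assumption.
- by move=> t /=; rewrite !in_itv/= => /andP[/ltW -> ->].
Qed.

Lemma window_mulSn xi l n u c : lebesgue_fun u -> (forall t, 0 <= u t) ->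
  (0 <= l)%R -> (forall xi, window xi l u <= c%:E) ->
  window xi (n.+1%:R * l) u <= (n.+1%:R * c)%:E.
Proof.
move=> mu u0 l0 h; elim: n xi => [|n IH] xi; first by rewrite !mul1r.
rewrite -(addn1 n.+1) natrD !mulrDl !mul1r EFinD.
have nl : (0 <= n.+1%:R * l)%R by rewrite mulr_ge0.
by apply: le_trans (window_cat _ mu u0 nl l0) _; exact: leeD.
Qed.

End windows.

Section upper_mean.
Context {R : realType}.
Local Open Scope ereal_scope.
Implicit Types (u v : R -> \bar R) (xi l c : R).

Definition nonneg_fun u := lebesgue_fun u /\ forall t, 0 <= u t.

(** A bound for all long windows instead of a bound for the limit: it needs no
    proof that the limit exists, and it is stable under sums and pointwise
    estimates.  It lies between the strict and the large inequality for the
    limit, see [sup_mean_lim_lt] and [sup_mean_lim_le]. *)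
Definition mean_le u c := exists2 L : R, (0 < L)%R &
  forall l xi, (L <= l)%R -> window xi l u <= (c * l)%:E.

Definition stepanov_bounded u := exists M : R, forall xi, window xi 1 u <= M%:E.

Lemma sup_meanP u l c : (0 < l)%R ->
  (sup_mean setT u l <= c%:E) = `[< forall xi, window xi l u <= (c * l)%:E >].
Proof.
move=> l0; apply/idP/asboolP => [h xi|h].
  have : l^-1%:E * window xi l u <= c%:E.
    apply: le_trans h; apply: ereal_sup_ubound; exists xi => //.
    by rewrite setIT.
  by rewrite muleC lee_pdivrMr// EFinM.
apply: ge_ereal_sup => _ [xi _ <-]; rewrite setIT.
by rewrite muleC lee_pdivrMr// -EFinM; exact: h.
Qed.

Lemma sup_mean_ge0 u l : (0 <= l)%R -> (forall t, 0 <= u t) ->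
  0 <= sup_mean setT u l.
Proof.
move=> l0 u0; apply: (@le_trans _ _ (l^-1%:E * window 0 l u)).
  by rewrite mule_ge0 ?lee_fin ?invr_ge0// window_ge0.
by apply: ereal_sup_ubound; exists 0%R => //; rewrite setIT.
Qed.

Lemma sup_mean_restrict (T : set R) u l :
  sup_mean T u l = sup_mean setT (u \_ T) l.
Proof.
congr ereal_sup; apply/eq_imagel => xi _ /=; congr (_ * _).
by rewrite setIT /integral_line integral_mkcondr.
Qed.

Lemma kappaWE (T : set R) : lebesgue_measurable T ->
  kappaW T = lim (sup_mean setT (EFin \o \1_T) l @[l --> +oo%R]).
Proof.
move=> mT; rewrite /kappaW.
set F := (X in lim (X @ _) = _).
suff -> : F = sup_mean setT (EFin \o \1_T) by [].
apply/funext => l; congr ereal_sup; apply/eq_imagel => xi _ /=.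
by rewrite setIT -/(window _ _ _) window_indic.
Qed.

(** A window of length [l] is covered by [l / l0 + 1] windows of length [l0], so
    a bound for the means at [l0] is nearly a bound for the means at all large
    [l].  As in the lemma of Fekete, the means converge to their infimum. *)
Lemma sup_mean_cvg u : nonneg_fun u -> stepanov_bounded u ->
  exists2 m : R, (0 <= m)%R & (forall l, (0 < l)%R -> m%:E <= sup_mean setT u l) /\
    sup_mean setT u l @[l --> +oo%R] --> m%:E.
Proof.
move=> [mu u0] [M hM].
have bnd l : (0 < l)%R -> sup_mean setT u l < +oo.
  move=> l0; pose n := Num.truncn l.
  have M0 : (0 <= M)%R.
    by rewrite -lee_fin; apply: le_trans (hM 0%R); exact: window_ge0.
  apply: (@le_lt_trans _ _ ((n.+1%:R * M) / l)%:E); last exact: ltry.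
  rewrite sup_meanP//; apply/asboolP => xi; rewrite divfK ?gt_eqF//.
  apply: le_trans (window_mulSn xi n mu u0 ler01 hM).
  apply: window_subset => //; rewrite lerD2l mulr1.
  by apply/ltW; exact: truncnS_gt.
pose m := ereal_inf [set sup_mean setT u l | l in [set l | (0 < l)%R]].
have m0 : 0 <= m.
  by apply: le_ereal_inf_tmp => _ [l /= l0 <-]; apply: sup_mean_ge0 => //; exact: ltW.
have mfin : m \is a fin_num.
  rewrite ge0_fin_numE//; apply: le_lt_trans (bnd 1%R ltr01).
  by apply: ereal_inf_lbound; exists 1%R => //=.
have mle l : (0 < l)%R -> m <= sup_mean setT u l.
  by move=> l0; apply: ereal_inf_lbound; exists l.
have key e : (0 < e)%R -> exists2 L, (0 < L)%R &
    forall l, (L <= l)%R -> sup_mean setT u l <= m + e%:E.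
  move=> e0; have e20 : (0 < e / 2)%R by rewrite divr_gt0.
  have [_ [l0 /= l00 <-] hl0] := lb_ereal_inf_adherent e20 mfin.
  pose c := (fine m + e / 2)%R.
  have c0 : (0 < c)%R by rewrite ltr_wpDl// fine_ge0.
  have hc : forall xi, window xi l0 u <= (c * l0)%:E.
    apply/asboolP; rewrite -sup_meanP// /c EFinD fineK//; exact: ltW.
  exists (2 * l0 * c / e)%R; first by rewrite divr_gt0// !mulr_gt0.
  move=> l hl.
  have l0' : (0 < l)%R.
    by apply: lt_le_trans hl; rewrite divr_gt0// !mulr_gt0.
  rewrite -(fineK mfin) -EFinD sup_meanP//; apply/asboolP => xi.
  pose n := Num.truncn (l / l0).
  apply: (@le_trans _ _ (n.+1%:R * (c * l0))%:E).
    apply: le_trans (window_mulSn xi n mu u0 (ltW l00) hc).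
    apply: window_subset => //; rewrite lerD2l -ler_pdivrMr//.
    by apply/ltW; exact: truncnS_gt.
  rewrite lee_fin.
  have n1 : (n%:R <= l / l0)%R by rewrite truncn_le// divr_ge0// ltW.
  apply: (@le_trans _ _ ((l / l0 + 1) * (c * l0)))%R.
    by rewrite ler_pM2r ?mulr_gt0// -natr1 lerD2r.
  have -> : ((l / l0 + 1) * (c * l0) = c * l + c * l0)%R by field; rewrite gt_eqF.
  move: hl; rewrite ler_pdivrMr// => hl.
  by rewrite /c; rewrite /c in hl; nra.
exists (fine m); first exact: fine_ge0.
split; first by move=> l l0; rewrite fineK// mle.
have near1 : \forall l \near +oo%R, (0 < l :> R)%R by apply: nbhs_pinfty_gt; exact: num_real.
apply/fine_cvgP; split.
  near=> l; rewrite ge0_fin_numE; first by apply: bnd; near: l.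
  by apply: sup_mean_ge0 => //; apply/ltW; near: l.
apply/cvgrPdist_le => e e0; have [L L0 hL] := key _ e0.
near=> l.
have l0 : (0 < l)%R by near: l.
have Ll : (L <= l)%R by near: l; apply: nbhs_pinfty_ge; exact: num_real.
have sf : sup_mean setT u l \is a fin_num.
  by rewrite ge0_fin_numE ?bnd// sup_mean_ge0// ltW.
have h1 : (fine m <= fine (sup_mean setT u l))%R by rewrite fine_le// mle.
have h2 : (fine (sup_mean setT u l) <= fine m + e)%R.
  by rewrite -lee_fin fineK// EFinD fineK// hL.
by rewrite /= ler_distlC h2 andbT (le_trans _ h1)// lerBlDr lerDl ltW.
Unshelve. all: by end_near. Qed.

Lemma sup_mean_lim_le u c : nonneg_fun u -> stepanov_bounded u ->
  mean_le u c -> lim (sup_mean setT u l @[l --> +oo%R]) <= c%:E.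
Proof.
move=> nu bu [L L0 hL]; have [m m0 [_ cm]] := sup_mean_cvg nu bu.
rewrite (cvg_lim _ cm)//.
apply: (cvge_to_le cm); near=> l.
rewrite sup_meanP; last by apply: lt_le_trans L0 _; near: l; by apply: nbhs_pinfty_ge; exact: num_real.
by apply/asboolP => xi; apply: hL; near: l; by apply: nbhs_pinfty_ge; exact: num_real.
Unshelve. all: by end_near. Qed.

Lemma sup_mean_lim_lt u c : nonneg_fun u -> stepanov_bounded u ->
  lim (sup_mean setT u l @[l --> +oo%R]) < c%:E -> mean_le u c.
Proof.
move=> nu bu; have [m m0 [_ cm]] := sup_mean_cvg nu bu.
rewrite (cvg_lim _ cm)// lte_fin => mc.
have /fine_cvgP[fin cfin] := cm.
have /cvgr_lt/(_ c mc) ltc := cfin.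
have : \forall l \near +oo%R, sup_mean setT u l <= c%:E.
  near=> l; rewrite -(@fineK _ (sup_mean setT u l)); last by near: l.
  by rewrite lee_fin ltW//; near: l; exact: ltc.
case=> L [_ hL]; exists (Num.max 1 (L + 1))%R; first by rewrite lt_max ltr01.
move=> l xi; rewrite ge_max => /andP[l1 lL].
have l0 : (0 < l)%R by apply: lt_le_trans l1.
have : sup_mean setT u l <= c%:E by apply: hL; apply: lt_le_trans lL; rewrite ltrDl.
by rewrite sup_meanP// => /asboolP.
Unshelve. all: by end_near. Qed.

End upper_mean.

Section mean_calculus.
Context {R : realType}.
Local Open Scope ereal_scope.
Implicit Types (u v : R -> \bar R) (xi l c k s : R) (A B : set R).

Lemma nonneg_funD u v : nonneg_fun u -> nonneg_fun v ->
  nonneg_fun (fun t => u t + v t).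
Proof.
by move=> [mu u0] [mv v0]; split; [exact: emeasurable_funD|move=> t; exact: adde_ge0].
Qed.

Lemma nonneg_funZ u k : (0 <= k)%R -> nonneg_fun u ->
  nonneg_fun (fun t => k%:E * u t).
Proof.
by move=> k0 [mu u0]; split; [exact: measurable_funeM|move=> t; exact: mule_ge0].
Qed.

Lemma nonneg_fun_sum (I : Type) (r : seq I) (F : I -> R -> \bar R) :
  (forall i, nonneg_fun (F i)) -> nonneg_fun (fun t => \sum_(i <- r) F i t).
Proof.
move=> nF; split; last by move=> t; apply: sume_ge0 => i _; exact: (nF i).2.
by apply: emeasurable_sum => i; exact: (nF i).1.
Qed.

Lemma nonneg_fun_cst c : (0 <= c)%R -> nonneg_fun (cst c%:E).
Proof. by move=> c0; split => //; exact: measurable_cst. Qed.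

Lemma nonneg_fun_translate u s : nonneg_fun u ->
  nonneg_fun (fun t => u (t + s)%R).
Proof.
move=> [mu u0]; split; last by move=> t; exact: u0.
exact: (measurableT_comp mu (measurable_fun_translate s)).
Qed.

Lemma nonneg_fun_indic A : lebesgue_measurable A -> nonneg_fun (EFin \o \1_A).
Proof.
move=> mA; split; last by move=> t; rewrite /= lee_fin.
apply/measurable_EFinP; exact: (@measurable_indic _ (lebesgue_sets R)).
Qed.

Lemma nonneg_fun_restrict u A : lebesgue_measurable A -> nonneg_fun u ->
  nonneg_fun (u \_ A).
Proof.
move=> mA [mu u0]; split; last by move=> t; rewrite /patch; case: ifP.
apply/(measurable_restrictT _ mA) => //; exact: (measurable_funTS mu).
Qed.

Lemma ae_mean_le u v c : nonneg_fun u -> nonneg_fun v ->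
  ae_line (fun t => u t <= v t) -> mean_le v c -> mean_le u c.
Proof.
move=> [mu u0] [mv v0] uv [L L0 h]; exists L => // l xi Ll.
by apply: le_trans (h l xi Ll); exact: ae_window_le.
Qed.

Lemma mean_leS u v c : nonneg_fun u -> nonneg_fun v ->
  (forall t, u t <= v t) -> mean_le v c -> mean_le u c.
Proof. by move=> nu nv uv; apply: ae_mean_le => //; exact: ae_lineT. Qed.

Lemma mean_leW u c c' : (c <= c')%R -> mean_le u c -> mean_le u c'.
Proof.
move=> cc' [L L0 h]; exists L => // l xi Ll.
by apply: le_trans (h l xi Ll) _; rewrite lee_fin ler_wpM2r// (le_trans (ltW L0)).
Qed.

Lemma mean_leD u v c c' : nonneg_fun u -> nonneg_fun v ->
  mean_le u c -> mean_le v c' -> mean_le (fun t => u t + v t) (c + c').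
Proof.
move=> [mu u0] [mv v0] [L L0 h] [L' L'0 h']; exists (Num.max L L').
  by rewrite lt_max L0.
move=> l xi; rewrite ge_max => /andP[Ll L'l].
by rewrite windowD// mulrDl EFinD; apply: leeD; [exact: h|exact: h'].
Qed.

Lemma mean_leZ u k c : (0 <= k)%R -> nonneg_fun u -> mean_le u c ->
  mean_le (fun t => k%:E * u t) (k * c).
Proof.
move=> k0 [mu u0] [L L0 h]; exists L => // l xi Ll.
by rewrite windowZ// -mulrA EFinM; apply: lee_pmul => //; [exact: window_ge0|exact: h].
Qed.

Lemma mean_le_cst c : (0 <= c)%R -> mean_le (cst c%:E) c.
Proof.
move=> c0; exists 1%R => // l xi l1; rewrite window_cst//.
exact: le_trans l1.
Qed.

Lemma mean_le_translate u c s : nonneg_fun u -> mean_le u c ->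
  mean_le (fun t => u (t + s)%R) c.
Proof.
move=> [mu u0] [L L0 h]; exists L => // l xi Ll.
by rewrite window_translate//; exact: h.
Qed.

(** A single window length suffices, at the cost of an arbitrarily small loss:
    the last window of a covering sticks out, but by a bounded length. *)
Lemma mean_le_window u c l : nonneg_fun u -> (0 <= c)%R -> (0 < l)%R ->
  (forall xi, window xi l u <= (c * l)%:E) -> forall c', (c < c')%R -> mean_le u c'.
Proof.
move=> [mu u0] c0 l0 h c' cc'.
have d0 : (0 < c' - c)%R by rewrite subr_gt0.
exists (Num.max l (c * l / (c' - c)))%R; first by rewrite lt_max l0.
move=> l' xi; rewrite ge_max => /andP[ll' hl'].
have l'0 : (0 < l')%R by apply: lt_le_trans ll'.
pose n := Num.truncn (l' / l).
apply: (@le_trans _ _ (n.+1%:R * (c * l))%:E).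
  apply: le_trans (window_mulSn xi n mu u0 (ltW l0) h).
  apply: window_subset => //; rewrite lerD2l -ler_pdivrMr//.
  by apply/ltW; exact: truncnS_gt.
rewrite lee_fin.
have n1 : (n%:R <= l' / l)%R by rewrite truncn_le// divr_ge0// ltW.
apply: (@le_trans _ _ ((l' / l + 1) * (c * l)))%R.
  by rewrite ler_wpM2r ?mulr_ge0 ?(ltW l0)// -natr1 lerD2r.
have -> : ((l' / l + 1) * (c * l) = c * l' + c * l)%R by field; rewrite gt_eqF.
by move: hl'; rewrite ler_pdivrMr// => hl'; nra.
Qed.

(** Chebyshev's inequality for upper means. *)
Lemma mean_le_superlevel u a c : nonneg_fun u -> (0 < a)%R -> mean_le u c ->
  mean_le (EFin \o \1_[set t | a%:E <= u t]) (c / a).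
Proof.
move=> nu a0 h; have [mu u0] := nu.
have mA : lebesgue_measurable [set t | a%:E <= u t].
  have := emeasurable_fun_c_infty (@measurableT _ (lebesgue_sets R)) mu a%:E.
  by rewrite setTI.
apply: (@mean_leS _ (fun t => a^-1%:E * u t)).
- exact: nonneg_fun_indic.
- by apply: nonneg_funZ => //; rewrite invr_ge0 ltW.
- move=> t /=; rewrite indicE; case: (boolP (t \in _)) => [|_].
    by rewrite inE/= => h1; rewrite muleC lee_pdivlMr// mul1e.
  by rewrite mule_ge0// lee_fin invr_ge0 ltW.
- by rewrite mulrC; apply: mean_leZ => //; rewrite invr_ge0 ltW.
Qed.

Lemma mean_le_indicU A B c c' : lebesgue_measurable A -> lebesgue_measurable B ->
  mean_le (EFin \o \1_A) c -> mean_le (EFin \o \1_B) c' ->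
  mean_le (EFin \o \1_(A `|` B)) (c + c').
Proof.
move=> mA mB hA hB.
apply: (@mean_leS _ (fun t => (EFin \o \1_A) t + (EFin \o \1_B) t)).
- by apply: nonneg_fun_indic; exact: measurableU.
- by apply: nonneg_funD; exact: nonneg_fun_indic.
- move=> t /=; rewrite !indicE in_setU -EFinD lee_fin.
  by case: (t \in A); case: (t \in B); rewrite ?addr0 ?add0r// lerDl.
- exact: (mean_leD (nonneg_fun_indic mA) (nonneg_fun_indic mB) hA hB).
Qed.

Lemma mean_le_indicS A B c : lebesgue_measurable A -> lebesgue_measurable B ->
  A `<=` B -> mean_le (EFin \o \1_B) c -> mean_le (EFin \o \1_A) c.
Proof.
move=> mA mB AB; apply: mean_leS; try exact: nonneg_fun_indic.
move=> t /=; rewrite !indicE lee_fin ler_nat.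
case: (boolP (t \in A)) => //; rewrite inE => /AB Bt; by rewrite mem_set.
Qed.

Lemma stepanov_boundedD u v : nonneg_fun u -> nonneg_fun v ->
  stepanov_bounded u -> stepanov_bounded v ->
  stepanov_bounded (fun t => u t + v t).
Proof.
move=> [mu u0] [mv v0] [M hM] [M' hM']; exists (M + M')%R => xi.
by rewrite windowD// EFinD leeD.
Qed.

Lemma stepanov_boundedZ u k : (0 <= k)%R -> nonneg_fun u ->
  stepanov_bounded u -> stepanov_bounded (fun t => k%:E * u t).
Proof.
move=> k0 [mu u0] [M hM]; exists (k * M)%R => xi.
by rewrite windowZ// EFinM lee_pmul// window_ge0.
Qed.

Lemma stepanov_bounded_cst c : (0 <= c)%R -> stepanov_bounded (cst c%:E).
Proof. by move=> c0; exists c => xi; rewrite window_cst// mulr1. Qed.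

Lemma stepanov_bounded_translate u s : nonneg_fun u ->
  stepanov_bounded u -> stepanov_bounded (fun t => u (t + s)%R).
Proof.
by move=> [mu u0] [M hM]; exists M => xi; rewrite window_translate.
Qed.

Lemma ae_stepanov_bounded u v : nonneg_fun u -> nonneg_fun v ->
  ae_line (fun t => u t <= v t) -> stepanov_bounded v -> stepanov_bounded u.
Proof.
move=> [mu u0] [mv v0] uv [M hM]; exists M => xi.
by apply: le_trans (hM xi); exact: ae_window_le.
Qed.

Lemma stepanov_boundedS u v : nonneg_fun u -> nonneg_fun v ->
  (forall t, u t <= v t) -> stepanov_bounded v -> stepanov_bounded u.
Proof. by move=> nu nv uv; apply: ae_stepanov_bounded => //; exact: ae_lineT. Qed.

Lemma stepanov_bounded_indic A : lebesgue_measurable A ->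
  stepanov_bounded (EFin \o \1_A).
Proof.
move=> mA; apply: (@stepanov_boundedS _ (cst 1%:E)).
- exact: nonneg_fun_indic.
- exact: nonneg_fun_cst.
- by move=> t; rewrite /= indicE lee_fin lern1 leq_b1.
- exact: stepanov_bounded_cst.
Qed.

Lemma stepanov_boundedP u : nonneg_fun u ->
  stepanov_bounded u <-> ereal_sup [set window xi 1 u | xi in [set: R]] < +oo.
Proof.
move=> [mu u0]; split => [[M hM]|h].
  apply: (@le_lt_trans _ _ M%:E); last exact: ltry.
  by apply: ge_ereal_sup => _ [xi _ <-].
set S := ereal_sup _ in h.
have S0 : 0 <= S.
  apply: (@le_trans _ _ (window 0 1 u)); first exact: window_ge0.
  by apply: ereal_sup_ubound; exists 0%R.
exists (fine S) => xi; rewrite fineK ?ge0_fin_numE//.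
by apply: ereal_sup_ubound; exists xi.
Qed.

Lemma kappaW_le A c : lebesgue_measurable A -> mean_le (EFin \o \1_A) c ->
  kappaW A <= c%:E.
Proof.
move=> mA h; rewrite (kappaWE mA).
exact: (sup_mean_lim_le (nonneg_fun_indic mA) (stepanov_bounded_indic mA) h).
Qed.

Lemma kappaW_lt A c : lebesgue_measurable A -> kappaW A < c%:E ->
  mean_le (EFin \o \1_A) c.
Proof.
move=> mA; rewrite (kappaWE mA).
exact: (sup_mean_lim_lt (nonneg_fun_indic mA) (stepanov_bounded_indic mA)).
Qed.

End mean_calculus.

(** * Strong measurability *)

Section strong_measurability.
Context {R : realType}.

(** The limit is a pointwise limit off a null set, and every subset of a null set
    is Lebesgue measurable. *)
Lemma ae_cvg_lebesgue_fun (u_ : nat -> R -> R) (u : R -> R) :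
  (forall n, lebesgue_fun (u_ n)) ->
  ae_line (fun t => u_ n t @[n --> \oo] --> u t) -> lebesgue_fun u.
Proof.
move=> mu_ [N [mN N0 uN]].
pose g n : R -> R := u_ n \* \1_(~` N).
have mg n : lebesgue_fun (g n).
  apply: measurable_funM; first exact: mu_.
  by apply: (@measurable_indic _ (lebesgue_sets R)); exact: measurableC.
have mlim : lebesgue_fun (u \* \1_(~` N)).
  apply: (measurable_fun_cvg mg) => t _; rewrite /g /=.
  rewrite indicE; case: (boolP (t \in ~` N)) => [|_].
    rewrite inE => Nt; rewrite mulr1; under eq_fun do rewrite mulr1.
    by apply: contrapT => h; apply: Nt; exact: uN.
  by rewrite mulr0; under eq_fun do rewrite mulr0; exact: cvg_cst.
apply/measurable_EFinP.
apply: (ae_measurable_fun completed_lebesgue_measure_is_complete _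
  (f := EFin \o (u \* \1_(~` N)))); last exact/measurable_EFinP.
exists N; split => // t /= h; apply: contrapT => Nt; apply: h => _.
by rewrite indicE mem_set// mulr1.
Qed.

Lemma simple_fun2_measurable (V W : Type) (s : R -> V) (r : R -> W)
    (H : V -> W -> R) : simple_function s -> simple_function r ->
  lebesgue_fun (fun t => H (s t) (r t)).
Proof.
move=> [fs ms] [fr mr] _ B mB; rewrite setTI.
rewrite (_ : _ @^-1` B = \bigcup_(p in (range s `*` range r) `&`
    [set p | B (H p.1 p.2)]) (s @^-1` [set p.1] `&` r @^-1` [set p.2])).
  apply: (@fin_bigcup_measurable _ (lebesgue_sets R)).
    by apply: finite_setIl; exact: finite_setX.
  by move=> [v w] _; apply: measurableI; [exact: ms|exact: mr].
apply/seteqP; split => [t /= Bt|t [[v w]] /=].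
  by exists (s t, r t) => //=; split => //; split; exists t.
by move=> [_ Bvw] [-> ->].
Qed.

(** The values of [H] along the finitely valued approximations of [f] and [g] are
    measurable for any [H]; sequential continuity carries this to the limit. *)
Lemma strongly_measurable_fun2 (V W : metricType R) (f : R -> V) (g : R -> W)
    (H : V -> W -> R) : strongly_measurable f -> strongly_measurable g ->
  (forall (x_ : nat -> V) (y_ : nat -> W) x y, x_ @ \oo --> x -> y_ @ \oo --> y ->
    H (x_ n) (y_ n) @[n --> \oo] --> H x y) ->
  lebesgue_fun (fun t => H (f t) (g t)).
Proof.
move=> [s [ss sf]] [r [sr rg]] cH.
apply: (@ae_cvg_lebesgue_fun (fun n t => H (s n t) (r n t))).
  by move=> n; exact: simple_fun2_measurable.
by apply: ae_lineS (ae_lineI sf rg) => t [h1 h2]; exact: cH.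
Qed.

Lemma metric_cvgP (V : metricType R) (x_ : nat -> V) (x : V) :
  x_ @ \oo --> x <-> forall e : R, 0 < e -> \forall n \near \oo, mdist x (x_ n) < e.
Proof. exact: metricType_numDomainType.cvgrPdist_lt. Qed.

Lemma mdist_lipschitz (V : metricType R) (x y x' y' : V) :
  `|mdist x y - mdist x' y'| <= mdist x x' + mdist y y'.
Proof.
rewrite ler_norml; have := metric_triangle x x' y; have := metric_triangle x' y' y.
have := metric_triangle x' x y'; have := metric_triangle x y y'.
rewrite (metric_sym x' x) (metric_sym y' y).
by move=> h1 h2 h3 h4; apply/andP; split; lra.
Qed.

Lemma mdist_seq_cvg (V : metricType R) (x_ y_ : nat -> V) x y :
  x_ @ \oo --> x -> y_ @ \oo --> y ->
  mdist (x_ n) (y_ n) @[n --> \oo] --> mdist x y.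
Proof.
move=> /metric_cvgP cx /metric_cvgP cy; apply/cvgrPdist_le => e e0.
have e2 : 0 < e / 2 by rewrite divr_gt0.
near=> n; apply: le_trans (mdist_lipschitz _ _ _ _) _.
by rewrite [leRHS]splitr lerD// ltW//; near: n; [exact: cx|exact: cy].
Unshelve. all: by end_near. Qed.

Lemma dist_set_lipschitz (V : metricType R) (A : set V) x y : A !=set0 ->
  `|dist_set x A - dist_set y A| <= mdist x y.
Proof.
move=> A0; have := dist_set_triangle x y A0; have := dist_set_triangle y x A0.
by rewrite (metric_sym y x) ler_norml => h1 h2; apply/andP; split; lra.
Qed.

Lemma mdist_lebesgue_fun (V : metricType R) (f g : R -> V) :
  strongly_measurable f -> strongly_measurable g ->
  lebesgue_fun (fun t => mdist (f t) (g t)).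
Proof.
by move=> mf mg; apply: strongly_measurable_fun2 => // *; exact: mdist_seq_cvg.
Qed.

Lemma dist_set_lebesgue_fun (V : metricType R) (f : R -> V) (A : set V) :
  A !=set0 -> strongly_measurable f ->
  lebesgue_fun (fun t => dist_set (f t) A).
Proof.
move=> A0 mf.
apply: (@strongly_measurable_fun2 _ _ _ _ (fun x _ => dist_set x A) mf mf).
move=> x_ y_ x y /metric_cvgP cx _; apply/cvgrPdist_lt => e e0.
near=> n; apply: le_lt_trans (dist_set_lipschitz _ _ A0) _.
by near: n; exact: cx.
Unshelve. all: by end_near. Qed.

Lemma simple_function_cst (V : Type) (v : V) : simple_function (cst v : R -> V).
Proof.
split; first by apply: (@sub_finite_set _ _ [set v]) => // _ [t _ <-].
move=> w; have [->|vw] := pselect (v = w).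
  by rewrite (_ : _ @^-1` _ = setT); [exact: measurableT|exact/seteqP].
rewrite (_ : _ @^-1` _ = set0); first exact: measurable0.
by apply/seteqP; split.
Qed.

Lemma strongly_measurable_cst (V : metricType R) (v : V) :
  strongly_measurable (cst v : R -> V).
Proof.
exists (fun _ => cst v); split; first by move=> _; exact: simple_function_cst.
by apply: ae_lineT => t; exact: cvg_cst.
Qed.

Lemma strongly_measurable_shift (V : metricType R) (f : R -> V) tau :
  strongly_measurable f -> strongly_measurable (shift f tau).
Proof.
move=> [s [ss sf]]; exists (fun n => shift (s n) tau); split.
  move=> n; have [fs ms] := ss n; split.
    by apply: sub_finite_set fs => _ [t _ <-]; exists (t + tau).
  by move=> v; exact: (lebesgue_measurable_translate tau (ms v)).
exact: (ae_line_translate tau sf).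
Qed.

Lemma truncated_mdistE (V : metricType R) (x y : V) :
  mdist (x : truncated V) (y : truncated V) = Num.min 1 (mdist x y).
Proof. by []. Qed.

Lemma truncated_mdist_le (V : metricType R) (x y : V) :
  mdist (x : truncated V) (y : truncated V) <= mdist x y.
Proof. by rewrite truncated_mdistE ge_min lexx orbT. Qed.

Lemma truncated_mdist_le1 (V : metricType R) (x y : truncated V) : mdist x y <= 1.
Proof. by rewrite /mdist/= /truncated_mdist ge_min lexx. Qed.

Lemma truncated_mdist_lt (V : metricType R) (x y : V) (e : R) : e <= 1 ->
  (mdist (x : truncated V) (y : truncated V) < e) = (mdist x y < e).
Proof.
by move=> e1; rewrite truncated_mdistE gt_min ltNge e1.
Qed.

Lemma truncated_cvg (V : metricType R) (x_ : nat -> V) (x : V) :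
  (x_ : nat -> truncated V) @ \oo --> (x : truncated V) <-> x_ @ \oo --> x.
Proof.
split => /metric_cvgP h; apply/metric_cvgP => e e0.
  have m0 : 0 < Num.min 1 e by rewrite lt_min ltr01.
  apply: filterS (h _ m0) => n.
  rewrite (truncated_mdist_lt x (x_ n)) ?ge_min ?lexx// lt_min.
  by case/andP.
by apply: filterS (h _ e0) => n; apply: le_lt_trans; exact: truncated_mdist_le.
Qed.

Lemma strongly_measurable_truncated (V : metricType R) (f : R -> V) :
  strongly_measurable (f : R -> truncated V) <-> strongly_measurable f.
Proof.
by split => -[s [ss sf]]; exists s; split => //; apply: ae_lineS sf => t;
  rewrite truncated_cvg.
Qed.

End strong_measurability.

(** * Weyl distances and almost periods *)

Section means_of_distances.
Context {R : realType} {V : metricType R}.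
Implicit Types (f g k : R -> V) (p c eps : R) (v : V).

Lemma powR_add_le (a b p : R) : 0 <= a -> 0 <= b -> 0 <= p ->
  (a + b) `^ p <= 2 `^ p * (a `^ p + b `^ p).
Proof.
wlog ab : a b / a <= b.
  move=> h a0 b0 p0; have [ab|/ltW ba] := leP a b; first exact: h.
  by rewrite addrC [X in _ * X]addrC; exact: h.
move=> a0 b0 p0; apply: (@le_trans _ _ ((2 * b) `^ p)).
  have ab2 : a + b <= 2 * b by lra.
  by apply: ge0_ler_powR; rewrite ?nnegrE ?addr_ge0 ?mulr_ge0.
rewrite powRM//.
by rewrite ler_pM2l ?powR_gt0// lerDr powR_ge0.
Qed.

Definition mdist_fun f g : R -> \bar R := fun t => (mdist (f t) (g t))%:E.

Lemma dist_pow1 f g : dist_pow 1 f g = mdist_fun f g.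
Proof. by apply/funext => t; rewrite /dist_pow powRr1// mdist_ge0. Qed.

Lemma nonneg_dist_pow p f g : strongly_measurable f -> strongly_measurable g ->
  nonneg_fun (dist_pow p f g).
Proof.
move=> mf mg; split; last by move=> t; rewrite lee_fin powR_ge0.
apply/measurable_EFinP.
exact: (measurableT_comp (measurable_powR p) (mdist_lebesgue_fun mf mg)).
Qed.

Lemma nonneg_mdist_fun f g : strongly_measurable f -> strongly_measurable g ->
  nonneg_fun (mdist_fun f g).
Proof. by move=> mf mg; rewrite -dist_pow1; exact: nonneg_dist_pow. Qed.

Lemma MpP p (v0 : V) f : Mp p v0 f <->
  strongly_measurable f /\ stepanov_bounded (dist_pow p f (cst v0)).
Proof.
have mc := strongly_measurable_cst v0.
split=> -[mf h]; (split; first exact: mf).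
  exact/(stepanov_boundedP (nonneg_dist_pow p mf mc)).
exact: ((stepanov_boundedP (nonneg_dist_pow p mf mc)).1 h).
Qed.

Lemma Mp_shift p (v0 : V) f tau : Mp p v0 f -> Mp p v0 (shift f tau).
Proof.
move=> /MpP[mf h]; apply/MpP; split; first exact: strongly_measurable_shift.
have n := nonneg_dist_pow p mf (strongly_measurable_cst v0).
exact: (stepanov_bounded_translate tau n h).
Qed.

Lemma Mp_dist_pow_bounded p (v0 : V) f : Mp p v0 f ->
  stepanov_bounded (dist_pow p f (cst v0)).
Proof. by case/MpP. Qed.

Lemma dist_pow_triangle p f g k t : 0 <= p ->
  (dist_pow p f g t <= (2 `^ p)%:E * (dist_pow p f k t + dist_pow p g k t))%E.
Proof.
move=> p0; rewrite /dist_pow -EFinD -EFinM lee_fin.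
apply: le_trans (powR_add_le (mdist_ge0 _ _) (mdist_ge0 _ _) p0).
apply: ge0_ler_powR => //; rewrite ?nnegrE ?addr_ge0 ?mdist_ge0//.
by rewrite (metric_sym (g t)); exact: metric_triangle.
Qed.

Lemma Mp_stepanov p (v0 : V) f g : 0 <= p -> Mp p v0 f -> Mp p v0 g ->
  stepanov_bounded (dist_pow p f g).
Proof.
move=> p0 Mf Mg; have [mf _] := Mf; have [mg _] := Mg.
have mc := strongly_measurable_cst v0.
have nf := nonneg_dist_pow p mf mc; have ng := nonneg_dist_pow p mg mc.
have nD := nonneg_funD nf ng.
have p2 : 0 <= 2 `^ p by exact: powR_ge0.
apply: (@stepanov_boundedS _ _
  (fun t => (2 `^ p)%:E * (dist_pow p f (cst v0) t + dist_pow p g (cst v0) t))%E).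
- exact: nonneg_dist_pow.
- exact: (nonneg_funZ p2 nD).
- by move=> t; exact: dist_pow_triangle.
- apply: (stepanov_boundedZ p2 nD); apply: (stepanov_boundedD nf ng);
  exact: Mp_dist_pow_bounded.
Qed.

(** The root is increasing and the means stay above their limit, so only the
    upper estimate of the roots uses the convergence. *)
Lemma Dpl_cvg p f g : 0 < p -> nonneg_fun (dist_pow p f g) ->
  stepanov_bounded (dist_pow p f g) ->
  exists2 m : R, 0 <= m &
    (forall l, 0 < l -> (m%:E <= sup_mean setT (dist_pow p f g) l)%E) /\
    sup_mean setT (dist_pow p f g) l @[l --> +oo] --> m%:E /\
    Dpl p l f g @[l --> +oo] --> (m `^ p^-1)%:E.
Proof.
move=> p0 nd bd; have [m m0 [mle cm]] := sup_mean_cvg nd bd.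
exists m => //; split => //; split => //.
have /fine_cvgP[fin cfin] := cm.
set S := sup_mean setT (dist_pow p f g) in mle cm fin cfin.
have near1 : \forall l \near +oo, 0 < l :> R by apply: nbhs_pinfty_gt; exact: num_real.
have pV : 0 < p^-1 by rewrite invr_gt0.
have DE l : S l \is a fin_num -> Dpl p l f g = (fine (S l) `^ p^-1)%:E.
  by move=> h; rewrite -poweR_EFin fineK.
apply/fine_cvgP; split.
  by near=> l; rewrite DE//; near: l.
apply/cvgrPdist_lt => e e0.
pose M := (m `^ p^-1 + e) `^ p.
have me0 : 0 <= m `^ p^-1 + e by rewrite addr_ge0 ?powR_ge0// ltW.
have mM : m < M.
  have {1}-> : m = (m `^ p^-1) `^ p by rewrite -powRrM mulVf ?gt_eqF// powRr1.
  by apply: gt0_ltr_powR => //; rewrite ?nnegrE ?powR_ge0// ltrDl.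
have /cvgr_lt/(_ M mM) ltM := cfin.
near=> l.
have l0 : 0 < l by near: l.
have Sf : S l \is a fin_num by near: l.
have SM : fine (S l) < M by near: l; exact: ltM.
have mS : m <= fine (S l) by rewrite -lee_fin fineK// mle.
rewrite /= DE//=.
have h1 : m `^ p^-1 <= fine (S l) `^ p^-1.
  by apply: ge0_ler_powR => //; rewrite ?nnegrE ?(ltW pV)// (le_trans m0).
have h2 : fine (S l) `^ p^-1 < m `^ p^-1 + e.
  have -> : m `^ p^-1 + e = M `^ p^-1 by rewrite /M -powRrM mulfV ?gt_eqF// powRr1.
  by apply: gt0_ltr_powR => //; rewrite ?nnegrE ?powR_ge0// (le_trans m0).
by rewrite ltr_distlC h2 andbT (lt_le_trans _ h1)// ltrBlDr ltrDl.
Unshelve. all: by end_near. Qed.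

Lemma Dp_lt p c eps f g : 0 < p -> nonneg_fun (dist_pow p f g) ->
  stepanov_bounded (dist_pow p f g) ->
  0 <= c -> mean_le (dist_pow p f g) c -> c `^ p^-1 < eps ->
  (Dp p f g < eps%:E)%E.
Proof.
move=> p0 nd bd c0 h ce; have [m m0 [_ [cS cD]]] := Dpl_cvg p0 nd bd.
rewrite /Dp (cvg_lim _ cD)//.
have := sup_mean_lim_le nd bd h; rewrite (cvg_lim _ cS)// lee_fin => mc.
rewrite lte_fin; apply: le_lt_trans ce.
by apply: ge0_ler_powR; rewrite ?nnegrE ?invr_ge0// ltW.
Qed.

Lemma Dp1E f g : nonneg_fun (mdist_fun f g) -> stepanov_bounded (mdist_fun f g) ->
  Dp 1 f g = lim (sup_mean setT (mdist_fun f g) l @[l --> +oo]).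
Proof.
rewrite -dist_pow1 => nd bd; have [m m0 [_ [cS cD]]] := Dpl_cvg ltr01 nd bd.
by rewrite /Dp (cvg_lim _ cD)// (cvg_lim _ cS)// invr1 powRr1.
Qed.

Lemma Dp1_ge0 f g : nonneg_fun (mdist_fun f g) ->
  stepanov_bounded (mdist_fun f g) -> (0 <= Dp 1 f g)%E.
Proof.
rewrite -dist_pow1 => nd bd; have [m m0 [_ [cS cD]]] := Dpl_cvg ltr01 nd bd.
by rewrite /Dp (cvg_lim _ cD)// invr1 powRr1.
Qed.

Lemma Dp1_le c f g : nonneg_fun (mdist_fun f g) ->
  stepanov_bounded (mdist_fun f g) -> mean_le (mdist_fun f g) c ->
  (Dp 1 f g <= c%:E)%E.
Proof. by move=> nd bd h; rewrite (Dp1E nd bd); exact: sup_mean_lim_le. Qed.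

Lemma Dp1_lt c f g : nonneg_fun (mdist_fun f g) ->
  stepanov_bounded (mdist_fun f g) -> (Dp 1 f g < c%:E)%E ->
  exists2 c', c' < c & mean_le (mdist_fun f g) c'.
Proof.
move=> nd bd h.
have D0 := Dp1_ge0 nd bd.
have Df : Dp 1 f g \is a fin_num by rewrite ge0_fin_numE// (lt_trans h)// ltry.
have dc : fine (Dp 1 f g) < c by rewrite -lte_fin fineK.
exists ((fine (Dp 1 f g) + c) / 2); first by rewrite midf_lt.
apply: (sup_mean_lim_lt nd bd); rewrite -(Dp1E nd bd) -(fineK Df) lte_fin.
by rewrite midf_lt.
Qed.

End means_of_distances.

(** A bounded metric makes the integrability condition void. *)
Lemma Mp_truncated (R : realType) (V : metricType R) (v0 : V) (f : R -> V) :
  strongly_measurable f -> Mp 1 (v0 : truncated V) (f : R -> truncated V).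
Proof.
move=> /strongly_measurable_truncated mf; apply/MpP; split; first exact: mf.
have mc := strongly_measurable_cst (v0 : truncated V).
apply: (stepanov_boundedS (nonneg_dist_pow 1 mf mc) (nonneg_fun_cst ler01)).
- by move=> t; rewrite dist_pow1 lee_fin; exact: truncated_mdist_le1.
- exact: stepanov_bounded_cst.
Qed.

Section almost_periods.
Context {R : realType} {V : metricType R} (v0 : V) (f : R -> V).
Hypothesis Mf : Mp 1 v0 f.
Implicit Types (tau eps c : R).

Let mf : strongly_measurable f. Proof. by case: Mf. Qed.

Lemma nonneg_shift_dist tau : nonneg_fun (mdist_fun f (shift f tau)).
Proof. by apply: nonneg_mdist_fun => //; exact: strongly_measurable_shift. Qed.

Lemma stepanov_shift_dist tau : stepanov_bounded (mdist_fun f (shift f tau)).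
Proof.
by rewrite -dist_pow1; apply: (Mp_stepanov ler01 Mf); exact: Mp_shift.
Qed.

Lemma periods_mean eps tau : periods 1 eps f tau ->
  exists2 c, c < eps & mean_le (mdist_fun f (shift f tau)) c.
Proof. exact: Dp1_lt (nonneg_shift_dist tau) (stepanov_shift_dist tau). Qed.

Lemma mean_periods c eps tau : c < eps ->
  mean_le (mdist_fun f (shift f tau)) c -> periods 1 eps f tau.
Proof.
move=> ce h; rewrite /periods /=.
by rewrite (le_lt_trans (Dp1_le (nonneg_shift_dist tau) (stepanov_shift_dist tau) h)).
Qed.

Lemma periods_le eps eps' : eps <= eps' -> periods 1 eps f `<=` periods 1 eps' f.
Proof. by move=> h tau /= /lt_le_trans; apply; rewrite lee_fin. Qed.

Lemma periods0 eps : 0 < eps -> periods 1 eps f 0.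
Proof.
move=> e0; apply: (@mean_periods 0) => //.
apply: (@mean_leS _ _ (cst 0%:E)) (mean_le_cst (lexx 0)).
- exact: nonneg_shift_dist.
- exact: nonneg_fun_cst.
- by move=> t; rewrite /mdist_fun /Defs.shift addr0 mdistxx.
Qed.

Lemma periodsD eps eps' tau tau' : periods 1 eps f tau -> periods 1 eps' f tau' ->
  periods 1 (eps + eps') f (tau + tau').
Proof.
move=> /periods_mean[c ce hc] /periods_mean[c' c'e hc'].
apply: (@mean_periods (c + c')); first exact: ltrD.
have n1 := nonneg_shift_dist tau.
have n2 := nonneg_fun_translate tau (nonneg_shift_dist tau').
apply: (mean_leS (nonneg_shift_dist _) (nonneg_funD n1 n2)); last first.
  apply: (mean_leD n1 n2 hc).
  exact: (mean_le_translate tau (nonneg_shift_dist tau') hc').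
move=> t; rewrite /mdist_fun /Defs.shift -EFinD lee_fin addrA.
exact: metric_triangle.
Qed.

Lemma periodsN eps tau : periods 1 eps f tau -> periods 1 eps f (- tau).
Proof.
move=> /periods_mean[c ce hc]; apply: (mean_periods ce).
apply: (mean_leS (nonneg_shift_dist _)
  (nonneg_fun_translate (- tau) (nonneg_shift_dist tau))); last first.
  exact: (mean_le_translate (- tau) (nonneg_shift_dist tau) hc).
by move=> t; rewrite /mdist_fun /Defs.shift subrK metric_sym.
Qed.

End almost_periods.

(** * Continuity of translations in the mean *)

Section translation_continuity.
Context {R : realType}.
Implicit Types (A B : set R) (s a b e : R).

Definition translation_continuous A := forall e, 0 < e -> exists2 s0, 0 < s0 &
  forall s, `|s| < s0 -> (meas (translate s A `\` A) <= e%:E)%E.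

Let meas_le A B : A `<=` B -> (@meas R A <= meas B)%E.
Proof. by move=> AB; apply: le_outer_measure. Qed.

Let meas_setU A B : (@meas R (A `|` B) <= meas A + meas B)%E.
Proof. exact: outer_measureU2. Qed.

Lemma meas_translate_itvoc s a b :
  (@meas R (translate s `]a, b] `\` `]a, b]) <= `|s|%:E)%E.
Proof.
rewrite translate_itvoc.
have [s0|/ltW s0] := leP 0 s.
  apply: (@le_trans _ _ (@meas R `[a - s, a])).
    apply: meas_le => t [/=]; rewrite !in_itv/= => /andP[t1 t2] /negP.
    rewrite negb_and -!leNgt -ltNge => /orP[ta|bt]; first by rewrite (ltW t1).
    by exfalso; lra.
  by rewrite meas_itvcc ?gerBl// ger0_norm// lee_fin; lra.
apply: (@le_trans _ _ (@meas R `[b, b - s])).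
  apply: meas_le => t [/=]; rewrite !in_itv/= => /andP[t1 t2] /negP.
  rewrite negb_and -!leNgt -ltNge => /orP[ta|bt]; last by rewrite (ltW bt).
  by exfalso; lra.
by rewrite meas_itvcc ?lerBrDl ?gerDr// ler0_norm// lee_fin; lra.
Qed.

Lemma translation_continuous_bigU (B : nat -> set R) N :
  (forall k, translation_continuous (B k)) ->
  translation_continuous (\big[setU/set0]_(k < N) B k).
Proof.
move=> hB; elim: N => [|N IH] e e0.
  exists 1 => // s _; rewrite big_ord0 setD0.
  by rewrite (_ : translate s set0 = set0)// measure0 lee_fin ltW.
have e2 : 0 < e / 2 by rewrite divr_gt0.
have [s1 s10 h1] := IH _ e2; have [s2 s20 h2] := hB N _ e2.
exists (Num.min s1 s2); first by rewrite lt_min s10.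
move=> s; rewrite lt_min => /andP[/h1 {}h1 /h2 {}h2].
rewrite big_ord_recr/= (splitr e) EFinD.
apply: le_trans (leeD h1 h2); apply: le_trans (meas_setU _ _); apply: meas_le.
move=> t [[h|h] /= nh]; [left|right]; split => // h'; apply: nh; [by left|by right].
Qed.

(** By definition of the outer measure, [A] differs little in measure from a
    finite union of intervals, for which the claim is clear. *)
Lemma measurable_translation_continuous A : lebesgue_measurable A ->
  (@meas R A < +oo)%E -> translation_continuous A.
Proof.
move=> mA Aoo e e0; have e3 : 0 < e / 3 by rewrite divr_gt0.
have Afin : @meas R A \is a fin_num by rewrite ge0_fin_numE// measure_ge0.
have [_ [B [mB AB] <-] hB] := lb_ereal_inf_adherent e3 Afin.
have mB' k : lebesgue_measurable (B k).
  by apply: sub_caratheodory; apply: sub_sigma_algebra; exact: mB.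
pose O := \bigcup_k B k.
have mO : lebesgue_measurable O by apply: bigcupT_measurable.
have hO : (@meas R O <= meas A + (e / 3)%:E)%E.
  apply: le_trans (ltW hB).
  apply: le_trans (outer_measure_sigma_subadditive ((wlength (@idfun R))^*)%mu B) _.
  apply: lee_nneseries => k _ //.
  by rewrite [leLHS]measurable_mu_extE//; exact: mB.
have Ofin : (@meas R O < +oo)%E.
  by apply: le_lt_trans hO _; rewrite lte_add_pinfty// ltry.
have OA : (@meas R (O `\` A) <= (e / 3)%:E)%E.
  rewrite measureD//= setIC setIidl//.
  by rewrite leeBlDr// addeC.
pose ON N := \big[setU/set0]_(k < N) B k.
have mON N : lebesgue_measurable (ON N) by apply: bigsetU_measurable => k _; exact: mB'.
have [N hN] : exists N, (@meas R (O `\` ON N) <= (e / 3)%:E)%E.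
  pose D N := O `\` ON N.
  have mD N : lebesgue_measurable (D N) := measurableD mO (mON N).
  have D0 : \bigcap_N D N = set0.
    apply/seteqP; split => t // /(_ _ Logic.I) hD.
    have [[k _ Bk] _] := hD 0%N; have [_] := hD k.+1; apply.
    by rewrite /ON -bigcup_mkord; exists k => //=.
  have : (@meas R \o D) @ \oo --> 0%E.
    rewrite -(measure0 (@meas R)) -D0.
    apply: (@nonincreasing_cvg_mu _ (lebesgue_sets R) R (@meas R) D).
    - by apply: le_lt_trans Ofin; apply: meas_le => t [].
    - exact: mD.
    - by apply: bigcapT_measurable => N; exact: mD.
    - move=> m n mn; apply/subsetPset => t [Ot nt]; split => // h; apply: nt.
      by apply: subset_bigsetU h.
  move=> /fine_cvgP[Dfin /cvgr_lt/(_ _ e3) Dlt].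
  near \oo => N; exists N.
  rewrite -[leLHS]fineK; last by near: N.
  by rewrite lee_fin ltW//; near: N.
have tc : translation_continuous (ON N).
  apply: translation_continuous_bigU => k r r0; exists r => // s sr.
  have [[a b] _ <-] := mB k.
  by apply: le_trans (meas_translate_itvoc s a b) _; rewrite lee_fin ltW.
have [s0 s00 hs] := tc _ e3; exists s0 => // s /hs {}hs.
have -> : e = e / 3 + (e / 3 + e / 3) by field.
have hN' : (@meas R (translate s (O `\` ON N)) <= (e / 3)%:E)%E.
  by rewrite [leLHS]meas_translate.
rewrite !EFinD; apply: le_trans (leeD hs (leeD hN' OA)).
apply: le_trans (leeD (lexx _) (meas_setU _ _)).
apply: le_trans (meas_setU _ _); apply: meas_le => t [/= tA nA].
have [h|h] := pselect (ON N (t + s)); last first.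
  by right; left; split => //; exact: AB.
have [h'|h'] := pselect (ON N t); last by left.
right; right; split => //; move: h'; rewrite /ON -bigcup_mkord => -[k _ Bk].
by exists k.
Unshelve. all: by end_near. Qed.

End translation_continuity.

Section mean_translation_continuity.
Import HBSimple.
Context {R : realType}.
Implicit Types (s a e xi l : R).

Lemma window_le_in xi l (u v : R -> \bar R) : nonneg_fun u -> nonneg_fun v ->
  (forall t, xi <= t <= xi + l -> (u t <= v t)%E) -> (window xi l u <= window xi l v)%E.
Proof.
move=> [mu u0] [mv v0] uv; apply: (@ge0_le_integral _ (lebesgue_sets R)).
- exact: measurable_window.
- by move=> t _; exact: u0.
- exact: (measurable_funTS mu).
- exact: (measurable_funTS mv).
- by move=> t /=; rewrite in_itv/=; exact: uv.
Qed.

Lemma window_sum (I : Type) (r : seq I) (F : I -> R -> \bar R) xi l :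
  (forall i, nonneg_fun (F i)) ->
  window xi l (fun t => \sum_(i <- r) F i t)%E = (\sum_(i <- r) window xi l (F i))%E.
Proof.
move=> nF; apply: (@ge0_integral_sum _ (lebesgue_sets R)).
- exact: measurable_window.
- by move=> i; exact: (measurable_funTS (nF i).1).
- by move=> i t _; exact: (nF i).2.
Qed.

Lemma nonneg_fun_abs (u : R -> R) : lebesgue_fun u ->
  nonneg_fun (fun t => `|u t|%:E).
Proof.
move=> mu; split; last by move=> t; rewrite lee_fin.
by apply/measurable_EFinP; exact: (measurableT_comp (@normr_measurable R setT) mu).
Qed.

Lemma lebesgue_fun_translate (u : R -> R) s : lebesgue_fun u ->
  lebesgue_fun (fun t => u (t + s)).
Proof. by move=> mu; exact: (measurableT_comp mu (measurable_fun_translate s)). Qed.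

Lemma simple_translation_continuous (g : R -> R) a e :
  lebesgue_fun g -> finite_set (range g) -> 0 < e ->
  exists2 s0, 0 < s0 & forall s, `|s| < s0 ->
    (window 0 a (fun t : R => `|g (t + s)%R - g t|%:E) <= e%:E)%E.
Proof.
move=> mg /finite_seqP[L hL] e0.
pose M := \sum_(v <- L) `|v|.
have gM t : `|g t| <= M.
  have : range g (g t) by exists t.
  rewrite hL /= /M => gL; rewrite (big_rem _ gL) /= lerDl.
  by apply: sumr_ge0.
have M0 : 0 <= M by exact: le_trans (gM 0).
pose A v := (g @^-1` [set v] : set R) `&` `[-1, (a + 1)]%classic.
have mA v : lebesgue_measurable (A v).
  apply: measurableI; last exact: measurable_window.
  by rewrite -[_ @^-1` _]setTI; exact: mg.
have fA v : (@meas R (A v) < +oo)%E.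
  apply: (@le_lt_trans _ _ (@meas R `[-1, (a + 1)])).
    by apply: le_outer_measure => t [].
  have [h|h] := leP (-1) (a + 1); first by rewrite meas_itvcc// ltry.
  by rewrite set_itv_ge ?measure0 ?ltry// bnd_simp -ltNge.
pose d := e / (2 * M + 1) / (size L).+1%:R.
have d0 : 0 < d.
  by rewrite !divr_gt0// ltr_wpDl// mulr_ge0.
have /choice[s0 hs0] : forall v, exists s0, 0 < s0 /\ forall s, `|s| < s0 ->
    (@meas R (translate s (A v) `\` A v) <= d%:E)%E.
  move=> v; have [s0 ? ?] := measurable_translation_continuous (mA v) (fA v) d0.
  by exists s0.
exists (\big[Num.min/1]_(v <- L) s0 v).
  by apply: lt_bigmin => // v _; case: (hs0 v).
move=> s hs.
have s1 : `|s| < 1 := lt_le_trans hs (bigmin_le_id _ _ _ _).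
have mD v : lebesgue_measurable (translate s (A v) `\` A v).
  exact: (measurableD (lebesgue_measurable_translate s (mA v)) (mA v)).
pose F v : R -> \bar R := EFin \o \1_(translate s (A v) `\` A v).
have nF v : nonneg_fun (F v) by exact: nonneg_fun_indic.
have nS := nonneg_fun_sum L nF.
have M20 : 0 <= 2 * M by rewrite mulr_ge0.
apply: (@le_trans _ _ (window 0 a (fun t => (2 * M)%:E * \sum_(v <- L) F v t)%E)).
  apply: window_le_in.
  - exact: (nonneg_fun_abs (measurable_funB (lebesgue_fun_translate s mg) mg)).
  - exact: nonneg_funZ.
  move=> t; rewrite add0r => /andP[t0 ta].
  have [->|gne] := eqVneq (g (t + s)) (g t).
    by rewrite subrr normr0 mule_ge0 ?lee_fin//; exact: nS.2.
  apply: (@le_trans _ _ ((2 * M)%:E * 1)%E).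
    rewrite mule1 lee_fin; apply: le_trans (ler_normB _ _) _.
    by have := gM t; have := gM (t + s); lra.
  apply: lee_wpmul2l; rewrite ?lee_fin//.
  have gL : g (t + s) \in L.
    have : range g (g (t + s)) by exists (t + s).
    by rewrite hL.
  rewrite (big_rem _ gL)/=; apply: (@le_trans _ _ (F (g (t + s)) t)); last first.
    by rewrite leeDl//; apply: sume_ge0 => v _; exact: (nF v).2.
  rewrite /F /= indicE mem_set//; split.
    split => //=; rewrite in_itv/=.
    by move: s1; rewrite ltr_norml => /andP[s1 s2]; apply/andP; split; lra.
  by move=> [/= /esym/eqP]; rewrite (negbTE gne).
rewrite (windowZ 0 a nS.1 nS.2 M20) (window_sum L 0 a nF).
apply: (@le_trans _ _ ((2 * M)%:E * ((size L)%:R * d)%:E)%E).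
  apply: lee_wpmul2l; first by rewrite lee_fin.
  have -> : ((size L)%:R * d)%:E = (\sum_(v <- L) d%:E)%E.
    by rewrite sumEFin big_const_seq count_predT iter_addr addr0 mulr_natl.
  rewrite big_seq [leRHS]big_seq; apply: lee_sum => v vL.
  rewrite window_indic//; apply: (@le_trans _ _ (@meas R (translate s (A v) `\` A v))).
    by apply: le_outer_measure => t [].
  have [_ h] := hs0 v; apply: h; apply: (lt_le_trans hs).
  exact: ge_bigmin_seq.
rewrite -EFinM lee_fin /d.
have -> : 2 * M * ((size L)%:R * (e / (2 * M + 1) / (size L).+1%:R)) =
    e * (2 * M / (2 * M + 1)) * ((size L)%:R / (size L).+1%:R).
  by ring.
rewrite -[leRHS]mulr1; apply: ler_pM.
- by rewrite mulr_ge0 ?(ltW e0)// divr_ge0// addr_ge0.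
- by rewrite divr_ge0.
- by rewrite ler_piMr ?(ltW e0)// ler_pdivrMr ?mul1r ?lerDl// ltr_wpDl.
- by rewrite ler_pdivrMr// mul1r ler_nat.
Qed.

(** On a bounded window, [h] is close in the mean to a function with finitely
    many values, and the claim for the latter is that for its level sets. *)
Lemma mean_translation_continuous (h : R -> R^o) a e : Mp 1 (0 : R^o) h ->
  0 <= a -> 0 < e -> exists2 s0, 0 < s0 & forall s, `|s| < s0 ->
    (window 0 a (mdist_fun h (shift h s)) <= e%:E)%E.
Proof.
move=> Mh a0 e0; have [mh bh] := (MpP _ _ _).1 Mh.
have e3 : 0 < e / 3 by rewrite divr_gt0.
have mhR : lebesgue_fun (h : R -> R).
  have [r [sr rh]] := mh; apply: (ae_cvg_lebesgue_fun (u_ := r)) => // n.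
  exact: (simple_fun2_measurable (fun x _ => x) (sr n) (sr n)).
have a2 : 0 <= a + 2 by rewrite addr_ge0.
(* The larger window contains the translates of [0, a] by [s] with |s| < 1. *)
pose E : set (lebesgue_sets R) := `[-1, (-1 + (a + 2))]%classic.
have mE : measurable E by exact: measurable_window.
have ih : (@meas R).-integrable E (EFin \o (h : lebesgue_sets R -> R)).
  apply/integrableP; split; first exact/measurable_EFinP/measurable_funTS.
  have [M hM] := bh; pose n := Num.truncn (a + 2).
  have nh := nonneg_dist_pow 1 mh (strongly_measurable_cst (0 : R^o)).
  apply: (@le_lt_trans _ _ (window (-1) (a + 2) (dist_pow 1 h (cst (0 : R^o))))).
    rewrite le_eqVlt; apply/orP; left; apply/eqP; apply: eq_integral => t _.
    by rewrite dist_pow1 /mdist_fun /mdist/= sub0r normrN.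
  apply: (@le_lt_trans _ _ (n.+1%:R * M)%:E); last exact: ltry.
  apply: le_trans (window_mulSn (-1) n nh.1 nh.2 ler01 hM).
  apply: (window_subset nh.1 nh.2) => //; rewrite mulr1 lerD2l.
  by apply/ltW; exact: truncnS_gt.
have [g_ [_ _ /fine_cvgP[gfin /cvgr_lt/(_ _ e3) glt]]] := approximation_sfun_integrable mE ih.
have [g [mg fg hg]] : exists g : R -> R, [/\ lebesgue_fun g, finite_set (range g) &
    (window (-1) (a + 2) (fun t => `|h t - g t|%:E) <= (e / 3)%:E)%E].
  near \oo => n; exists (g_ n); split.
  - exact: measurable_funPT.
  - exact: (@fimfunP (lebesgue_sets R) R (g_ n)).
  have -> : window (-1) (a + 2) (fun t => `|h t - g_ n t|%:E) =
    (\int[@meas R]_(z in E) `|(EFin \o h) z - (g_ n z)%:E|)%E.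
    by apply: eq_integral => t _; [].
  rewrite -[leLHS]fineK; last by near: n.
  by rewrite lee_fin ltW//; near: n.
have [s0 s00 hs0] := simple_translation_continuous a mg fg e3.
pose k t := `|h t - g t|%:E.
have nk : nonneg_fun k by apply: nonneg_fun_abs; exact: measurable_funB.
exists (Num.min 1 s0); first by rewrite lt_min ltr01.
move=> s; rewrite lt_min => /andP[s1 /hs0 hs].
have nks := nonneg_fun_translate s nk.
pose w (t : R) := `|g (t + s)%R - g t|%:E.
have nw : nonneg_fun w.
  exact: (nonneg_fun_abs (measurable_funB (lebesgue_fun_translate s mg) mg)).
apply: (@le_trans _ _ (window 0 a (fun t => k (t + s)%R + (w t + k t)))%E).
  apply: window_le.
  - exact: (nonneg_mdist_fun mh (strongly_measurable_shift s mh)).1.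
  - exact: (nonneg_funD nks (nonneg_funD nw nk)).1.
  - by move=> t; rewrite lee_fin mdist_ge0.
  - move=> t; rewrite /k /w -!EFinD lee_fin /mdist/= /Defs.shift.
    have := ler_distD (g (t + s)) (h (t + s)) (h t).
    have := ler_distD (g t) (g (t + s)) (h t); rewrite (distrC (g t) (h t)); lra.
rewrite (windowD _ _ nks.1 (nonneg_funD nw nk).1 nks.2 (nonneg_funD nw nk).2).
rewrite (windowD _ _ nw.1 nk.1 nw.2 nk.2).
have -> : e = e / 3 + (e / 3 + e / 3) by field.
move: s1; rewrite ltr_norml => /andP[s1 s1'].
rewrite !EFinD; apply: leeD; [|apply: leeD => //].
- rewrite (window_translate _ _ _ nk.1 nk.2); apply: le_trans hg.
  by apply: (window_subset nk.1 nk.2); lra.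
- by apply: le_trans hg; apply: (window_subset nk.1 nk.2); lra.
Unshelve. all: by end_near. Qed.

End mean_translation_continuity.

(** * Dithering functions *)

Section geometric_limits.
Context {R : realType}.

Lemma complete_space_line : complete_space (R^o : metricType R).
Proof. by move=> G FG cG; have := @cauchy_cvg R^o G FG cG; exists (lim G). Qed.

(** The bounds telescope, so the sequence is a Cauchy sequence and the limit
    inherits the rate. *)
Lemma telescoping_limit (V : metricType R) (x : nat -> V) (rho : nat -> R) :
  complete_space V -> rho @ \oo --> 0 ->
  (forall n, mdist (x n) (x n.+1) <= rho n - rho n.+1) ->
  exists l, x @ \oo --> l /\ forall n, mdist (x n) l <= rho n.
Proof.
move=> cV rho0 h.
have hm n m : mdist (x n) (x (n + m)%N) <= rho n - rho (n + m)%N.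
  elim: m => [|m IH]; first by rewrite addn0 mdistxx subrr.
  apply: le_trans (metric_triangle _ (x (n + m)%N) _) _.
  by have := h (n + m)%N; rewrite addnS; lra.
have tail n : \forall m \near \oo, mdist (x n) (x m) <= rho n - rho m.
  by near=> m; rewrite -(@subnKC n m) ?hm//; near: m; exact: nbhs_infty_ge.
have rho_ge0 n : 0 <= rho n.
  apply: (cvgr_to_le rho0); near=> m.
  rewrite -subr_ge0; apply: le_trans (mdist_ge0 (x n) (x m)) _; near: m; exact: tail.
have [l xl] : exists l : V, x @ \oo --> l.
  apply: cV; apply: cauchy_exP => e e0.
  have : \forall n \near \oo, rho n < e by apply: (cvgr_lt _ rho0).
  case=> N _ /(_ N (leqnn N)) rN.
  exists (x N); change (\forall p \near \oo, ball (x N) e (x p)).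
  near=> p; rewrite ballEmdist/=.
  apply: (@le_lt_trans _ _ (rho N - rho p)); first by near: p; exact: tail.
  by apply: le_lt_trans rN; rewrite gerBl.
exists l; split => // n.
have /metric_cvgP cl := xl.
apply/ler_addgt0Pr => e e0; near \oo => m.
apply: le_trans (metric_triangle _ (x m) _) _; apply: lerD; last first.
  by rewrite metric_sym ltW//; near: m; exact: cl.
have : mdist (x n) (x m) <= rho n - rho m by near: m; exact: tail.
by move/le_trans; apply; rewrite lerBlDr lerDl.
Unshelve. all: by end_near. Qed.

End geometric_limits.

Section cosine.
Context {R : realType}.

Lemma cos_lipschitz (x y : R) : `|cos x - cos y| <= `|x - y|.
Proof.
wlog yx : x y / y <= x.
  move=> h; have [|/ltW xy] := leP y x; first exact: h.
  by rewrite distrC (distrC x); exact: h.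
have cd (z : R) : z \in `]y, x[%R -> is_derive z 1 (@cos R) (- sin z).
  by move=> _; exact: is_derive_cos.
have [|c _ ->] := MVT_segment yx cd.
  by apply: continuous_subspaceT => z; exact: continuous_cos.
rewrite normrM normrN ler_piMl//.
by rewrite ler_norml sin_geN1 sin_le1.
Qed.

(** The four values are [cos t], [- sin t], [- cos t] and [sin t].  One of
    [cos t] and [sin t] has an absolute value of at least the root of 1/2, which
    exceeds 11/16, and occurs with both signs; one of these two values is at that
    distance from [y]. *)
Lemma quarter_turns_spread (t y : R) :
  exists2 i, (i < 4)%N & 11 / 16 <= `|cos (t + i%:R * (pi / 2)) - y|.
Proof.
apply: contrapT => h.
have {}h i : (i < 4)%N -> `|cos (t + i%:R * (pi / 2)) - y| < 11 / 16.
  by move=> i4; rewrite ltNge; apply/negP => hi; apply: h; exists i.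
have := h 0 isT; have := h 1%N isT; have := h 2 isT; have := h 3 isT.
rewrite mul0r addr0 mul1r cosDpihalf.
have -> : t + 2 * (pi / 2) = t + pi by congr (_ + _); field.
have -> : t + 3 * (pi / 2) = t + pi / 2 + pi by field.
rewrite !cosDpi cosDpihalf opprK !ltr_norml.
move=> /andP[h1 h2] /andP[h3 h4] /andP[h5 h6] /andP[h7 h8].
have := cos2Dsin2 t.
have : cos t ^+ 2 < (11 / 16) ^+ 2.
  by rewrite -real_normK ?num_real// ltr_pXn2r ?nnegrE// ltr_norml; apply/andP; split; lra.
have : sin t ^+ 2 < (11 / 16) ^+ 2.
  by rewrite -real_normK ?num_real// ltr_pXn2r ?nnegrE// ltr_norml; apply/andP; split; lra.
lra.
Qed.

End cosine.

Section dither.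
Context {R : realType}.
Variable S : R -> set R.
Hypothesis S_le : forall e e', e <= e' -> S e `<=` S e'.
Hypothesis S0 : forall e, 0 < e -> S e 0.
Hypothesis SD : forall e e' tau tau', S e tau -> S e' tau' ->
  S (e + e') (tau + tau').
Hypothesis S_dense : forall e, 0 < e -> relatively_dense (S e).

(** As the sets [S e] are relatively dense, a continuous [psi] with this property
    is almost periodic in the sense of Bohr. *)
Definition moduli_dominated (psi : R -> R) := forall eta, 0 < eta ->
  exists2 e, 0 < e & forall tau, S e tau -> forall t,
    `|psi (t + tau) - psi t| <= eta.

Hypothesis small_frequencies : forall m, 0 < m -> exists2 lam : R, 0 < lam < m &
  moduli_dominated (fun t => cos (lam * t)).

Definition amplitude (k : nat) : R := (8^-1) ^+ k.
Local Notation a := amplitude.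

Let a_gt0 k : 0 < a k. Proof. by rewrite exprn_gt0// invr_gt0. Qed.

Let minl (x y : R) : Num.min x y <= x. Proof. by rewrite ge_min lexx. Qed.

Let minr (x y : R) : Num.min x y <= y. Proof. by rewrite ge_min lexx orbT. Qed.

Let aS k : a k.+1 = a k / 8. Proof. by rewrite /amplitude exprSr. Qed.

(** The stage after [k] terms of the sum that defines the dither: the partial sum
    [psi], and a precision [e] so fine that [S e] hardly moves [psi] on the scale
    [a k] of the next term.  The bound [b] forces the precisions to decrease as
    fast as the construction needs. *)
Definition dither_level (b : nat -> R) (z : nat * (R -> R) * R) : Prop :=
  let: (k, psi, e) := z in
  [/\ continuous psi, moduli_dominated psi, 0 < e <= b k &
      forall tau, S e tau -> forall t, `|psi (t + tau) - psi t| <= a k / 16].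

(** The translations by [sigma i] turn the new term by nearly [i] quarters, so
    one of them moves the sum away from any given [x]. *)
Definition dither_step (z z' : nat * (R -> R) * R) : Prop :=
  let: (k, psi, e) := z in let: (k', psi', e') := z' in
  [/\ k' = k.+1, e' <= e / 2, forall t, `|psi' t - psi t| <= a k &
      exists sigma : nat -> R, (forall i, (i < 4)%N -> S (e / 2) (sigma i)) /\
      forall t x, exists2 i, (i < 4)%N & a k / 2 <= `|psi' (t + sigma i) - x|].

Section levels.
Variable b : nat -> R.
Hypothesis b_gt0 : forall k, 0 < b k.

(** The frequency [lam] of the new term is small compared with the inverse of a
    gap [A] of [S (e / 2)], so that some point of this set comes after
    [i * (pi / 2) / lam] so soon that [lam] turns the remainder by 1/8 at most.
    Of the spread 11/16, the errors 1/16 and 1/8 leave the half of [a k]. *)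
Let dither_step_exists (z : {z | dither_level b z}) :
  exists z' : {z | dither_level b z}, dither_step (sval z) (sval z').
Proof.
case: z => -[[k psi] e] /= [cpsi dpsi /andP[e0 eb] hpsi].
have e20 : 0 < e / 2 by rewrite divr_gt0.
have [A A0 hA] := S_dense e20.
have [|lam /andP[lam0 lamA] dlam] := @small_frequencies ((8 * A)^-1).
  by rewrite invr_gt0 mulr_gt0.
pose psi' t := psi t + a k * cos (lam * t).
have cpsi' : continuous psi'.
  move=> t; apply: cvgD; first exact: cpsi.
  apply: cvgM; first exact: cvg_cst.
  apply: continuous_comp; last exact: continuous_cos.
  by apply: cvgM; [exact: cvg_cst|exact: cvg_id].
have dpsi' : moduli_dominated psi'.
  move=> eta eta0; have [|e1 e10 h1] := dpsi (eta / 2); first by rewrite divr_gt0.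
  have [|e2 e2_0 h2] := dlam (eta / 2 / a k); first by rewrite !divr_gt0.
  exists (Num.min e1 e2); first by rewrite lt_min e10.
  move=> tau tauS t.
  have {}h1 := h1 tau (S_le (minl _ _) tauS) t.
  have {}h2 := h2 tau (S_le (minr _ _) tauS) t.
  rewrite /psi' (_ : _ - _ = (psi (t + tau) - psi t) +
    a k * (cos (lam * (t + tau)) - cos (lam * t))); last by ring.
  rewrite (splitr eta); apply: le_trans (ler_normD _ _) _; apply: lerD => //.
  by rewrite normrM gtr0_norm// mulrC -ler_pdivlMr.
have [|e' e'0 he'] := dpsi' (a k.+1 / 16); first by rewrite divr_gt0.
pose e'' := Num.min e' (Num.min (e / 2) (b k.+1)).
have lev : dither_level b (k.+1, psi', e'').
  split => //.
    by rewrite !lt_min e'0 e20 b_gt0 /= /e'' !ge_min lexx !orbT.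
  by move=> tau /(S_le (minl _ _)) /he'.
exists (exist _ _ lev); split => //=.
- by rewrite /e'' !ge_min lexx !orbT.
- move=> t; rewrite /psi' addrC addKr normrM gtr0_norm// ler_piMr ?(ltW (a_gt0 k))//.
  by rewrite ler_norml cos_geN1 cos_le1.
have hs i : exists s, S (e / 2) s /\ `|lam * s - i%:R * (pi / 2)| <= 8^-1.
  have [s [/=]] := hA (i%:R * (pi / 2) / lam).
  rewrite in_itv/= => /andP[s1 s2] Ss; exists s; split => //.
  move: s1; rewrite ler_pdivrMr// => s1.
  have s2' : lam * s <= i%:R * (pi / 2) + lam * A.
    by have := ler_wpM2l (ltW lam0) s2; rewrite mulrDr [lam * (_ / _)]mulrC divfK ?gt_eqF.
  have : lam * A <= 8^-1.
    by rewrite -ler_pdivlMr// -invfM ltW.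
  by rewrite ler_distl => h; apply/andP; split; lra.
have [sigma hsigma] := choice hs.
exists sigma; split; first by move=> i _; case: (hsigma i).
move=> t x.
have [i i4 hi] := quarter_turns_spread (lam * t) ((x - psi t) / a k).
exists i => //; have [Ssi hlam] := hsigma i.
have {}hpsi : `|psi (t + sigma i) - psi t| <= a k / 16.
  by apply: hpsi; apply: S_le Ssi; lra.
have hc : `|cos (lam * (t + sigma i)) - cos (lam * t + i%:R * (pi / 2))| <= 8^-1.
  apply: le_trans (cos_lipschitz _ _) _.
  by rewrite mulrDr opprD addrACA subrr add0r.
have hi' : a k * (11 / 16) <=
    `|psi t + a k * cos (lam * t + i%:R * (pi / 2)) - x|.
  rewrite (_ : _ - x = a k * (cos (lam * t + i%:R * (pi / 2)) - (x - psi t) / a k)).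
    by rewrite normrM (gtr0_norm (a_gt0 k)) ler_pM2l.
  by field; rewrite gt_eqF.
have hd : `|psi t + a k * cos (lam * t + i%:R * (pi / 2)) - psi' (t + sigma i)|
    <= a k * (3 / 16).
  rewrite /psi' (_ : _ - _ = - ((psi (t + sigma i) - psi t) +
    a k * (cos (lam * (t + sigma i)) - cos (lam * t + i%:R * (pi / 2))))); last by ring.
  rewrite normrN; apply: le_trans (ler_normD _ _) _.
  have : `|a k * (cos (lam * (t + sigma i)) - cos (lam * t + i%:R * (pi / 2)))|
      <= a k * 8^-1 by rewrite normrM (gtr0_norm (a_gt0 k)) ler_pM2l.
  by have := a_gt0 k; lra.
have := ler_distD (psi' (t + sigma i)) (psi t + a k * cos (lam * t + i%:R * (pi / 2))) x.
lra.
Qed.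

Lemma dither_levels :
  exists (psi : nat -> R -> R) (e : nat -> R) (sigma : nat -> nat -> R),
  psi 0%N = cst 0 /\ forall k, [/\ dither_level b (k, psi k, e k), e k.+1 <= e k / 2,
    forall t, `|psi k.+1 t - psi k t| <= a k,
    forall i, (i < 4)%N -> S (e k / 2) (sigma k i) &
    forall t x, exists2 i, (i < 4)%N &
      a k / 2 <= `|psi k.+1 (t + sigma k i) - x|].
Proof.
have lev0 : dither_level b (0%N, cst 0, b 0%N).
  split => //=.
  - by move=> t; exact: cvg_cst.
  - by move=> eta eta0; exists 1 => // tau _ t; rewrite subrr normr0 ltW.
  - by rewrite b_gt0 lexx.
  - by move=> tau _ t; rewrite subrr normr0 divr_ge0// ltW.
have nx (z : {z | dither_level b z}) :
    {z' : {z | dither_level b z} | dither_step (sval z) (sval z')}.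
  exact/cid/dither_step_exists.
have [Z [Z0 ZS]] := dependent_choice nx (exist _ _ lev0).
have Zk k : (sval (Z k)).1.1 = k.
  elim: k => [|k IH]; first by rewrite Z0.
  have := ZS k; case: (sval (Z k)) IH => -[k1 p1] e1 /= ->.
  by case: (sval (Z k.+1)) => -[k2 p2] e2 [->].
pose psi k := (sval (Z k)).1.2; pose e k := (sval (Z k)).2.
have ZE k : sval (Z k) = (k, psi k, e k).
  by rewrite /psi /e -{2}(Zk k); case: (sval (Z k)) => -[].
have Znext k : dither_step (k, psi k, e k) (k.+1, psi k.+1, e k.+1).
  by rewrite -!ZE; exact: ZS.
have /choice[sigma hsigma] : forall k, exists s : nat -> R,
    (forall i, (i < 4)%N -> S (e k / 2) (s i)) /\
    forall t x, exists2 i, (i < 4)%N & a k / 2 <= `|psi k.+1 (t + s i) - x|.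
  by move=> k; case: (Znext k).
exists psi, e, sigma; split; first by rewrite /psi Z0.
move=> k; have [h1 h2] := hsigma k.
have [_ h3 h4 _] := Znext k.
split => //; rewrite -ZE; exact: (svalP (Z k)).
Qed.

End levels.

(** A sequence in which repetitions are kept, so that proportions refer to the
    4 ^ n choices of one [sigma] at each of [n] levels. *)
Fixpoint sumset (sigma : nat -> nat -> R) (k n : nat) : seq R :=
  if n is m.+1 then flatten [seq [seq sigma k i + tau | tau <- sumset sigma k.+1 m]
                            | i <- iota 0 4]
  else [:: 0].

Let sumsetS sigma k n : sumset sigma k n.+1 =
  [seq sigma k 0%N + tau | tau <- sumset sigma k.+1 n] ++
  [seq sigma k 1%N + tau | tau <- sumset sigma k.+1 n] ++
  [seq sigma k 2%N + tau | tau <- sumset sigma k.+1 n] ++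
  [seq sigma k 3%N + tau | tau <- sumset sigma k.+1 n].
Proof. by rewrite /= cats0. Qed.

Lemma size_sumset sigma k n : size (sumset sigma k n) = (4 ^ n)%N.
Proof.
elim: n k => [//|n IH] k.
by rewrite sumsetS !size_cat !size_map !IH expnS; lia.
Qed.

(** Dither is noise added to a signal before it is quantized.  The almost periods
    in [L] are taken with a precision that is small relative to the scale [rho],
    so that they move the function to be quantized by much less than they scatter
    [theta]. *)
Definition dither (theta : R -> R) : Prop :=
  [/\ measurable_fun setT theta, moduli_dominated theta,
      forall t, `|theta t| <= 8 / 7 &
      forall gam, 0 < gam -> exists2 rho, 0 < rho & exists L : seq R,
        [/\ (0 < size L)%N, forall tau, tau \in L -> S (gam * rho) tau &
          forall t x, (count (fun tau => `|theta (t + tau) - x| < rho) L)%:R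
            <= gam * (size L)%:R]].

(** At each level one of the four branches is free of translations that bring the
    dither near [x], whatever is chosen at the later levels: the new term has
    moved it by half of [a k], and the later almost periods and the rest of the
    sum cannot undo this.  So at most 3 ^ n of the 4 ^ n sums of [n] levels
    bring it near [x]. *)
Theorem dither_exists : exists theta : R -> R, dither theta.
Proof.
(* The levels from [n] to [2n - 1] are used for the scale [a (2n)] and the
   proportion (3/4) ^ n; the bound [b n] puts the almost periods of these levels
   into the set [S] at the product of both. *)
pose b k := (3 / 4) ^+ k * a k.*2.
have b_gt0 k : 0 < b k by rewrite mulr_gt0// exprn_gt0.
have [psi [e [sigma [psi0 lev]]]] := dither_levels b_gt0.
pose rho k := 8 / 7 * a k.
have rho0 : rho @ \oo --> 0.
  rewrite -[0](mulr0 (8 / 7)); apply: cvgM; first exact: cvg_cst.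
  by apply: cvg_expr; rewrite ger0_norm ?invr_ge0// invf_lt1// ltr1n.
have : forall t, exists l : R, psi ^~ t @ \oo --> l /\
    forall k, `|l - psi k t| <= rho k.
  move=> t.
  have [|l [hl1 hl2]] := @telescoping_limit R R^o (psi ^~ t) rho (@complete_space_line R) rho0.
    move=> k; rewrite /mdist/=; have [_ _ h _ _] := lev k.
    by apply: le_trans (h t) _; rewrite /rho aS; have := a_gt0 k; lra.
  by exists l.
move=> /choice[theta htheta].
have close k t : `|theta t - psi k t| <= rho k by have [_] := htheta t.
exists theta; split.
- apply: (measurable_fun_cvg (h := psi)).
    by move=> k; apply: continuous_measurable_fun; have [[]] := lev k.
  by move=> t _; have [] := htheta t.
- move=> eta eta0.
  have : \forall k \near \oo, rho k < eta / 4.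
    by apply: (cvgr_lt _ rho0); rewrite divr_gt0.
  case=> k _ /(_ k (leqnn k)) rk.
  have [[_ dpsi _ _] _ _ _ _] := lev k.
  have [|e1 e10 h1] := dpsi (eta / 2); first by rewrite divr_gt0.
  exists e1 => // tau tauS t; have := h1 tau tauS t.
  have := close k t; have := close k (t + tau).
  by rewrite !ler_norml => /andP[? ?] /andP[? ?] /andP[? ?]; apply/andP; split; lra.
- by move=> t; have := close 0%N t; rewrite psi0 subr0 /rho /amplitude expr0 mulr1.
- move=> gam gam0.
  have : \forall n \near \oo, (3 / 4 : R) ^+ n < gam.
    have := @cvg_expr R (3 / 4); rewrite ger0_norm// => /(_ ltac:(lra)) h.
    by apply: (cvgr_lt _ h).
  case=> n _ /(_ n (leqnn n)) ngam.
  have periods m : forall k tau, tau \in sumset sigma k m -> S (e k) tau.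
    elim: m => [|m IH] k tau.
      by rewrite inE => /eqP ->; apply: S0; have [[_ _ /andP[]]] := lev k.
    have [[_ _ /andP[e0 _] _] e2 _ hs _] := lev k.
    case/flatten_mapP => i; rewrite mem_iota => /andP[_ i4] /mapP[tau' /IH h ->].
    rewrite (splitr (e k)); apply: SD; first exact: hs.
    exact: S_le h.
  exists (a n.*2) => //; exists (sumset sigma n n); split.
  + by rewrite size_sumset expn_gt0.
  + move=> tau /periods; apply: S_le; have [[_ _ /andP[_ eb] _] _ _ _ _] := lev n.
    by apply: le_trans eb _; rewrite /b ler_wpM2r// ltW.
  + move=> t x.
    have H m : forall (k : nat) (t : R), (k + m = n.*2)%N ->
        (count (fun tau => `|theta (t + tau) - x| < a n.*2)%R (sumset sigma k m)
         <= 3 ^ m)%N.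
      elim: m => [|m IH] k s km; first by rewrite /= addn0 leq_b1.
      have IHt i : (count (fun tau => `|theta (s + (sigma k i + tau)) - x| < a n.*2)%R
          (sumset sigma k.+1 m) <= 3 ^ m)%N.
        have := IH k.+1 (s + sigma k i); rewrite addSnnS => /(_ km).
        by under eq_count do rewrite -addrA.
      have [[cpsi dpsi /andP[e0 _] hpsi] _ _ _ /(_ s x)[i i4 hi]] := lev k.
      have IHi : count (fun tau => `|theta (s + (sigma k i + tau)) - x| < a n.*2)%R
          (sumset sigma k.+1 m) = 0%N.
        apply/eqP; rewrite -leqn0 leqNgt -has_count; apply/hasPn => tau /periods tauS.
        rewrite -leNgt.
        have [[_ _ _ hpsi'] _ _ _ _] := lev k.+1.
        have := hpsi' tau tauS (s + sigma k i); have := close k.+1 (s + sigma k i + tau).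
        have := hi; rewrite addrA /rho aS.
        have : a n.*2 <= a k / 8.
          by rewrite -aS; apply: ler_wiXn2l; rewrite ?invr_ge0// ?invf_le1// ?ler1n//; lia.
        set y := theta _; set z := psi k.+1 (_ + tau); set w := psi k.+1 _ => h1 h2 h3 h4.
        have := ler_distD z w x; have := ler_distD y z x.
        rewrite (distrC z y) (distrC w z); have := a_gt0 k; lra.
      rewrite sumsetS !count_cat !count_map /preim/= expnS.
      set c := fun j : nat => count (fun tau =>
        `|theta (s + (sigma k j + tau)) - x| < a n.*2)%R (sumset sigma k.+1 m).
      rewrite -[X in (X <= _)%N]/(c 0 + (c 1 + (c 2 + c 3)))%N.
      have ci : c i = 0%N := IHi; have c3 : forall j, (c j <= 3 ^ m)%N := IHt.
      clearbody c; move: (c3 0%N) (c3 1%N) (c3 2%N) (c3 3%N) ci.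
      by case: i i4 hi {IHi} => [|[|[|[|//]]]] _ _; lia.
    have {}H := H n n t (addnn n); rewrite size_sumset.
    apply: (@le_trans _ _ ((3 / 4) ^+ n * (4 ^ n)%:R)); last first.
      by rewrite ler_wpM2r// ltW.
    by rewrite natrX exprMn -mulrA -exprMn mulVf// expr1n mulr1 -natrX ler_nat.
Qed.

End dither.

(** * Almost periods and frequencies of a Weyl almost periodic function *)

Section weyl_almost_periodic.
Context {R : realType}.
Variable h : R -> R^o.
Hypothesis Wh : Wp 1 (0 : R^o) h.
Implicit Types (tau xi e eps l : R).

Let Mh : Mp 1 (0 : R^o) h. Proof. by case: Wh. Qed.

Let nh tau : nonneg_fun (mdist_fun h (shift h tau)).
Proof. exact: (nonneg_shift_dist Mh). Qed.

Lemma periods_l_window l eps tau : 0 < l -> periods_l 1 l eps h tau ->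
  forall xi, (window xi l (mdist_fun h (shift h tau)) <= (eps * l)%:E)%E.
Proof.
move=> l0; rewrite /periods_l /= /Dpl dist_pow1 invr1.
have S0 := sup_mean_ge0 (ltW l0) (nh tau).2.
rewrite poweRe1// => /ltW; rewrite sup_meanP// => /asboolP; exact.
Qed.

Lemma window_periods l eps eps' tau : 0 < l -> 0 <= eps < eps' ->
  (forall xi, window xi l (mdist_fun h (shift h tau)) <= (eps * l)%:E)%E ->
  periods 1 eps' h tau.
Proof.
move=> l0 /andP[e0 ee'] hw.
apply: (mean_periods Mh (c := (eps + eps') / 2)); first by rewrite midf_lt.
by apply: (mean_le_window (nh tau) e0 l0 hw); rewrite midf_lt.
Qed.

Lemma weyl_periods_dense eps : 0 < eps -> relatively_dense (periods 1 eps h).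
Proof.
move=> eps0; have e2 : 0 < eps / 2 by rewrite divr_gt0.
have [_ /(_ _ e2)[l l0 [a a0 ha]]] := Wh.
exists a => // xi; have [t [It Pt]] := ha xi; exists t; split => //.
apply: (@window_periods l (eps / 2) eps t l0); last exact: periods_l_window.
by rewrite ltW//= ltr_pdivrMr// ltr_pMr// ltr1n.
Qed.

(** By continuity of translations in the mean, the claim holds for one window of
    length [a + l]; almost periods carry it to every window of length [l]. *)
Lemma small_translations_periods eps : 0 < eps -> exists2 s0, 0 < s0 &
  forall s, `|s| < s0 -> periods 1 eps h s.
Proof.
move=> eps0; pose e := eps / 8; have e0 : 0 < e by rewrite divr_gt0.
have [_ /(_ _ e0)[l l0 [a a0 ha]]] := Wh.
have al0 : 0 <= a + l by rewrite addr_ge0// ltW.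
have [s0 s00 hs] := mean_translation_continuous Mh al0 (mulr_gt0 e0 l0).
exists s0 => // s /hs {}hs.
apply: (@window_periods l (3 * e) eps s l0).
  by apply/andP; split; rewrite /e; lra.
move=> xi; have [q [/=]] := ha (- xi); rewrite in_itv/= => /andP[q1 q2] Pq.
have hq := periods_l_window l0 Pq.
have n1 := nonneg_fun_translate s (nh q).
have n2 := nonneg_fun_translate q (nh s).
have n3 := nh q.
apply: (@le_trans _ _ (window xi l (fun t => mdist_fun h (shift h q) (t + s) +
    (mdist_fun h (shift h s) (t + q)%R + mdist_fun h (shift h q) t)))%E).
  apply: (window_le _ _ (nh s).1 (nonneg_funD n1 (nonneg_funD n2 n3)).1 (nh s).2).
  move=> t; rewrite /mdist_fun /Defs.shift -!EFinD lee_fin (addrAC t s q).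
  have t1 := metric_triangle (h t) (h (t + q)) (h (t + s)).
  have t2 := metric_triangle (h (t + q)) (h (t + q + s)) (h (t + s)).
  rewrite (metric_sym (h (t + q + s)) (h (t + s))) in t2.
  lra.
rewrite (windowD _ _ n1.1 (nonneg_funD n2 n3).1 n1.2 (nonneg_funD n2 n3).2).
rewrite (windowD _ _ n2.1 n3.1 n2.2 n3.2).
rewrite (window_translate _ _ _ (nh q).1 (nh q).2).
rewrite (window_translate _ _ _ (nh s).1 (nh s).2).
have -> : 3 * e * l = e * l + (e * l + e * l) by ring.
rewrite !EFinD; apply: leeD; [|apply: leeD] => //.
by apply: le_trans hs; apply: (window_subset (nh s).1 (nh s).2); lra.
Qed.

(** Almost periods bring every point into a fixed bounded interval, in which
    points that are close differ by an almost period; so the cells of a partition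
    of this interval serve as colours.  This is the total boundedness of the
    translates of [h] in the mean. *)
Lemma finite_colouring eps : 0 < eps -> exists (N : nat) (col : R -> nat),
  (forall tau, (col tau < N)%N) /\
  forall tau tau', col tau = col tau' -> periods 1 eps h (tau - tau').
Proof.
move=> eps0; have e4 : 0 < eps / 4 by rewrite divr_gt0.
have [a a0 ha] := weyl_periods_dense e4.
have [s0 s00 hs] := small_translations_periods e4.
have /choice[q hq] : forall tau, exists q, 0 <= tau + q <= a /\ periods 1 (eps / 4) h q.
  move=> tau; have [q [/=]] := ha (- tau); rewrite in_itv/= => /andP[q1 q2] Pq.
  by exists q; split => //; apply/andP; split; lra.
pose col tau := Num.truncn ((tau + q tau) / s0).
exists (Num.truncn (a / s0)).+1, col; split.
  move=> tau; rewrite ltnS /col; apply: le_truncn.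
  by rewrite ler_pM2r ?invr_gt0//; have [/andP[]] := hq tau.
move=> tau tau' hcol.
have [/andP[r1 r2] Pq] := hq tau; have [/andP[r1' r2'] Pq'] := hq tau'.
pose r := tau + q tau; pose r' := tau' + q tau'.
have d : `|r - r'| < s0.
  have k1 : 0 <= r / s0 by rewrite divr_ge0// ltW.
  have k2 : 0 <= r' / s0 by rewrite divr_ge0// ltW.
  have := truncn_itv k1; have := truncn_itv k2.
  rewrite -/(col tau) -/(col tau') hcol -natr1 => /andP[a1 a2] /andP[b1 b2].
  have : `|r / s0 - r' / s0| < 1 by rewrite ltr_norml; apply/andP; split; lra.
  by rewrite -mulrBl normrM (gtr0_norm (_ : 0 < s0^-1)) ?invr_gt0// ltr_pdivrMr// mul1r.
have -> : tau - tau' = (r - r') + (- q tau + q tau') by rewrite /r /r'; ring.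
have le_eps : eps / 4 + (eps / 4 + eps / 4) <= eps by lra.
apply: (periods_le le_eps).
exact: (periodsD Mh (hs _ d) (periodsD Mh (periodsN Mh Pq) Pq')).
Qed.

(** Two points of [T] of the same colour differ by a common almost period, so one
    representative of each of the finitely many colours is enough to correct
    every point of [T] by a bounded amount. *)
Lemma common_relatively_dense (T : R -> set R) :
  (forall e, 0 < e -> relatively_dense (T e)) ->
  (forall e tau tau', T (e / 2) tau -> T (e / 2) tau' -> T e (tau - tau')) ->
  forall e, 0 < e -> relatively_dense (T e `&` periods 1 e h).
Proof.
move=> T_dense T_diff e e0; have e2 : 0 < e / 2 by rewrite divr_gt0.
have [N [col [colN hcol]]] := finite_colouring e0.
have [a a0 ha] := T_dense _ e2.
have /choice[rep hrep] : forall i, exists r, (exists2 tau, T (e / 2) tau & col tau = i) ->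
    T (e / 2) r /\ col r = i.
  move=> i; have [[tau Ttau ci]|ni] := pselect (exists2 tau, T (e / 2) tau & col tau = i).
    by exists tau.
  by exists 0 => /ni.
pose M := \sum_(i < N) `|rep i|.
have repM i : (i < N)%N -> `|rep i| <= M.
  move=> iN; rewrite /M (bigD1 (Ordinal iN))//= lerDl.
  by apply: sumr_ge0.
have M0 : 0 <= M by apply: sumr_ge0.
exists (2 * M + a); first by rewrite ltr_wpDl// mulr_ge0.
move=> xi; have [tau [/=]] := ha (xi + M); rewrite in_itv/= => /andP[t1 t2] Ttau.
have [Tr cr] : T (e / 2) (rep (col tau)) /\ col (rep (col tau)) = col tau.
  by apply: hrep; exists tau.
exists (tau - rep (col tau)); split; last first.
  by split; [exact: T_diff|apply: hcol].
have := repM _ (colN tau); rewrite ler_norml /= in_itv/= => /andP[m1 m2].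
by apply/andP; split; lra.
Qed.

(** Otherwise a sequence of almost periods for precisions tending to 0 would
    contradict the definition of [Mod]. *)
Lemma Mod_periods lam eta : Mod h lam -> 0 < eta ->
  exists2 e, 0 < e & forall tau, periods 1 e h tau ->
    `|cos (lam * tau) - 1| < eta /\ `|sin (lam * tau)| < eta.
Proof.
move=> Mlam eta0; apply: contrapT => H.
have {}H : forall n : nat, exists tau, periods 1 n.+1%:R^-1 h tau /\
    ~ (`|cos (lam * tau) - 1| < eta /\ `|sin (lam * tau)| < eta).
  move=> n; apply: contrapT => H1; apply: H.
  exists n.+1%:R^-1; first by rewrite invr_gt0.
  move=> tau Ptau; apply: contrapT => H2; apply: H1; by exists tau.
have [tau htau] := choice H.
have [mh _] := Mh.
have Mt := Mp_truncated (0 : R^o) mh.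
have nt n := nonneg_shift_dist Mt (tau n).
have bt n := stepanov_shift_dist Mt (tau n).
have D0 : Dp 1 (h : R -> truncated R^o) (shift h (tau j)) @[j --> \oo] --> 0%E.
  apply: (@squeeze_cvge _ _ _ _ (cst 0%E) _ (fun j => (j.+1%:R^-1)%:E)).
  - apply: nearW => n; rewrite (Dp1_ge0 (nt n) (bt n))/=.
    apply: (Dp1_le (nt n) (bt n)).
    have [/(periods_mean Mh)[c cn hc] _] := htau n.
    apply: (mean_leS (nt n) (nh (tau n)) _ (mean_leW (ltW cn) hc)).
    by move=> t; rewrite lee_fin; exact: truncated_mdist_le.
  - exact: cvg_cst.
  - exact: cvge_harmonic.
have hlim := Mlam tau D0.
have eC : (0 : R[i]) < (eta%:C)%C by rewrite ltcR.
have := hlim _ (nbhsx_ballx (1 : R[i]^o) _ eC).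
case=> n _ /(_ n (leqnn n)) /=; rewrite /ball /=.
rewrite normc_def ltcR /expi /= => hn.
have [_ []] := htau n.
by split; apply: le_lt_trans hn; rewrite -sqrtr_sqr ler_wsqrtr//;
  rewrite ?(sqrrN, sub0r) ?(lerDr, lerDl) ?sqr_ge0// -[leLHS]sqrrN opprB lerDl sqr_ge0.
Qed.

Lemma Mod_moduli_dominated (S : R -> set R) lam :
  (forall e, S e `<=` periods 1 e h) -> Mod h lam ->
  moduli_dominated S (fun t => cos (lam * t)).
Proof.
move=> Sh Mlam eta eta0; have e2 : 0 < eta / 2 by rewrite divr_gt0.
have [e e0 he] := Mod_periods Mlam e2; exists e => // tau /Sh /he[hc hs] t.
rewrite mulrDr cosD.
rewrite (_ : _ - _ = cos (lam * t) * (cos (lam * tau) - 1) -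
  sin (lam * t) * sin (lam * tau)); last by ring.
rewrite (splitr eta); apply: le_trans (ler_normB _ _) _; rewrite !normrM.
apply: lerD.
  apply: le_trans (ltW hc); rewrite ler_piMl// ler_norml cos_geN1 cos_le1//.
apply: le_trans (ltW hs); rewrite ler_piMl// ler_norml sin_geN1 sin_le1//.
Qed.

(** The difference of two close frequencies would turn some almost period by one
    to three quarters, and the cosine of this angle would not be positive. *)
Lemma Mod_separated e : 0 < e -> exists2 c, 0 < c & forall lam mu : R,
  (forall tau, periods 1 e h tau ->
    `|cos (lam * tau) - 1| < 8^-1 /\ `|sin (lam * tau)| < 8^-1) ->
  (forall tau, periods 1 e h tau ->
    `|cos (mu * tau) - 1| < 8^-1 /\ `|sin (mu * tau)| < 8^-1) ->
  `|lam - mu| <= c -> lam = mu.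
Proof.
move=> e0; have [a a0 ha] := weyl_periods_dense e0.
have pi0 := pi_gt0 R.
exists (pi / a); first by rewrite divr_gt0.
move=> lam mu hlam hmu.
wlog lm : lam mu hlam hmu / mu <= lam.
  move=> H; have [|/ltW lm] := leP mu lam; first exact: H.
  by rewrite distrC => /(H _ _ hmu hlam lm) ->.
rewrite ger0_norm ?subr_ge0// => d.
apply/eqP; rewrite eq_le lm andbT leNgt; apply/negP => lt.
have th0 : 0 < lam - mu by rewrite subr_gt0.
have [tau [/=]] := ha (pi / 2 / (lam - mu)); rewrite in_itv/= => /andP[t1 t2] Pt.
have := hlam tau Pt; have := hmu tau Pt.
rewrite !ltr_norml => -[/andP[m1 m2] /andP[m3 m4]] [/andP[l1 l2] /andP[l3 l4]].
have cE : cos ((lam - mu) * tau) =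
    cos (lam * tau) * cos (mu * tau) + sin (lam * tau) * sin (mu * tau).
  by rewrite mulrBl cosB.
have cpos : 0 < cos ((lam - mu) * tau) by rewrite cE; nra.
have s1 : pi / 2 <= (lam - mu) * tau by move: t1; rewrite ler_pdivrMr// (mulrC tau).
have s2 : (lam - mu) * tau <= pi / 2 + pi.
  have : (lam - mu) * tau <= (lam - mu) * (pi / 2 / (lam - mu) + a).
    by rewrite ler_pM2l.
  rewrite mulrDr (mulrC _ (_ / (lam - mu))) divfK ?gt_eqF// => /le_trans; apply.
  by rewrite lerD2l -ler_pdivlMr.
have : 0 <= sin ((lam - mu) * tau - pi / 2) by apply: sin_ge0_pi; apply/andP; split; lra.
by rewrite sinBpihalf; lra.
Qed.

(** The frequencies that nearly fix all the almost periods for the precision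
    [n.+1%:R^-1] are uniformly separated, and these countably many sets of
    frequencies cover [Mod h]. *)
Lemma Mod_countable : countable (Mod h).
Proof.
pose M n : set R := [set lam | forall tau, periods 1 n.+1%:R^-1 h tau ->
  `|cos (lam * tau) - 1| < 8^-1 /\ `|sin (lam * tau)| < 8^-1].
have e8 : 0 < 8^-1 :> R by rewrite invr_gt0.
have MM : Mod h `<=` \bigcup_n M n.
  move=> lam /Mod_periods/(_ e8)[e e0 he].
  have : \forall n \near \oo, n.+1%:R^-1 < e by exact: near_infty_natSinv_lt (PosNum e0).
  case=> n _ /(_ n (leqnn n)) /ltW h1; exists n => // tau.
  by move=> /(periods_le h1)/he.
apply: (sub_countable (subset_card_le MM)); apply: bigcup_countable => //.
move=> n _; have n0 : 0 < n.+1%:R^-1 :> R by rewrite invr_gt0.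
have [c c0 hc] := Mod_separated n0.
apply/countable_injP; exists (fun lam => pickle (Num.floor (lam / c))).
move=> lam mu; rewrite !inE => Mlam Mmu /(pcan_inj pickleK) hf.
apply: hc => //.
have := floor_itv (lam / c); have := floor_itv (mu / c).
rewrite hf intrD => /andP[a1 a2] /andP[b1 b2].
have : `|lam / c - mu / c| <= 1 by rewrite ler_norml; apply/andP; split; lra.
by rewrite -mulrBl normrM (gtr0_norm (_ : 0 < c^-1)) ?invr_gt0// ler_pdivrMr// mul1r.
Qed.

End weyl_almost_periodic.

(** * Averages over translates *)

Section averaging.
Context {R : realType}.
Local Open Scope ereal_scope.
Implicit Types (u : R -> \bar R) (tau xi l : R) (L : seq R).

Lemma window_le_translate u xi l tau : nonneg_fun u -> (forall t, u t <= 1) ->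
  (0 <= l)%R -> window xi l u <= window (xi + tau) l u + `|tau|%:E.
Proof.
move=> [mu u0] u1 l0.
have wle xi' l' : (0 <= l')%R -> window xi' l' u <= l'%:E.
  move=> l'0; rewrite -[l'%:E]mul1e -EFinM -(window_cst xi')//.
  apply: window_le => //; exact: measurable_cst.
have [tau0|/ltW tau0] := leP 0%R tau.
  rewrite (ger0_norm tau0) addeC; apply: (@le_trans _ _ (window xi (tau + l) u)).
    by apply: window_subset => //; rewrite lerD2l lerDr.
  by apply: le_trans (window_cat _ mu u0 tau0 l0) _; apply: leeD => //; exact: wle.
have N0 : (0 <= - tau)%R by rewrite oppr_ge0.
rewrite (ler0_norm tau0); apply: (@le_trans _ _ (window (xi + tau) (l - tau) u)).
  apply: window_subset => //; first by rewrite gerDl.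
  by rewrite addrACA subrr addr0.
by apply: le_trans (window_cat _ mu u0 l0 N0) _; apply: leeD => //; exact: wle.
Qed.

Definition translates_sum u L : R -> \bar R :=
  fun t => \sum_(tau <- L) u (t + tau)%R.

Lemma nonneg_translates_sum u L : nonneg_fun u -> nonneg_fun (translates_sum u L).
Proof.
by move=> nu; apply: nonneg_fun_sum => tau; exact: nonneg_fun_translate.
Qed.

Lemma window_translates_sum u L xi l : nonneg_fun u -> (forall t, u t <= 1) ->
  (0 <= l)%R ->
  (size L)%:R%:E * window xi l u <=
    window xi l (translates_sum u L) + (\sum_(tau <- L) `|tau|)%:E.
Proof.
move=> nu u1 l0; have [mu u0] := nu.
elim: L => [|tau L IH].
  by rewrite mul0e big_nil adde0; apply: window_ge0; exact: (nonneg_translates_sum [::] nu).2.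
have -> : translates_sum u (tau :: L) = fun t => u (t + tau)%R + translates_sum u L t.
  by apply/funext => t; rewrite /translates_sum big_cons.
have [mt t0] := nonneg_fun_translate tau nu.
have [ms s0] := nonneg_translates_sum L nu.
rewrite (windowD _ _ mt ms t0 s0) window_translate// big_cons EFinD addeACA.
rewrite /= -add1n natrD EFinD ge0_muleDl ?lee_fin// mul1e.
by apply: leeD => //; exact: window_le_translate.
Qed.

(** Each translation changes an integral over a window by a bounded amount, which
    does not count in the means over long windows. *)
Lemma mean_le_average u L c e : nonneg_fun u -> (forall t, u t <= 1) ->
  (0 < size L)%N -> mean_le (translates_sum u L) ((size L)%:R * c) -> (0 < e)%R ->
  mean_le u (c + e).
Proof.
move=> nu u1 L0 [l0 l00 h] e0.
pose M := (\sum_(tau <- L) `|tau|)%R.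
have N0 : (0 < (size L)%:R :> R)%R by rewrite ltr0n.
have N1 : (1 <= (size L)%:R :> R)%R by rewrite ler1n.
have M0 : (0 <= M)%R by apply: sumr_ge0.
exists (Num.max l0 (M / e))%R; first by rewrite lt_max l00.
move=> l xi; rewrite ge_max => /andP[ll Ml].
have l_ge0 : (0 <= l)%R by exact: le_trans (ltW l00) ll.
rewrite -(@lee_pmul2l _ (size L)%:R%:E)//.
apply: le_trans (window_translates_sum L xi nu u1 l_ge0) _.
apply: le_trans (leeD (h l xi ll) (lexx _)) _.
rewrite -EFinD -EFinM lee_fin -/M.
move: Ml; rewrite ler_pdivrMr// => Ml; nra.
Qed.

End averaging.

(** * Quantization by moving thresholds *)

Section countable_net.
Context {R : realType}.

Lemma compact_finite_net (V : metricType R) (K : set V) (e : R) : compact K ->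
  0 < e -> exists s : seq V, forall x, K x -> exists2 y, y \in s & mdist x y < e.
Proof.
move=> /compact_near_coveringP cK e0.
pose F : set_system (seq V) :=
  filter_from setT (fun r : seq V => [set s : seq V | {subset r <= s}]).
have FF : Filter F.
  apply: filter_from_filter; first by exists [::].
  move=> s s' _ _; exists (s ++ s') => // r /= h.
  by split=> x xs; apply: h; rewrite mem_cat xs ?orbT.
have := cK (seq V) F (fun s x => exists2 y, y \in s & mdist x y < e) FF.
case=> [x Kx|s _ hs]; last by exists s => x Kx; apply: hs.
exists (ball x e, [set s : seq V | x \in s]) => /=.
  split; first exact: nbhsx_ballx.
  by exists [:: x] => // s; apply; rewrite inE.
move=> [z s] /= [zx xs]; exists x => //.
by move: zx; rewrite ballEmdist /= metric_sym.
Qed.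

End countable_net.

(** The family [S] is kept abstract because all the functions in the construction
    have to be coded along the same almost periods. *)
Definition almost_periods_in {R : realType} {V : metricType R}
    (S : R -> set R) (phi : R -> V) : Prop :=
  forall e tau, 0 < e -> S e tau -> mean_le (mdist_fun phi (shift phi tau)) e.

Definition tight {R : realType} {V : metricType R} (phi : R -> V) : Prop :=
  forall e d : R, 0 < e -> 0 < d -> exists K : set V, [/\ compact K, K !=set0 &
    (kappaW [set t | (e <= dist_set (phi t) K)%R] < d%:E)%E].

Section indicator_means.
Context {R : realType}.
Implicit Types (A B : set R).

Lemma lebesgue_ltr (u v : R -> R) : lebesgue_fun u -> lebesgue_fun v ->
  lebesgue_measurable [set t | u t < v t].
Proof.
move=> mu mv; have := measurable_fun_ltr mu mv.
move=> /(_ measurableT [set true] Logic.I); rewrite setTI.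
by congr (measurable _); apply/seteqP; split.
Qed.

Lemma lebesgue_ler (u v : R -> R) : lebesgue_fun u -> lebesgue_fun v ->
  lebesgue_measurable [set t | u t <= v t].
Proof.
move=> mu mv; rewrite (_ : [set t | _] = ~` [set t | v t < u t]).
  by apply: measurableC; exact: lebesgue_ltr.
by apply/seteqP; split => t /=; rewrite leNgt => /negP.
Qed.

Lemma code_ge_measurable (q : R -> nat) N :
  (forall n, lebesgue_measurable (q @^-1` [set n])) ->
  lebesgue_measurable [set t | (N <= q t)%N].
Proof.
move=> mq.
rewrite (_ : [set t | _] = \bigcup_(n in [set n | (N <= n)%N]) (q @^-1` [set n])).
  by apply: bigcup_measurable => n _; exact: mq.
apply/seteqP; split => [t /= h|t [n /= h nt]]; first by exists (q t).
by rewrite /= nt.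
Qed.

Lemma code_change_measurable (q : R -> nat) tau :
  (forall n, lebesgue_measurable (q @^-1` [set n])) ->
  lebesgue_measurable [set t | q t != q (t + tau)].
Proof.
move=> mq; rewrite (_ : [set t | _] = ~` \bigcup_n (q @^-1` [set n] `&`
    translate tau (q @^-1` [set n]))).
  apply: measurableC; apply: bigcupT_measurable => n; apply: measurableI.
    exact: mq.
  by apply: lebesgue_measurable_translate; exact: mq.
apply/seteqP; split => t; rewrite /translate/=.
  by move=> /eqP h [n _ [/= h1 h2]]; apply: h; rewrite h1 h2.
by move=> h; apply/eqP => h1; apply: h; exists (q t).
Qed.
Lemma mean_le_indic_in_seq (T : eqType) (s : seq T) (F : T -> set R) c :
  0 <= c -> (forall i, lebesgue_measurable (F i)) ->
  (forall i, i \in s -> mean_le (EFin \o \1_(F i)) c) ->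
  mean_le (fun t => \sum_(i <- s) (\1_(F i) t)%:E)%E ((size s)%:R * c).
Proof.
move=> c0 mF; elim: s => [|i s IH] hF.
  rewrite mul0r (_ : (fun t => _) = cst 0%:E); first exact: mean_le_cst.
  by apply/funext => t; rewrite big_nil.
rewrite (_ : (fun t => _) = (fun t => (EFin \o \1_(F i)) t +
    \sum_(j <- s) (\1_(F j) t)%:E)%E); last by apply/funext => t; rewrite big_cons.
rewrite /= -add1n natrD mulrDl mul1r; apply: mean_leD.
- exact: nonneg_fun_indic.
- by apply: nonneg_fun_sum => j; exact: nonneg_fun_indic.
- by apply: hF; rewrite inE eqxx.
- by apply: IH => j js; apply: hF; rewrite inE js orbT.
Qed.

Lemma indic_le_sum (T : eqType) (s : seq T) (F : T -> set R) A t :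
  (A t -> exists2 i, i \in s & F i t) ->
  ((\1_A t : R)%:E <= \sum_(i <- s) (\1_(F i) t)%:E)%E.
Proof.
move=> h; rewrite indicE; case: (boolP (t \in A)) => [|_]; last first.
  by apply: sume_ge0 => i _; rewrite lee_fin.
rewrite inE => /h[i + Fi]; elim: s {h} => // j s IH; rewrite inE big_cons.
case/orP => [/eqP <-|/IH h].
  rewrite indicE mem_set//; rewrite leeDl//.
  by apply: sume_ge0 => k _; rewrite lee_fin.
by apply: (le_trans h); rewrite leeDr// lee_fin.
Qed.

Lemma mean_le_indic_bigcup (N : nat) (F : nat -> set R) c :
  0 <= c -> (forall i, lebesgue_measurable (F i)) ->
  (forall i, (i < N)%N -> mean_le (EFin \o \1_(F i)) c) ->
  mean_le (EFin \o \1_(\bigcup_(i in [set i | (i < N)%N]) F i)) (N%:R * c).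
Proof.
move=> c0 mF hF.
have := @mean_le_indic_in_seq _ (iota 0 N) F c c0 mF.
rewrite size_iota => h; apply: mean_leS (h _).
- by apply: nonneg_fun_indic; apply: bigcup_measurable => i _; exact: mF.
- by apply: nonneg_fun_sum => j; exact: nonneg_fun_indic.
- by move=> t; apply: indic_le_sum => -[i /= iN Fi]; exists i; rewrite ?mem_iota.
- by move=> i; rewrite mem_iota => /andP[_ iN]; exact: hF.
Qed.

End indicator_means.

Section thresholds.
Context {R : realType} (V : metricType R).
Variables (S : R -> set R) (theta : R -> R) (phi : R -> V) (eta : R).
Hypothesis eta0 : 0 < eta.
Hypothesis dtheta : dither S theta.
Hypothesis mphi : strongly_measurable phi.
Hypothesis phi_periods : almost_periods_in S phi.

(** The moving threshold is [eta * (3 / 4 + theta t / 8)], which stays between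
    [eta / 2] and [eta] as [theta] is bounded by 8/7.  The distance to [v] is
    below the threshold when [rescaled_dist v t] is below [theta t]. *)
Definition rescaled_dist (v : V) : R -> R :=
  fun t => 8 * (mdist (phi t) v / eta - 3 / 4).

Let mdist_v v : lebesgue_fun (fun t => mdist (phi t) v).
Proof. exact: (mdist_lebesgue_fun mphi (strongly_measurable_cst v)). Qed.

Let mtheta : lebesgue_fun theta.
Proof. by have [m _ _ _] := dtheta; exact: borel_fun_lebesgue. Qed.

Lemma rescaled_dist_measurable v : lebesgue_fun (rescaled_dist v).
Proof.
apply: measurable_funM; first exact: measurable_cst.
apply: measurable_funB; last exact: measurable_cst.
by apply: measurable_funM; [exact: mdist_v|exact: measurable_cst].
Qed.

Lemma rescaled_dist_lipschitz v t s :
  `|rescaled_dist v t - rescaled_dist v s| <= 8 / eta * mdist (phi t) (phi s).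
Proof.
rewrite /rescaled_dist -mulrBr opprB addrA subrK -mulrBl.
rewrite !normrM (gtr0_norm (_ : 0 < eta^-1)) ?invr_gt0// (@ger0_norm _ 8)//.
rewrite -mulrA [X in _ <= 8 * X]mulrC ler_pM2l// ler_pM2r ?invr_gt0//.
by apply: le_trans (mdist_lipschitz _ _ _ _) _; rewrite mdistxx addr0.
Qed.

Definition threshold_band (v : V) (rho : R) : set R :=
  [set t | `|theta t - rescaled_dist v t| < rho].

Lemma threshold_band_measurable v rho : lebesgue_measurable (threshold_band v rho).
Proof.
apply: lebesgue_ltr; last exact: measurable_cst.
exact: (measurableT_comp (@normr_measurable R setT)
  (measurable_funB mtheta (rescaled_dist_measurable v))).
Qed.

Definition moved (a tau : R) : set R := [set t | a <= mdist (phi t) (phi (t + tau))].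

Lemma moved_measurable a tau : lebesgue_measurable (moved a tau).
Proof.
apply: lebesgue_ler; first exact: measurable_cst.
exact: (mdist_lebesgue_fun mphi (strongly_measurable_shift tau mphi)).
Qed.

Lemma moved_mean a e tau : 0 < a -> 0 < e -> S e tau ->
  mean_le (EFin \o \1_(moved a tau)) (e / a).
Proof.
move=> a0 e0 Se.
have n := nonneg_mdist_fun mphi (strongly_measurable_shift tau mphi).
have := mean_le_superlevel n a0 (phi_periods e0 Se).
by congr (mean_le (EFin \o \1_ _) _); apply/seteqP; split.
Qed.

(** The translations provided by the dither hardly affect the distance to [v] but
    scatter the threshold, so that few of them leave the threshold near the
    distance; and it is enough to estimate an average over these
    translations. *)
Lemma threshold_band_small v gam : 0 < gam -> exists2 rho, 0 < rho &
  mean_le (EFin \o \1_(threshold_band v rho)) gam.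
Proof.
move=> gam0.
(* The proportion [g] of translations that leave the threshold near the distance
   and the mean [g * rho / a] = 16 * g / eta of the set where [phi] is moved by
   [a] or more add up to [gam / 2]. *)
pose g := gam / 2 / (1 + 16 / eta).
have g0 : 0 < g.
  by rewrite !divr_gt0// addr_gt0// divr_gt0.
have [_ _ _ /(_ g g0)[rho rho0 [L [L0 LS hL]]]] := dtheta.
exists (rho / 2); first by rewrite divr_gt0.
pose A := threshold_band v (rho / 2).
have mA : lebesgue_measurable A by exact: threshold_band_measurable.
pose a := eta * rho / 16.
have a0 : 0 < a by rewrite divr_gt0// mulr_gt0.
have N0 : 0 < (size L)%:R :> R by rewrite ltr0n.
have nA := nonneg_fun_indic mA.
have gE : gam = g * (1 + 16 / eta) + gam / 2.
  by rewrite /g divfK ?gt_eqF ?addr_gt0 ?divr_gt0// -splitr.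
rewrite gE; apply: (mean_le_average (L := L)) => //; last by rewrite divr_gt0.
  by move=> t; rewrite /= indicE lee_fin lern1 leq_b1.
pose M : R -> \bar R := fun t => (\sum_(tau <- L) (\1_(moved a tau) t)%:E)%E.
have nM : nonneg_fun M.
  by apply: nonneg_fun_sum => j; exact: nonneg_fun_indic (moved_measurable a j).
have nc : nonneg_fun (cst (g * (size L)%:R)%:E : R -> \bar R).
  by apply: nonneg_fun_cst; rewrite mulr_ge0// ltW.
apply: (@mean_leS _ _ (fun t => cst (g * (size L)%:R)%:E t + M t)%E).
- exact: nonneg_translates_sum.
- exact: nonneg_funD.
- move=> t; rewrite /translates_sum /M /cst.
  apply: (@le_trans _ _ ((count (fun tau =>
      `|theta (t + tau) - rescaled_dist v t| < rho) L)%:R%:E + M t)%E).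
    rewrite /M -sum1_count natr_sum -sumEFin [X in (X + _)%E]big_mkcond -big_split/=.
    apply: lee_sum => tau _; rewrite !indicE.
    case: (boolP (t + tau \in A)) => [|_]; last first.
      by case: ifP => _; rewrite -EFinD lee_fin ?addr_ge0// ?add0r ler0n.
    rewrite inE /A /threshold_band/= => hA.
    case: ltP => [_|h1]; first by rewrite -EFinD lee_fin lerDl ler0n.
    rewrite mem_set ?add0e//= /moved/= leNgt; apply/negP => h2.
    have := rescaled_dist_lipschitz v (t + tau) t; rewrite metric_sym => h3.
    have h4 : 8 / eta * mdist (phi t) (phi (t + tau)) < rho / 2.
      have -> : rho / 2 = 8 / eta * a by rewrite /a; field; rewrite gt_eqF.
      by rewrite ltr_pM2l// divr_gt0.
    have := ler_distD (rescaled_dist v (t + tau)) (theta (t + tau)) (rescaled_dist v t).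
    lra.
  by rewrite leeD2r// lee_fin.
rewrite [X in mean_le _ X](_ : _ = g * (size L)%:R + (size L)%:R * (g * rho / a)); last first.
  by rewrite /a; field; rewrite !gt_eqF.
apply: (mean_leD nc nM).
  by apply: mean_le_cst; rewrite mulr_ge0// ltW.
apply: mean_le_indic_in_seq.
- by apply: divr_ge0; [apply: mulr_ge0|]; exact: ltW.
- by move=> tau; exact: moved_measurable.
- move=> tau /LS h; apply: moved_mean => //; exact: mulr_gt0.
Qed.

End thresholds.

Section countable_net_of_range.
Context {R : realType} {V : metricType R}.

Lemma enumerate_seqs (T : choiceType) (x0 : T) (P : nat -> seq T) :
  exists v : nat -> T, forall n x, x \in P n -> exists j, v j = x.
Proof.
exists (fun j => if unpickle j is Some p then nth x0 (P p.1) p.2 else x0).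
move=> n x xP; exists (pickle (n, index x (P n))).
by rewrite pickleK /= nth_index.
Qed.

(** The values of the finitely valued approximations of [phi] are dense in its
    essential range.  Finite nets of the compact sets from tightness, included
    in the same sequence, take care of the quantitative second property. *)
Lemma tight_net (phi : R -> V) (r : R) : strongly_measurable phi -> tight phi ->
  0 < r -> exists v : nat -> V,
    ae_line (fun t => exists j, mdist (phi t) (v j) < r) /\
    forall gam, 0 < gam -> exists N, forall A, lebesgue_measurable A ->
      (forall t, A t -> forall j, (j < N)%N -> r <= mdist (phi t) (v j)) ->
      mean_le (EFin \o \1_A) gam.
Proof.
move=> mphi tphi r0; have [s [ss sphi]] := mphi.
have r20 : 0 < r / 2 by rewrite divr_gt0.
have /choice[w hw] : forall n, exists w : seq V, range (s n) = [set` w].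
  by move=> n; apply/finite_seqP; have [] := ss n.
have /choice[z hz] : forall n : nat, exists z : seq V,
    forall A, lebesgue_measurable A ->
    (forall t, A t -> forall y, y \in z -> r <= mdist (phi t) y) ->
    mean_le (EFin \o \1_A) n.+1%:R^-1.
  move=> n; have n0 : 0 < n.+1%:R^-1 :> R by rewrite invr_gt0.
  have [K [cK K0 kK]] := tphi (r / 2) _ r20 n0.
  have [z hz] := compact_finite_net cK r20.
  exists z => A mA hA.
  pose B := [set t | r / 2 <= dist_set (phi t) K].
  have mB : lebesgue_measurable B.
    apply: lebesgue_ler; first exact: measurable_cst.
    exact: dist_set_lebesgue_fun.
  apply: (mean_le_indicS mA mB _ (kappaW_lt mB kK)) => t At.
  rewrite /B /= leNgt; apply/negP => h.
  have [_ [x Kx <-] xr] := inf_lt (dist_set_has_inf (phi t) K0).1 h.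
  have [y yz xy] := hz x Kx.
  have := hA t At y yz; rewrite leNgt => /negP; apply.
  apply: le_lt_trans (metric_triangle _ x _) _.
  by rewrite (splitr r) ltrD.
have [v hv] := enumerate_seqs (s 0%N 0) (fun n => w n ++ z n).
exists v; split.
  apply: ae_lineS sphi => t /metric_cvgP /(_ r r0) [n _ /(_ n (leqnn n)) h].
  have [|j vj] := hv n (s n t).
    rewrite mem_cat; apply/orP; left.
    have : range (s n) (s n t) by exists t.
    by rewrite hw.
  by exists j; rewrite vj.
move=> gam gam0.
have [n ngam] : exists n, n.+1%:R^-1 < gam.
  have : \forall n \near \oo, n.+1%:R^-1 < gam by exact: near_infty_natSinv_lt (PosNum gam0).
  by case=> n _ /(_ n (leqnn n)) h; exists n.
have [N hN] : exists N, forall y, y \in z n -> exists2 j, (j < N)%N & v j = y.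
  have : {subset z n <= w n ++ z n} by move=> y yz; rewrite mem_cat yz orbT.
  move: (hv n) => /=; set P := w n ++ z n => hvP.
  elim: (z n) => [|y l IH] hl; first by exists 0%N.
  have [|N hN] := IH; first by move=> x xl; apply: hl; rewrite inE xl orbT.
  have [j vj] := hvP y (hl y (mem_head _ _)).
  exists (maxn N j.+1) => x; rewrite inE => /orP[/eqP ->|/hN[i iN vi]].
    by exists j => //; rewrite leq_max leqnn orbT.
  by exists i => //; rewrite leq_max iN.
exists N => A mA hA; apply: mean_leW (ltW ngam) _; apply: hz => // t At y yz.
by have [j jN <-] := hN y yz; exact: hA.
Qed.

End countable_net_of_range.

Section quantization.
Context {R : realType} {V : metricType R}.
Variables (S : R -> set R) (theta : R -> R) (phi : R -> V) (eta : R).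
Hypothesis eta0 : 0 < eta.
Hypothesis dtheta : dither S theta.
Hypothesis S_le : forall e e', e <= e' -> S e `<=` S e'.
Hypothesis mphi : strongly_measurable phi.
Hypothesis phi_periods : almost_periods_in S phi.

Variable v : nat -> V.

Let near_point (t : R) (j : nat) : bool := rescaled_dist phi eta (v j) t < theta t.

(** With the first near index as the code, a code below [N] depends on the first
    [N] comparisons only.  The default value 0 is meant for a null set. *)
Definition quantizer (t : R) : nat :=
  if pselect (exists j, near_point t j) is left h then ex_minn h else 0.

Let near_ex t j : near_point t j -> exists j, near_point t j.
Proof. by exists j. Qed.

Let quantizerP t : (exists j, near_point t j) ->
  near_point t (quantizer t) /\ forall i, near_point t i -> (quantizer t <= i)%N.
Proof.
rewrite /quantizer => h; case: pselect => // h'.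
by case: ex_minnP => m hm mmin; split.
Qed.

Let quantizer_eq t s N : (exists j, near_point t j) -> (exists j, near_point s j) ->
  (quantizer t < N)%N -> (quantizer s < N)%N ->
  (forall j, (j < N)%N -> near_point t j = near_point s j) ->
  quantizer t = quantizer s.
Proof.
move=> /quantizerP[t1 t2] /quantizerP[s1 s2] tN sN h.
by apply/eqP; rewrite eqn_leq t2 ?h// s2// -h.
Qed.

Let near_point_measurable j : lebesgue_measurable [set t | near_point t j].
Proof.
apply: lebesgue_ltr; first exact: rescaled_dist_measurable.
by have [m _ _ _] := dtheta; exact: borel_fun_lebesgue.
Qed.

Lemma quantizer_measurable n : lebesgue_measurable (quantizer @^-1` [set n]).
Proof.
pose P j := [set t | near_point t j].
pose none := \bigcap_j ~` P j.
have mnone : lebesgue_measurable none.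
  by apply: bigcapT_measurable => j; apply: measurableC; exact: near_point_measurable.
pose first := P n `&` \bigcap_(j in [set j | (j < n)%N]) ~` P j.
have mfirst : lebesgue_measurable first.
  apply: measurableI; first exact: near_point_measurable.
  by apply: bigcap_measurableType => j _; apply: measurableC; exact: near_point_measurable.
suff -> : quantizer @^-1` [set n] = first `|` (if n == 0%N then none else set0).
  by apply: measurableU => //; case: ifP.
apply/seteqP; split => [t /= tn|t [[Pt nP]|]] /=.
- have [h|h] := pselect (exists j, near_point t j).
    have [] := quantizerP h; rewrite tn => h1 h2; left; split => // j /= jn.
    by move=> /h2; rewrite leqNgt jn.
  have n0 : n = 0%N by rewrite -tn /quantizer; case: pselect.
  by right; rewrite n0 /= => j _ /= Pj; apply: h; exists j.
- have [h1 h2] := quantizerP (near_ex Pt).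
  apply/eqP; rewrite eqn_leq h2// leqNgt; apply/negP => h3.
  exact: (nP _ h3).
- case: ifP => // /eqP -> h; rewrite /quantizer; case: pselect => // -[j Pj].
  by have := h j Logic.I.
Qed.

Lemma near_point_dist t j : near_point t j -> mdist (phi t) (v j) < eta.
Proof.
rewrite /near_point /rescaled_dist => h.
have [_ _ /(_ t) th _] := dtheta; move: th; rewrite ler_norml => /andP[_ th].
by rewrite -[eta]mul1r -ltr_pdivrMr//; lra.
Qed.

Lemma dist_near_point t j : mdist (phi t) (v j) < eta / 2 -> near_point t j.
Proof.
move=> h; rewrite /near_point /rescaled_dist.
have [_ _ /(_ t) th _] := dtheta; move: th; rewrite ler_norml => /andP[th _].
have : mdist (phi t) (v j) / eta < 1 / 2 by rewrite ltr_pdivrMr//; lra.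
lra.
Qed.

Hypothesis v_dense : ae_line (fun t => exists j, mdist (phi t) (v j) < eta / 2).
Hypothesis v_tight : forall gam, 0 < gam -> exists N, forall A,
  lebesgue_measurable A ->
  (forall t, A t -> forall j, (j < N)%N -> eta / 2 <= mdist (phi t) (v j)) ->
  mean_le (EFin \o \1_A) gam.

Let v_near : ae_line (fun t => exists j, near_point t j).
Proof. by apply: ae_lineS v_dense => t [j /dist_near_point]; exists j. Qed.

Lemma quantizer_dist : ae_line (fun t => mdist (phi t) (v (quantizer t)) < eta).
Proof.
by apply: ae_lineS v_near => t /quantizerP[h _]; exact: near_point_dist.
Qed.

Lemma quantizer_tail gam : 0 < gam ->
  exists N, mean_le (EFin \o \1_[set t | (N <= quantizer t)%N]) gam.
Proof.
move=> /v_tight[N hN]; exists N.+1; apply: hN; first exact: code_ge_measurable quantizer_measurable.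
move=> t /= tN j jN; rewrite leNgt; apply/negP => /dist_near_point h.
have [_ /(_ j h) hq] := quantizerP (near_ex h).
by move: (leq_trans tN hq); rewrite ltnNge (ltnW jN).
Qed.

Definition requantized (tau : R) : set R :=
  [set t | quantizer t != quantizer (t + tau)].

Lemma requantized_measurable tau : lebesgue_measurable (requantized tau).
Proof. exact: code_change_measurable quantizer_measurable. Qed.

(** The code of [t] is affected by the translation only if it is large before or
    after, if one of finitely many distances is near the threshold, or if [phi]
    is moved by a large amount. *)
Lemma requantized_small gam : 0 < gam -> exists2 e, 0 < e & forall tau,
  S e tau -> mean_le (EFin \o \1_(requantized tau)) gam.
Proof.
move=> gam0; have g0 : 0 < gam / 4 by rewrite divr_gt0.
have [N hN] := quantizer_tail g0.
pose d := gam / 4 / N.+1%:R.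
have d0 : 0 < d by rewrite divr_gt0.
have /choice[rho hrho] : forall j, exists rho, 0 < rho /\
    mean_le (EFin \o \1_(threshold_band theta phi eta (v j) rho)) d.
  by move=> j; have [rho ? ?] := threshold_band_small eta0 dtheta mphi phi_periods (v j) d0; exists rho.
pose r := \big[Num.min/1]_(j < N) rho j.
have r0 : 0 < r by apply: lt_bigmin => // j _; case: (hrho j).
have rle j : (j < N)%N -> r <= rho j.
  by move=> jN; exact: (bigmin_le 1 (Ordinal jN) (fun i : 'I_N => rho i)).
have [_ theta_bohr _ _] := dtheta.
have [|e1 e10 he1] := theta_bohr (r / 2); first by rewrite divr_gt0.
pose a := eta * r / 16.
have a0 : 0 < a by rewrite divr_gt0// mulr_gt0.
pose e := Num.min e1 (a * (gam / 4)).
have e0 : 0 < e by rewrite lt_min e10 mulr_gt0.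
exists e => // tau Stau.
have tt : forall t, `|theta (t + tau) - theta t| <= r / 2.
  by apply: he1; apply: S_le Stau; rewrite ge_min lexx.
pose far := [set t | (N <= quantizer t)%N].
pose bands := \bigcup_(j in [set j | (j < N)%N]) threshold_band theta phi eta (v j) (rho j).
have mfar : lebesgue_measurable far by exact: code_ge_measurable quantizer_measurable.
have mfar' : lebesgue_measurable (translate tau far) by exact: lebesgue_measurable_translate.
have mband j : lebesgue_measurable (threshold_band theta phi eta (v j) (rho j)).
  exact: (threshold_band_measurable eta dtheta mphi).
have mbands : lebesgue_measurable bands by apply: bigcup_measurable => j _; exact: mband.
have mmoved := moved_measurable mphi a tau.
have hbands : mean_le (EFin \o \1_bands) (N%:R * d).
  by apply: mean_le_indic_bigcup => // [|j _]; [exact: ltW|case: (hrho j)].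
have hmoved : mean_le (EFin \o \1_(moved phi a tau)) (e / a).
  exact: (moved_mean mphi phi_periods a0 e0 Stau).
have hfar' : mean_le (EFin \o \1_(translate tau far)) (gam / 4).
  exact: (mean_le_translate tau (nonneg_fun_indic mfar) hN).
have m1 := measurableU _ _ mfar mfar'.
have m2 := measurableU _ _ mbands mmoved.
have m3 := measurableU _ _ m1 m2.
have h1 := mean_le_indicU mfar mfar' hN hfar'.
have h2 := mean_le_indicU mbands mmoved hbands hmoved.
have h3 := mean_le_indicU m1 m2 h1 h2.
have le_gam : gam / 4 + gam / 4 + (N%:R * d + e / a) <= gam.
  have : N%:R * d <= gam / 4.
    rewrite /d mulrCA ler_piMr// ?(ltW g0)//.
    by rewrite ler_pdivrMr// mul1r ler_nat.
  have : e / a <= gam / 4.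
    by rewrite ler_pdivrMr// mulrC /e ge_min lexx orbT.
  lra.
apply: mean_leW le_gam _.
apply: (ae_mean_le _ (nonneg_fun_indic m3) _ h3).
  exact: nonneg_fun_indic (requantized_measurable tau).
apply: ae_lineS (ae_lineI v_near (ae_line_translate tau v_near)) => t [ne1 ne2].
rewrite /= !indicE lee_fin ler_nat.
case: (boolP (t \in requantized tau)) => //; rewrite inE => /eqP hq.
rewrite lt0b; apply/mem_set; apply: contrapT => h.
have {h}[[nfar nfar'] [nband nmoved]] : (~ far t /\ ~ translate tau far t) /\
    (~ bands t /\ ~ moved phi a tau t).
  by split; split => hh; apply: h; [left; left|left; right|right; left|right; right].
apply: hq; apply: (@quantizer_eq _ _ N) => //.
- by rewrite ltnNge; apply/negP.
- by rewrite ltnNge; apply/negP.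
move=> j jN.
have hb : rho j <= `|theta t - rescaled_dist phi eta (v j) t|.
  by rewrite leNgt; apply/negP => hb; apply: nband; exists j.
have := rescaled_dist_lipschitz phi eta0 (v j) t (t + tau).
have : 8 / eta * mdist (phi t) (phi (t + tau)) < r / 2.
  have -> : r / 2 = 8 / eta * a by rewrite /a; field; rewrite gt_eqF.
  rewrite ltr_pM2l ?divr_gt0// ltNge; apply/negP => hm; exact: nmoved.
have := tt t; have := rle j jN; rewrite /near_point.
set x := rescaled_dist _ _ _ _; set y := rescaled_dist _ _ _ _ => k1 k2 k3 k4.
move: k2 k4; rewrite !ler_norml => /andP[k2 k2'] /andP[k4 k4'].
move: hb; rewrite -/x ler_normr => /orP[hb|hb].
  have -> : x < theta t by lra.
  by apply/esym; lra.
have -> : (x < theta t) = false by apply/negbTE; rewrite -leNgt; lra.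
by apply/esym/negbTE; rewrite -leNgt; lra.
Qed.

End quantization.

(** The last property is the one for which the thresholds have to move: along
    [S] the codes do not only stay close, they stay equal up to a set of small
    upper mean. *)
Theorem quantization_exists (R : realType) (V : metricType R) (S : R -> set R)
    (theta : R -> R) (phi : R -> V) (eta : R) : 0 < eta -> dither S theta ->
  (forall e e', e <= e' -> S e `<=` S e') ->
  strongly_measurable phi -> almost_periods_in S phi -> tight phi ->
  exists (v : nat -> V) (q : R -> nat),
    [/\ forall n, lebesgue_measurable (q @^-1` [set n]),
        ae_line (fun t => mdist (phi t) (v (q t)) < eta),
        forall gam, 0 < gam ->
          exists N, mean_le (EFin \o \1_[set t | (N <= q t)%N]) gam &
        forall gam, 0 < gam -> exists2 e, 0 < e & forall tau, S e tau ->
          mean_le (EFin \o \1_[set t | q t != q (t + tau)]) gam].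
Proof.
move=> eta0 dtheta S_le mphi pphi tphi.
have eta20 : 0 < eta / 2 by rewrite divr_gt0.
have [v [v1 v2]] := tight_net mphi tphi eta20.
exists v, (quantizer theta phi eta v); split.
- exact: (quantizer_measurable eta dtheta mphi v).
- exact: (quantizer_dist eta0 dtheta v1).
- exact: (quantizer_tail eta0 dtheta mphi v2).
- exact: (requantized_small eta0 dtheta S_le mphi pphi v1 v2).
Qed.

(** * Uniform limits of functions of integer codes *)

Section simple_functions.
Context {R : realType}.

Lemma simple_function_comp (A B : Type) (G : A -> B) (s : R -> A) :
  simple_function s -> simple_function (G \o s).
Proof.
move=> [fs ms]; split.
  by apply: sub_finite_set (finite_image G fs) => _ [t _ <-]; exists (s t) => //; exists t.
move=> b; rewrite (_ : _ @^-1` _ = \bigcup_(a in range s `&` [set a | G a = b]) (s @^-1` [set a])).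
  apply: (@fin_bigcup_measurable _ (lebesgue_sets R)) => [|a _]; last exact: ms.
  exact: finite_setIl.
apply/seteqP; split => [t /= Gb|t [a [_ /= <-] /= ->]//].
by exists (s t) => //; split => //; exists t.
Qed.

Lemma simple_function_pair (A B : Type) (s : R -> A) (r : R -> B) :
  simple_function s -> simple_function r -> simple_function (fun t => (s t, r t)).
Proof.
move=> [fs ms] [fr mr]; split.
  apply: sub_finite_set (finite_setX fs fr) => _ [t _ <-].
  by split; exists t.
move=> [a b]; rewrite (_ : _ @^-1` _ = s @^-1` [set a] `&` r @^-1` [set b]).
  by apply: measurableI; [exact: ms|exact: mr].
by apply/seteqP; split => t /= [-> ->].
Qed.

Lemma simple_function_minn (q : R -> nat) N :
  (forall n, lebesgue_measurable (q @^-1` [set n])) ->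
  simple_function (fun t => minn (q t) N).
Proof.
move=> mq; split.
  apply: (@sub_finite_set _ _ `I_N.+1); last exact: finite_II.
  by move=> _ [t _ <-] /=; rewrite ltnS geq_minr.
move=> n; rewrite (_ : _ @^-1` _ = \bigcup_(m in [set m | minn m N = n]) (q @^-1` [set m])).
  by apply: bigcup_measurable => m _; exact: mq.
apply/seteqP; split => [t /= h|t [m /= <- /= ->]//].
by exists (q t).
Qed.

(** Truncated codes take finitely many values; the codes from rank [n] on, which
    [G] is not meant to read, are replaced by 0 so that a list encodes the
    rest. *)
Lemma simple_function_codes (A : Type) (Q : nat -> R -> nat) N n
    (G : (nat -> nat) -> A) :
  (forall k m, lebesgue_measurable (Q k @^-1` [set m])) ->
  simple_function (fun t => G (fun k => if (k < n)%N then minn (Q k t) N else 0%N)).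
Proof.
move=> mQ; pose code t := [seq minn (Q k t) N | k <- iota 0 n].
have sc : simple_function code.
  rewrite /code; elim: (iota 0 n) => [|k l IH]; first exact: simple_function_cst.
  exact: (simple_function_comp (fun p => p.1 :: p.2)
    (simple_function_pair (simple_function_minn N (mQ k)) IH)).
rewrite (_ : (fun t => _) = (fun l => G (nth 0%N l)) \o code).
  exact: simple_function_comp.
apply/funext => t /=; congr G; apply/funext => k.
case: ltnP => kn; last by rewrite nth_default// size_map size_iota.
by rewrite (nth_map 0%N) ?size_iota// nth_iota.
Qed.

End simple_functions.

Section coded_functions.
Context {R : realType} {U : metricType R}.
Variable S : R -> set R.
Hypothesis S_le : forall e e', e <= e' -> S e `<=` S e'.
Variables (Q : nat -> R -> nat) (G : nat -> (nat -> nat) -> U) (rho : nat -> R).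
Hypothesis mQ : forall k m, lebesgue_measurable (Q k @^-1` [set m]).
Hypothesis Q_tail : forall k gam, 0 < gam ->
  exists N, mean_le (EFin \o \1_[set t | (N <= Q k t)%N]) gam.
Hypothesis Q_periods : forall k gam, 0 < gam -> exists2 e, 0 < e &
  forall tau, S e tau -> mean_le (EFin \o \1_[set t | Q k t != Q k (t + tau)]) gam.
Hypothesis G_local : forall n c c', (forall k, (k <= n.+1)%N -> c k = c' k) ->
  G n c = G n c'.
Hypothesis rho0 : rho @ \oo --> 0.
Hypothesis G_gap : forall n c, mdist (G n c) (G n.+1 c) <= rho n - rho n.+1.

Variable f : R -> U.
Hypothesis f_close : forall t n, mdist (G n (Q ^~ t)) (f t) <= rho n.

Let trunc_code n N (t : R) : nat -> nat :=
  fun k => if (k < n)%N then minn (Q k t) N else 0%N.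

Let trunc_codeE n N t : (forall k, (k <= n.+1)%N -> (Q k t <= N)%N) ->
  G n (trunc_code n.+2 N t) = G n (Q ^~ t).
Proof.
move=> h; apply: G_local => k kn; rewrite /trunc_code ltnS kn.
by apply/minn_idPl; exact: h.
Qed.

Let rho_ge0 n : 0 <= rho n.
Proof. by apply: le_trans (f_close 0 n); exact: mdist_ge0. Qed.

Let G_gap_le n m c : (n <= m)%N -> mdist (G n c) (G m c) <= rho n.
Proof.
move=> nm; apply: (@le_trans _ _ (rho n - rho m)); last by rewrite gerBl.
elim: m nm => [|m IH]; first by rewrite leqn0 => /eqP ->; rewrite mdistxx subrr.
rewrite leq_eqVlt => /orP[/eqP <-|]; first by rewrite mdistxx subrr.
rewrite ltnS => /IH h; apply: le_trans (metric_triangle _ (G m c) _) _.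
by have := G_gap m c; lra.
Qed.

Lemma coded_strongly_measurable : strongly_measurable f.
Proof.
exists (fun N t => G N (trunc_code N.+2 N t)); split.
  by move=> N; exact: (simple_function_codes N N.+2 (G N) mQ).
apply: ae_lineT => t; apply/metric_cvgP => e e0.
have : \forall n \near \oo, rho n < e / 3 by apply: (cvgr_lt _ rho0); rewrite divr_gt0.
case=> m _ /(_ m (leqnn m)) rm.
pose M := \max_(k < m.+2) Q k t.
near=> N.
have mN : (m <= N)%N by near: N; exact: nbhs_infty_ge.
have MN : (M <= N)%N by near: N; exact: nbhs_infty_ge.
have h1 := f_close t m.
have h2 := G_gap_le (trunc_code N.+2 N t) mN.
have h3 : G m (trunc_code N.+2 N t) = G m (Q ^~ t).
  apply: G_local => k km; rewrite /trunc_code.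
  rewrite ifT; last by rewrite ltnS (leq_trans km)// ltnS.
  apply/minn_idPl; apply: leq_trans MN.
  by have := @leq_bigmax 'I_m.+2 (fun k => Q k t) (Ordinal (km : (k < m.+2)%N)).
rewrite metric_sym in h1.
apply: le_lt_trans (metric_triangle _ (G m (Q ^~ t)) _) _.
by rewrite -{2}h3; lra.
Unshelve. all: by end_near. Qed.

(** Off the rare set where one of the first codes is large, [f] is uniformly close
    to a function with finitely many values. *)
Lemma coded_tight : tight (f : R -> truncated U).
Proof.
move=> e d e0 d0.
have : \forall n \near \oo, rho n < e by exact: (cvgr_lt _ rho0).
case=> n _ /(_ n (leqnn n)) rn.
pose g := d / 2 / n.+2%:R.
have g0 : 0 < g by rewrite !divr_gt0.
have /choice[N hN] : forall k, exists N, mean_le (EFin \o \1_[set t | (N <= Q k t)%N]) g.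
  by move=> k; exact: Q_tail.
pose M := \max_(k < n.+2) N k.
pose s t := G n (trunc_code n.+2 M t) : truncated U.
have [fs _] : simple_function s := simple_function_codes M n.+2 (G n) mQ.
have mge k : lebesgue_measurable [set t | (N k <= Q k t)%N].
  by apply: code_ge_measurable => m; exact: mQ.
pose B := \bigcup_(k in [set k | (k < n.+2)%N]) [set t | (N k <= Q k t)%N].
have mB : lebesgue_measurable B by apply: bigcup_measurable => k _; exact: mge.
have hB : mean_le (EFin \o \1_B) (n.+2%:R * g).
  by apply: mean_le_indic_bigcup; [exact: ltW|exact: mge|move=> k _; exact: hN].
have s0 : range s !=set0 by exists (s 0), 0.
exists (range s); split => //; first exact: finite_compact.
have mf : strongly_measurable (f : R -> truncated U).
  exact/strongly_measurable_truncated/coded_strongly_measurable.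
pose A := [set t | e <= dist_set (f t : truncated U) (range s)].
have mA : lebesgue_measurable A.
  apply: lebesgue_ler; first exact: measurable_cst.
  exact: (dist_set_lebesgue_fun s0 mf).
apply: (@le_lt_trans _ _ (d / 2)%:E); last first.
  by rewrite lte_fin ltr_pdivrMr// ltr_pMr// ltr1n.
apply: (kappaW_le mA).
have <- : n.+2%:R * g = d / 2 by rewrite mulrC divfK.
apply: (mean_le_indicS mA mB _ hB) => t; rewrite /A /= leNgt => /negP hA.
apply: contrapT => nB; apply: hA.
apply: le_lt_trans rn; apply: le_trans (f_close t n).
rewrite metric_sym; apply: le_trans (truncated_mdist_le _ _).
apply: dist_set_le; exists t => //; rewrite /s trunc_codeE// => k kn.
apply: (@leq_trans (N k)); last first.
  by have := @leq_bigmax 'I_n.+2 (fun k => N k) (Ordinal (kn : (k < n.+2)%N)).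
by rewrite leqNgt; apply/negP => h; apply: nB; exists k => //=; exact: ltnW.
Qed.

(** Off the rare set where one of the first codes changes, [f] moves by at most
    [2 * rho n]. *)
Lemma coded_periods gam : 0 < gam -> exists2 e, 0 < e & forall tau, S e tau ->
  mean_le (mdist_fun (f : R -> truncated U) (shift (f : R -> truncated U) tau)) gam.
Proof.
move=> gam0.
have : \forall n \near \oo, rho n < gam / 4 by apply: (cvgr_lt _ rho0); rewrite divr_gt0.
case=> n _ /(_ n (leqnn n)) rn.
pose g := gam / 2 / n.+2%:R.
have g0 : 0 < g by rewrite !divr_gt0.
have /choice[e he] : forall k, exists e, 0 < e /\ forall tau, S e tau ->
    mean_le (EFin \o \1_[set t | Q k t != Q k (t + tau)]) g.
  by move=> k; have [e e0 he] := Q_periods k g0; exists e.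
pose m := \big[Num.min/1]_(k < n.+2) e k.
have m0 : 0 < m by apply: lt_bigmin => // k _; case: (he k).
exists m => // tau Stau.
pose ch k := [set t | Q k t != Q k (t + tau)].
have mch k : lebesgue_measurable (ch k).
  by apply: code_change_measurable => i; exact: mQ.
pose B := \bigcup_(k in [set k | (k < n.+2)%N]) ch k.
have mB : lebesgue_measurable B by apply: bigcup_measurable => k _; exact: mch.
have hB : mean_le (EFin \o \1_B) (n.+2%:R * g).
  apply: mean_le_indic_bigcup; [exact: ltW|exact: mch|move=> k kn].
  have [_ h] := he k; apply: h; apply: S_le Stau.
  exact: (bigmin_le 1 (Ordinal kn) (fun k : 'I_n.+2 => e k)).
have mf : strongly_measurable (f : R -> truncated U).
  exact/strongly_measurable_truncated/coded_strongly_measurable.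
have nB := nonneg_fun_indic mB.
have g2 : 0 <= gam / 2 by rewrite divr_ge0// ltW.
have nc := nonneg_fun_cst g2.
have {1}-> : gam = gam / 2 + n.+2%:R * g by rewrite (mulrC _ g) divfK// -splitr.
apply: (mean_leS _ (nonneg_funD nc nB) _ (mean_leD nc nB (mean_le_cst g2) hB)).
  exact: nonneg_mdist_fun (strongly_measurable_shift tau mf).
move=> t; rewrite /mdist_fun /Defs.shift /= /cst -EFinD lee_fin indicE.
case: (boolP (t \in B)) => [_|].
  by apply: le_trans (truncated_mdist_le1 _ _) _; rewrite lerDr.
move=> /negP tB; rewrite addr0; apply: le_trans (truncated_mdist_le _ _) _.
have E : G n (Q ^~ t) = G n (Q ^~ (t + tau)).
  apply: G_local => k kn; apply/eqP/negP => h; apply: tB; rewrite inE.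
  by exists k => //; apply/negP.
have h1 := f_close t n; have h2 := f_close (t + tau) n.
apply: le_trans (metric_triangle _ (G n (Q ^~ t)) _) _.
by rewrite metric_sym; rewrite -E in h2; lra.
Qed.

End coded_functions.

(** * Selections from coded closed sets *)

Section hausdorff.
Context {R : realType}.

(** For an unbounded set the supremum in the Hausdorff distance would be a default
    value and would bound nothing. *)
Lemma hausdorff_dist_lt (V : metricType R) (A B : set V) (e : R) x :
  metric_bounded A -> B !=set0 -> hausdorff_dist A B < e -> A x ->
  exists2 y, B y & mdist x y < e.
Proof.
move=> [M AM] B0; rewrite /hausdorff_dist gt_max => /andP[ABe _] Ax.
have xB : dist_set x B < e.
  apply: le_lt_trans ABe; apply: ub_le_sup; last by exists x.
  have [b Bb] := B0; exists (M + mdist x b) => _ [y Ay <-].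
  apply: le_trans (dist_set_le y Bb) _.
  by apply: le_trans (metric_triangle y x b) _; rewrite lerD2r AM.
have [_ [y By <-] xy] := inf_lt (dist_set_has_inf x B0).1 xB.
by exists y.
Qed.

Lemma closed_set_near (U : metricType R) (A B : closed_set U) (e : R) x : e <= 1 ->
  mdist A B < e -> closed_set_val A x ->
  exists2 y, closed_set_val B y & mdist x y < e.
Proof.
move=> e1 AB Ax.
have [y By xy] := @hausdorff_dist_lt (truncated U) _ _ e x
  (@truncated_bounded _ _ _) (closed_set_nonempty B) AB Ax.
by exists y => //; rewrite -(truncated_mdist_lt _ _ e1).
Qed.

End hausdorff.

Section selection.
Context {R : realType} {U : metricType R}.
Hypothesis cU : complete_space U.
Variables (S : R -> set R) (theta : R -> R).
Hypothesis dtheta : dither S theta.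
Hypothesis S_le : forall e e', e <= e' -> S e `<=` S e'.
Variables (g : R -> U) (F : R -> closed_set U).
Hypothesis mg : strongly_measurable (g : R -> truncated U).
Hypothesis pg : almost_periods_in S (g : R -> truncated U).
Hypothesis tg : tight (g : R -> truncated U).
Hypothesis mF : strongly_measurable F.
Hypothesis pF : almost_periods_in S F.
Hypothesis tF : tight F.

(** The sets coded at the scales [eta n] and [eta n.+1] are both near [F t], so a
    point of the first is nearer than the sum of the scales to some point of the
    second.  Moving along such points gives a limit in [F t], and the sum of all
    moves is a small multiple of the first scale. *)
Theorem almost_periodic_selection (delta : R) : 0 < delta -> exists f : R -> U,
  [/\ strongly_measurable f,
      tight (f : R -> truncated U),
      forall gam, 0 < gam -> exists2 e, 0 < e & forall tau, S e tau ->
        mean_le (mdist_fun (f : R -> truncated U) (shift (f : R -> truncated U) tau)) gam,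
      ae_line (fun t => closed_set_val (F t) (f t)) &
      ae_line (fun t => mdist (f t) (g t) <
                        dist_set (g t) (closed_set_val (F t)) + delta)].
Proof.
move=> delta0.
(* The final estimate adds seven errors of size [c]: the code of [g], which
   enters twice, the choice of [base], the coarsest code of [F], and
   [rho 0] = 3 * c for all moves. *)
pose c := Num.min 1 delta / 8.
have c0 : 0 < c by rewrite divr_gt0// lt_min ltr01.
have c1 : c <= 8^-1 by rewrite ler_pdivrMr// mulVf// ge_min lexx.
have cd : c <= delta / 8 by rewrite ler_pM2r// ge_min lexx orbT.
pose eta k := c / 2 ^+ k.
have eta0 k : 0 < eta k by rewrite divr_gt0// exprn_gt0.
have etaS k : eta k.+1 = eta k / 2 by rewrite /eta exprS invfM mulrCA mulrC.
have eta_le k : eta k <= 8^-1.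
  apply: le_trans c1; rewrite ler_pdivrMr ?exprn_gt0// ler_pMr//.
  by rewrite exprn_ege1// ler1n.
have [x [qg [mqg gx qg_tail qg_per]]] := quantization_exists c0 dtheta S_le mg pg tg.
have /choice[Cq hCq] : forall k, exists Cq : (nat -> closed_set U) * (R -> nat),
    [/\ forall n, lebesgue_measurable (Cq.2 @^-1` [set n]),
        ae_line (fun t => mdist (F t) (Cq.1 (Cq.2 t)) < eta k),
        forall gam, 0 < gam ->
          exists N, mean_le (EFin \o \1_[set t | (N <= Cq.2 t)%N]) gam &
        forall gam, 0 < gam -> exists2 e, 0 < e & forall tau, S e tau ->
          mean_le (EFin \o \1_[set t | Cq.2 t != Cq.2 (t + tau)]) gam].
  move=> k; have [C [q h]] := quantization_exists (eta0 k) dtheta S_le mF pF tF.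
  by exists (C, q).
pose C k := (Cq k).1; pose q k := (Cq k).2.
pose Q k := if k is m.+1 then q m else qg.
have /choice[base hbase] : forall ij : nat * nat, exists u,
    closed_set_val (C 0%N ij.2) u /\
    mdist (x ij.1 : U) u < dist_set (x ij.1 : U) (closed_set_val (C 0%N ij.2)) + c.
  move=> [i j] /=.
  have hi := dist_set_has_inf (x i : U) (closed_set_nonempty (C 0%N j)).
  by have [_ [u Cu <-] hu] := inf_adherent c0 hi; exists u.
(* A move from one coded set to the next, through [F t], takes up to
   [eta k + eta k.+1], which is [rho k - rho k.+1]. *)
pose rho k := 3 * eta k.
(* For the codes of almost every [t] the point [w] exists; for other codes, which
   [G] also has to accept, the point is left in place. *)
pose step k (u : U) (A : closed_set U) :=
  if pselect (exists w, closed_set_val A w /\ mdist u w < rho k - rho k.+1)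
  is left h then sval (cid h) else u.
pose G := fix G (n : nat) (code : nat -> nat) : U :=
  if n is m.+1 then step m (G m code) (C m.+1 (code m.+2))
  else base (code 0%N, code 1%N).
have rhoE k : rho k - rho k.+1 = eta k + eta k.+1 by rewrite /rho etaS; field.
have rho0 : rho @ \oo --> 0.
  rewrite (_ : rho = fun k => 3 * c * (2^-1) ^+ k); last first.
    by apply/funext => k; rewrite /rho /eta exprVn mulrA.
  rewrite -[0](mulr0 (3 * c)); apply: cvgM; first exact: cvg_cst.
  by apply: cvg_expr; rewrite ger0_norm// invf_lt1// ltr1n.
have G_gap n code : mdist (G n code) (G n.+1 code) <= rho n - rho n.+1.
  rewrite /= /step; case: pselect => [h|_]; first by case: cid => w /= [_ /ltW].
  by rewrite mdistxx rhoE addr_ge0// ltW.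
have G_local n code code' : (forall k, (k <= n.+1)%N -> code k = code' k) ->
    G n code = G n code'.
  elim: n => [|n IH] h /=; first by rewrite !h.
  by rewrite IH ?h// => k kn; rewrite h// ltnW.
have /choice[f hf] : forall t, exists l : U, G ^~ (Q ^~ t) @ \oo --> l /\
    forall n, mdist (G n (Q ^~ t)) l <= rho n.
  by move=> t; apply: telescoping_limit => // n; exact: G_gap.
have f_close t n : mdist (G n (Q ^~ t)) (f t) <= rho n by have [_] := hf t.
have mQ k m : lebesgue_measurable (Q k @^-1` [set m]).
  by case: k => [|k] /=; [exact: mqg|have [h _ _ _] := hCq k; exact: h].
have Q_tail k gam : 0 < gam ->
    exists N, mean_le (EFin \o \1_[set t | (N <= Q k t)%N]) gam.
  by case: k => [|k]; [exact: qg_tail|have [_ _ h _] := hCq k; exact: h].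
have Q_per k gam : 0 < gam -> exists2 e, 0 < e & forall tau, S e tau ->
    mean_le (EFin \o \1_[set t | Q k t != Q k (t + tau)]) gam.
  by case: k => [|k]; [exact: qg_per|have [_ _ _ h] := hCq k; exact: h].
have F_near : ae_line (fun t => forall k, mdist (F t) (C k (q k t)) < eta k).
  by apply: ae_line_forall => k; have [_ h _ _] := hCq k.
have G_in t : (forall k, mdist (F t) (C k (q k t)) < eta k) ->
    forall n, closed_set_val (C n (q n t)) (G n (Q ^~ t)).
  move=> Ft; elim=> [|n IH]; first by have [] := hbase (Q 0%N t, Q 1%N t).
  have eta1 k : eta k <= 1 by apply: le_trans (eta_le k) _; rewrite invf_le1// ler1n.
  rewrite /= /step; case: pselect => [h|]; first by case: cid => w [].
  case; have [|y Fy Gy] := closed_set_near (eta1 n) _ IH (B := F t).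
    by rewrite metric_sym; exact: Ft.
  have [w Cw yw] := closed_set_near (eta1 n.+1) (Ft n.+1) Fy.
  exists w; split => //; rewrite rhoE.
  by apply: le_lt_trans (metric_triangle _ y _) _; exact: ltrD.
exists f; split.
- exact: (coded_strongly_measurable mQ G_local rho0 G_gap f_close).
- exact: (coded_tight mQ Q_tail G_local rho0 G_gap f_close).
- exact: (coded_periods S_le mQ Q_per G_local rho0 G_gap f_close).
- apply: ae_lineS F_near => t Ft; apply: dist_set0_closed.
  + exact: closed_set_closed.
  + exact: closed_set_nonempty.
  apply/ler_addgt0Pr => e e0; rewrite add0r.
  have : \forall n \near \oo, rho n < e / 2 by apply: (cvgr_lt _ rho0); rewrite divr_gt0.
  case=> n _ /(_ n (leqnn n)) rn.
  have eta1 k : eta k <= 1 by apply: le_trans (eta_le k) _; rewrite invf_le1// ler1n.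
  have [|y Fy Gy] := closed_set_near (eta1 n) _ (G_in t Ft n) (B := F t).
    by rewrite metric_sym; exact: Ft.
  apply: le_trans (dist_set_le _ Fy) _.
  apply: le_trans (metric_triangle _ (G n (Q ^~ t)) _) _.
  have := f_close t n; rewrite metric_sym; have : eta n <= rho n by rewrite /rho; have := eta0 n; lra.
  lra.
- apply: ae_lineS (ae_lineI F_near gx) => t [Ft].
  rewrite (@truncated_mdist_lt _ _ (g t) (x (qg t))); last first.
    by apply: le_trans c1 _; rewrite invf_le1// ler1n.
  move=> gxt.
  have eta1 : c <= 1 by apply: le_trans c1 _; rewrite invf_le1// ler1n.
  have Ft0 : mdist (F t) (C 0%N (q 0%N t)) < c by have := Ft 0%N; rewrite /eta expr0 divr1.
  have [_ /= hb] := hbase (qg t, q 0%N t).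
  have := f_close t 0%N; rewrite /= /rho /eta expr0 divr1 metric_sym => hf0.
  have gC : dist_set (g t) (closed_set_val (C 0%N (q 0%N t))) <=
      dist_set (g t) (closed_set_val (F t)) + c.
    rewrite -lerBlDr; apply: lb_le_inf.
      exact: (dist_set_has_inf (g t) (closed_set_nonempty (F t))).1.
    move=> _ [y Fy <-]; rewrite lerBlDr.
    have [w Cw yw] := closed_set_near eta1 Ft0 Fy.
    apply: le_trans (dist_set_le _ Cw) _.
    by apply: le_trans (metric_triangle _ y _) _; rewrite lerD2l ltW.
  have xC := dist_set_triangle (x (qg t) : U) (g t) (closed_set_nonempty (C 0%N (q 0%N t))).
  have t1 := metric_triangle (f t) (base (qg t, q 0%N t)) (g t).
  have t2 := metric_triangle (base (qg t, q 0%N t)) (x (qg t) : U) (g t).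
  rewrite (metric_sym (x (qg t) : U) (g t)) in xC t2.
  rewrite (metric_sym (base _) (x (qg t) : U)) in t2.
  have := delta0; lra.
Qed.

End selection.

(** * Functions of order p *)

Section restricted_means.
Context {R : realType}.
Implicit Types (T : set R) (u v : R -> \bar R).

Lemma restrict_le u T t : (forall t, 0 <= u t)%E -> ((u \_ T) t <= u t)%E.
Proof. by move=> u0; rewrite /patch; case: ifP. Qed.

Lemma stepanov_bounded_restrict u T : lebesgue_measurable T -> nonneg_fun u ->
  stepanov_bounded u -> stepanov_bounded (u \_ T).
Proof.
move=> mT nu; apply: (stepanov_boundedS (nonneg_fun_restrict mT nu) nu).
by move=> t; apply: restrict_le; exact: nu.2.
Qed.

Lemma sup_mean_restrict_lim_le u T c : lebesgue_measurable T -> nonneg_fun u ->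
  stepanov_bounded u -> mean_le (u \_ T) c ->
  (lim (sup_mean T u l @[l --> +oo%R]) <= c%:E)%E.
Proof.
move=> mT nu bu hc.
have -> : sup_mean T u = sup_mean setT (u \_ T).
  by apply/funext => l; exact: sup_mean_restrict.
exact: (sup_mean_lim_le (nonneg_fun_restrict mT nu) (stepanov_bounded_restrict mT nu bu) hc).
Qed.

Lemma sup_mean_restrict_lim_lt u T c : lebesgue_measurable T -> nonneg_fun u ->
  stepanov_bounded u -> (lim (sup_mean T u l @[l --> +oo%R]) < c%:E)%E ->
  mean_le (u \_ T) c.
Proof.
move=> mT nu bu.
have -> : sup_mean T u = sup_mean setT (u \_ T).
  by apply/funext => l; exact: sup_mean_restrict.
exact: (sup_mean_lim_lt (nonneg_fun_restrict mT nu) (stepanov_bounded_restrict mT nu bu)).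
Qed.

Lemma Mstar_mean (V : metricType R) (p : R) (v0 : V) (f : R -> V) eps :
  Mstar p v0 f -> 0 < eps -> exists2 delta, 0 < delta & forall T c,
    lebesgue_measurable T -> c < delta -> mean_le (EFin \o \1_T) c ->
    mean_le (dist_pow p f (cst v0) \_ T) eps.
Proof.
move=> [Mf hM] eps0; have [delta d0 hd] := hM _ eps0; exists delta => // T c mT cd hc.
have [mf _] := (MpP _ _ _).1 Mf.
apply: (sup_mean_restrict_lim_lt mT
  (nonneg_dist_pow p mf (strongly_measurable_cst v0)) (Mp_dist_pow_bounded Mf)).
apply: hd => //; apply: le_lt_trans (kappaW_le mT hc) _.
by rewrite lte_fin.
Qed.

End restricted_means.

Section bounded_selections.
Context {R : realType} {U : metricType R}.

Lemma bounded_closed_set_dist (u0 : U) (B0 : bounded_closed_set U) :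
  exists2 c : R, 0 <= c & forall (B : bounded_closed_set U) x,
    bounded_closed_set_val B x -> mdist x u0 <= mdist B B0 + c.
Proof.
have [M hM] := bounded_closed_set_bounded B0.
have [b Bb] := bounded_closed_set_nonempty B0.
exists (M + mdist b u0).
  by rewrite addr_ge0 ?mdist_ge0// (le_trans _ (hM _ _ Bb Bb))// mdist_ge0.
move=> B x Bx; apply/ler_addgt0Pr => e e0.
have [|y By xy] := @hausdorff_dist_lt R U _ _ (mdist B B0 + e) x
    (bounded_closed_set_bounded B) (bounded_closed_set_nonempty B0) _ Bx.
  by rewrite /mdist/= /bounded_closed_set_mdist ltrDl.
have := hM y b By Bb; have := metric_triangle x y u0; have := metric_triangle y b u0.
lra.
Qed.

(** By [bounded_closed_set_dist], the [p]-th power of the distance of [f t] from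
    [u0] is bounded by a multiple of that of [Fb t] from [B0] plus a constant,
    and the means of a constant over sets of small density are small. *)
Lemma selection_Mstar (p : R) (u0 : U) (B0 : bounded_closed_set U)
    (Fb : R -> bounded_closed_set U) (f : R -> U) : 1 <= p ->
  strongly_measurable f -> ae_line (fun t => bounded_closed_set_val (Fb t) (f t)) ->
  Mstar p B0 Fb -> Mstar p u0 f.
Proof.
move=> p1 mf fF MFb; have p0 : 0 < p by apply: lt_le_trans p1.
have [MF _] := MFb; have [mFb bF] := (MpP _ _ _).1 MF.
have [c c0 hc] := bounded_closed_set_dist u0 B0.
have nf := nonneg_dist_pow p mf (strongly_measurable_cst u0).
have nF := nonneg_dist_pow p mFb (strongly_measurable_cst B0).
set w := dist_pow p Fb (cst B0) in nF bF.
have cp0 : 0 <= c `^ p by exact: powR_ge0.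
have p20 : 0 < 2 `^ p by rewrite powR_gt0.
have dom : ae_line (fun t => (dist_pow p f (cst u0) t <= (2 `^ p)%:E * (w t + (c `^ p)%:E))%E).
  apply: ae_lineS fF => t Ft; rewrite /w /dist_pow -EFinD -EFinM lee_fin.
  apply: le_trans (powR_add_le (mdist_ge0 _ _) c0 (ltW p0)).
  apply: ge0_ler_powR; rewrite ?nnegrE ?addr_ge0 ?mdist_ge0// ?(ltW p0)//.
  exact: hc.
have nc := nonneg_fun_cst cp0.
have bf : stepanov_bounded (dist_pow p f (cst u0)).
  apply: (ae_stepanov_bounded nf (nonneg_funZ (ltW p20) (nonneg_funD nF nc)) dom).
  apply: (stepanov_boundedZ (ltW p20) (nonneg_funD nF nc)).
  exact: (stepanov_boundedD nF nc bF (stepanov_bounded_cst cp0)).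
split; first by apply/MpP.
move=> eps eps0.
pose e1 := eps / (4 * 2 `^ p).
have e10 : 0 < e1 by rewrite divr_gt0// mulr_gt0.
have [d1 d10 hd1] := Mstar_mean MFb e10.
pose d := Num.min d1 (e1 / (c `^ p + 1)).
have d0 : 0 < d by rewrite lt_min d10 divr_gt0// ltr_wpDl.
exists (d / 2); first by rewrite divr_gt0.
move=> T mT kT; have hT := kappaW_lt mT kT.
have hw : mean_le (w \_ T) e1.
  apply: (hd1 T (d / 2) mT _ hT); apply: (@lt_le_trans _ _ d).
    by rewrite ltr_pdivrMr// ltr_pMr// ltr1n.
  by rewrite /d ge_min lexx.
have n1 := nonneg_fun_restrict mT nF.
have n2 := nonneg_funZ cp0 (nonneg_fun_indic mT).
apply: (@le_lt_trans _ _ (eps / 2)%:E); last first.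
  by rewrite lte_fin ltr_pdivrMr// ltr_pMr// ltr1n.
apply: (sup_mean_restrict_lim_le mT nf bf).
have le_eps : 2 `^ p * (e1 + c `^ p * (d / 2)) <= eps / 2.
  have : c `^ p * (d / 2) <= e1.
    have : d * (c `^ p + 1) <= e1.
      by rewrite -ler_pdivlMr ?ltr_wpDl// /d ge_min lexx orbT.
    nra.
  move=> h; apply: (@le_trans _ _ (2 `^ p * (e1 + e1))); first by rewrite ler_pM2l// lerD2l.
  by rewrite le_eqVlt; apply/orP; left; apply/eqP; rewrite /e1; field; rewrite gt_eqF.
apply: (mean_leW le_eps).
apply: (ae_mean_le (nonneg_fun_restrict mT nf) (nonneg_funZ (ltW p20) (nonneg_funD n1 n2))).
  apply: ae_lineS dom => t; rewrite /patch /= indicE; case: (boolP (t \in T)) => tT h.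
    by rewrite mule1.
  by rewrite mule0 adde0 mule0.
apply: (mean_leZ (ltW p20) (nonneg_funD n1 n2)); apply: (mean_leD n1 n2 hw).
exact: (mean_leZ cp0 (nonneg_fun_indic mT) hT).
Qed.

End bounded_selections.

Section truncated_topology.
Context {R : realType} {U : metricType R}.

Lemma truncated_nbhs (x : U) (N : set U) : nbhs x N -> nbhs (x : truncated U) N.
Proof.
rewrite -filter_from_ballE => -[e /= e0 eN].
have e1 : 0 < Num.min 1 e by rewrite lt_min ltr01.
apply: filterS (nbhsx_ballx (x : truncated U) _ e1) => y.
rewrite ballEmdist /= (truncated_mdist_lt x y) ?ge_min ?lexx// lt_min => /andP[_ xy].
by apply: eN; rewrite ballEmdist.
Qed.

Lemma truncated_compact (K : set U) : compact (K : set (truncated U)) -> compact K.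
Proof.
move=> cK G PG GK; have [x [Kx clx]] := cK G PG GK.
by exists x; split => // A B GA /truncated_nbhs; exact: clx.
Qed.

Lemma truncated_dist_set_lt (x : U) (K : set U) (e : R) : e <= 1 -> K !=set0 ->
  dist_set (x : truncated U) K < e -> dist_set x K < e.
Proof.
move=> e1 K0 xK.
have [_ [y Ky <-]] := inf_lt (dist_set_has_inf (x : truncated U) K0).1 xK.
by rewrite (truncated_mdist_lt x y e1); apply: le_lt_trans; exact: dist_set_le.
Qed.

End truncated_topology.

Section order_p.
Context {R : realType} {U : metricType R}.

Lemma relatively_denseS (A B : set R) : A `<=` B -> relatively_dense A -> relatively_dense B.
Proof.
by move=> AB [a a0 ha]; exists a => // xi; have [t [It At]] := ha xi; exists t; split => //; exact: AB.
Qed.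

(** Where [f] and its translate are closer than [a], the [p]-th power of their
    distance is below [a `^ p].  The other points form a set of small density by
    Chebyshev's inequality, on which the [p]-th powers of the distances from
    [u0] have a small mean, for [f] and likewise for the translate. *)
Lemma Mstar_periods (p : R) (u0 : U) (f : R -> U) eps : 1 <= p ->
  Mstar p u0 f -> 0 < eps -> exists2 e, 0 < e & periods_trunc e f `<=` periods p eps f.
Proof.
move=> p1 Mf eps0; have p0 : 0 < p by apply: lt_le_trans p1.
have [Mpf _] := Mf; have [mf bf] := (MpP _ _ _).1 Mpf.
have mft := (strongly_measurable_truncated f).2 mf.
pose c := (eps / 2) `^ p.
have c0 : 0 < c by rewrite powR_gt0// divr_gt0.
have cE : c `^ p^-1 < eps.
  rewrite /c -powRrM mulfV ?gt_eqF// powRr1 ?divr_ge0 ?(ltW eps0)//.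
  by rewrite ltr_pdivrMr// ltr_pMr// ltr1n.
have p20 : 0 < 2 `^ p by rewrite powR_gt0.
pose e1 := c / (4 * 2 `^ p).
have e10 : 0 < e1 by rewrite divr_gt0// mulr_gt0.
have [d d0 hd] := Mstar_mean Mf e10.
pose a := Num.min 1 ((c / 4) `^ p^-1).
have a0 : 0 < a by rewrite lt_min ltr01 powR_gt0// divr_gt0.
have a1 : a <= 1 by rewrite ge_min lexx.
have ap : a `^ p <= c / 4.
  have -> : c / 4 = ((c / 4) `^ p^-1) `^ p.
    by rewrite -powRrM mulVf ?gt_eqF// powRr1// divr_ge0// ltW.
  by apply: ge0_ler_powR; rewrite ?nnegrE ?powR_ge0 ?(ltW a0) ?(ltW p0)// ge_min lexx orbT.
exists (a * d); first by rewrite mulr_gt0.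
move=> tau /(periods_mean (Mp_truncated u0 mf))[b bd hb].
have mfs := strongly_measurable_shift tau mf.
have Mps := Mp_shift tau Mpf.
pose T : set R := [set t | a <= mdist (f t : truncated U) (f (t + tau))].
have mT : lebesgue_measurable T := moved_measurable mft a tau.
have ntr := nonneg_mdist_fun mft (strongly_measurable_shift tau mft).
have hT : mean_le (EFin \o \1_T) (b / a).
  have := mean_le_superlevel ntr a0 hb.
  by congr (mean_le (EFin \o \1_ _) _); apply/seteqP; split.
have bad : b / a < d by rewrite ltr_pdivrMr// mulrC.
have mc := strongly_measurable_cst u0.
have nf := nonneg_dist_pow p mf mc.
pose T' := translate (- tau) T.
have mT' : lebesgue_measurable T' := lebesgue_measurable_translate (- tau) mT.
have hT' : mean_le (EFin \o \1_T') (b / a).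
  exact: (mean_le_translate (- tau) (nonneg_fun_indic mT) hT).
have h1 := hd T _ mT bad hT.
have h2 := hd T' _ mT' bad hT'.
have n1 := nonneg_fun_restrict mT nf.
have n2' := nonneg_fun_restrict mT' nf.
have n2 := nonneg_fun_translate tau n2'.
have {}h2 := mean_le_translate tau n2' h2.
have nn := nonneg_dist_pow p mf mfs.
apply: (Dp_lt p0 nn (Mp_stepanov (ltW p0) Mpf Mps) (ltW c0) _ cE).
have ap0 : 0 <= a `^ p by exact: powR_ge0.
have na := nonneg_fun_cst ap0.
have nz := nonneg_funZ (ltW p20) (nonneg_funD n1 n2).
have le_c : a `^ p + 2 `^ p * (e1 + e1) <= c.
  have -> : 2 `^ p * (e1 + e1) = c / 2 by rewrite /e1; field; rewrite gt_eqF.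
  lra.
apply: (mean_leW le_c).
apply: (mean_leS nn (nonneg_funD na nz)); last first.
  apply: (mean_leD na nz (mean_le_cst ap0)).
  exact: (mean_leZ (ltW p20) (nonneg_funD n1 n2) (mean_leD n1 n2 h1 h2)).
move=> t; have [Tt|nTt] := pselect (T t); last first.
  apply: (@le_trans _ _ (cst (a `^ p)%:E t)); last by rewrite leeDl//; exact: nz.2.
  rewrite /dist_pow /cst lee_fin; apply: ge0_ler_powR.
  - exact: ltW.
  - by rewrite nnegrE mdist_ge0.
  - by rewrite nnegrE ltW.
  - apply: ltW; rewrite -(truncated_mdist_lt (f t) _ a1) ltNge; exact/negP.
apply: (@le_trans _ _ (((2 `^ p)%:E * (((dist_pow p f (cst u0)) \_ T) t +
    ((dist_pow p f (cst u0)) \_ T') (t + tau)%R))%E)); last by rewrite leeDr//; exact: na.2.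
rewrite /patch !mem_set//; last by rewrite /T' /translate/= addrK.
exact: (dist_pow_triangle f (shift f tau) (cst u0) t (ltW p0)).
Qed.

Lemma Wtilde_Mstar_Wtilde_p (p : R) (u0 : U) : 1 <= p ->
  Wtilde u0 `&` Mstar p u0 `<=` Wtilde_p p u0.
Proof.
move=> p1 f [[Mf perf tf] MSf]; have [Mpf _] := MSf.
have [mf _] := (MpP _ _ _).1 Mpf.
split; first exact: Mpf.
  move=> eps eps0; have [e e0 he] := Mstar_periods p1 MSf eps0.
  exact: relatively_denseS he (perf e e0).
move=> eps delta eps0 delta0.
pose e := Num.min 1 eps; have e0 : 0 < e by rewrite lt_min ltr01.
have d2 : 0 < delta / 2 by rewrite divr_gt0.
have [K [cK K0 kK]] := tf e (delta / 2) e0 d2.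
exists K; split; [exact: truncated_compact|exact: K0|].
have mft := (strongly_measurable_truncated f).2 mf.
have mA : lebesgue_measurable [set t | eps <= @dist_set R U (f t) K].
  apply: lebesgue_ler; first exact: measurable_cst.
  exact: (@dist_set_lebesgue_fun R U f K K0 mf).
have mB : lebesgue_measurable [set t | e <= dist_set (f t : truncated U) K].
  apply: lebesgue_ler; first exact: measurable_cst.
  exact: (dist_set_lebesgue_fun K0 mft).
apply: (@le_lt_trans _ _ (delta / 2)%:E); last first.
  by rewrite lte_fin ltr_pdivrMr// ltr_pMr// ltr1n.
apply: (kappaW_le mA); apply: (mean_le_indicS mA mB _ (kappaW_lt mB kK)) => t /=.
have e1 : e <= 1 by rewrite ge_min lexx.
move=> h; rewrite leNgt; apply/negP => h2.
have := @truncated_dist_set_lt R U (f t) K e e1 K0 h2.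
by rewrite ltNge => /negP; apply; apply: le_trans h; rewrite ge_min lexx orbT.
Qed.

End order_p.

(** * Selections along the common almost periods *)

Theorem theorem3 (R : realType) (U : metricType R)
    (u0 : U) (C0 : closed_set U) (B0 : bounded_closed_set U)
    (g : R -> U) (F : R -> closed_set U) :
  complete_space U ->
  Wtilde u0 g ->
  Wtilde_p 1 C0 F ->
  (forall eps : R, 0 < eps -> relatively_dense (common_periods g F eps)) ->
  forall (delta : R) (h : R -> R^o),
    0 < delta -> Wp 1 (0 : R^o) h -> dense (Mod h) ->
    [/\ countable (Mod h),
        forall eps : R, 0 < eps ->
          relatively_dense (common_periods g F eps `&` periods 1 eps h) &
        exists f : R -> U,
          [/\ Wtilde u0 f,
              ae_line (fun t => closed_set_val (F t) (f t)),
              ae_line (fun t => mdist (f t) (g t) <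
                                dist_set (g t) (closed_set_val (F t)) + delta),
              forall eps' : R, 0 < eps' -> exists2 eps : R, 0 < eps &
                common_periods g F eps `&` periods 1 eps h `<=` periods_trunc eps' f &
              forall (p : R) (Fb : R -> bounded_closed_set U), 1 <= p ->
                (forall t, bounded_closed_set_val (Fb t) =
                           closed_set_val (F t)) ->
                Mstar p B0 Fb ->
                (Wtilde u0 `&` Mstar p u0) f /\
                Wtilde u0 `&` Mstar p u0 `<=` Wtilde_p p u0]].
Proof.
move=> cU [Mg _ tg] [MF _ tF] T_dense delta h delta0 Wh dMod.
have [mg _] := (MpP _ _ _).1 Mg; have [mF _] := (MpP _ _ _).1 MF.
have [Mh _] := Wh.
pose S e := common_periods g F e `&` periods 1 e h.
have S_dense e : 0 < e -> relatively_dense (S e).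
  apply: (common_relatively_dense Wh T_dense) => {}e tau tau' [gt Ft] [gt' Ft'].
  rewrite (splitr e); split.
    exact: (periodsD Mg gt (periodsN Mg gt')).
  exact: (periodsD MF Ft (periodsN MF Ft')).
have S_le e e' : e <= e' -> S e `<=` S e'.
  by move=> ee' tau [[gt Ft] ht]; split; [split|];
    [exact: (periods_le ee' gt)|exact: (periods_le ee' Ft)|exact: (periods_le ee' ht)].
have S0 e : 0 < e -> S e 0.
  by move=> e0; split; [split|];
    [exact: (periods0 Mg e0)|exact: (periods0 MF e0)|exact: (periods0 Mh e0)].
have SD e e' tau tau' : S e tau -> S e' tau' -> S (e + e') (tau + tau').
  move=> [[gt Ft] ht] [[gt' Ft'] ht']; split; [split|].
  - exact: (periodsD Mg gt gt').
  - exact: (periodsD MF Ft Ft').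
  - exact: (periodsD Mh ht ht').
have pg : almost_periods_in S (g : R -> truncated U).
  by move=> e tau e0 [[/(periods_mean Mg)[c ce hc] _] _]; exact: (mean_leW (ltW ce) hc).
have pF : almost_periods_in S F.
  by move=> e tau e0 [[_ /(periods_mean MF)[c ce hc]] _]; exact: (mean_leW (ltW ce) hc).
have [theta dtheta] : exists theta : R -> R, dither S theta.
  apply: dither_exists => // m m0.
  have [lam [/=]] : (`]0, m[%classic `&` Mod h) !=set0.
    apply: dMod; last exact: itv_open.
    by exists (m / 2); rewrite /= in_itv/= divr_gt0//= ltr_pdivrMr// ltr_pMr// ltr1n.
  rewrite in_itv/= => lam0m Mlam; exists lam => //.
  by apply: (Mod_moduli_dominated Wh _ Mlam) => e tau [].
have [f [mf tf pf fF fg]] :=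
  almost_periodic_selection cU dtheta S_le mg pg tg mF pF tF delta0.
have Mf := Mp_truncated u0 mf.
have f_periods eps : 0 < eps -> exists2 e, 0 < e & S e `<=` periods_trunc eps f.
  move=> eps0; have e2 : 0 < eps / 2 by rewrite divr_gt0.
  have [e e0 he] := pf _ e2; exists e => // tau /he.
  by apply: (mean_periods Mf); rewrite ltr_pdivrMr// ltr_pMr// ltr1n.
have Wf : Wtilde u0 f.
  split; [exact: Mf| |exact: tf] => eps eps0.
  have [e e0 he] := f_periods _ eps0.
  exact: (relatively_denseS he (S_dense e e0)).
split; [exact: (Mod_countable Wh)|exact: S_dense|].
exists f; split; [exact: Wf|exact: fF|exact: fg|exact: f_periods|].
move=> p Fb p1 FbF MFb; split; last exact: (Wtilde_Mstar_Wtilde_p p1).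
split; first exact: Wf.
apply: (selection_Mstar u0 p1 mf _ MFb).
by apply: ae_lineS fF => t; rewrite FbF.
Qed.
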